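(* Suppose that the relativistic charged-particle system $$\frac{dx}{d\tau}=v,\qquad \frac{dt}{d\tau}=w,\qquad \frac{dv}{d\tau}=v\times B(x)-i\,w\,E(x),\qquad \frac{dw}{d\tau}=i\,E(x)\cdot v$$ has sufficiently smooth solutions and that $B(x)$ and $E(x)$ are sufficiently differentiable. Assume further that $B$ and $E$ are locally Lipschitz continuous with Lipschitz constant $L$. Let ${\bm y}=(x;t)$ and ${\bm u}=(v;w)$ denote the exact solution, let $\tau_n=nh$, and let ${\bm y}_n=(x_n;t_n)$, ${\bm u}_n=(v_n;w_n)$ be the numerical solution produced with step size $h$ by any one of the two-step symmetric methods M1, M2, M3, M4 (defined in the context), started from the exact initial values. If the step size satisfies $h\le h_0$ for a constant $h_0>0$, then the global errors satisfy $$|{\bm y}_{n+1}-{\bm y}(\tau_{n+1})|\le Ch^2,\qquad |{\bm u}_{n+1}-{\bm u}(\tau_{n+1})|\le Ch^2\qquad\text{for } (n+1)h\le T,$$ where $C>0$ is a generic constant independent of $h$ and $n$, but depending on $L$ and $T$.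
   Context: **System.** $A:\mathbb{R}^3\to\mathbb{R}^3$ and $U:\mathbb{R}^3\to\mathbb{R}$ are smooth, $B=\nabla\times A$, $E=-\nabla U$. The unknowns are $x(\tau),v(\tau)\in\mathbb{R}^3$ and purely imaginary scalars $t(\tau),w(\tau)\in i\mathbb{R}$ (with $t=i\bar t$, $w=i\gamma$, where $\bar t$ is time and $\gamma$ the relativistic factor, $\tau$ the proper time). We write ${\bm y}=(x;t)=(x^{\intercal},t)^{\intercal}$, ${\bm u}=(v;w)=(v^{\intercal},w)^{\intercal}$, and $|\cdot|$ is the Euclidean norm. **Matrices.** For $b\in\mathbb{R}^3$ let $\tilde b$ be the skew-symmetric $3\times3$ matrix with $\tilde b\,\alpha=\alpha\times b$ for all $\alpha\in\mathbb{R}^3$; thus $\tilde B(x)$, $\tilde E(x)$ are the matrices associated with $B(x)$, $E(x)$. Let $${\bm F}(x)=\begin{pmatrix}\tilde B(x)&-iE(x)\\ iE(x)^{\intercal}&0\end{pmatrix}\in\mathbb{C}^{4\times4}.$$ **Coefficients.** Let $r_1=E^{\intercal}E-B^{\intercal}B$, $r_2=-E^{\intercal}B$, $d=\sqrt{r_1^2+4r_2^2}$, $\lambda_1=(r_1+d)/2$, $\lambda_2=(r_1-d)/2$ (all functions of $x$), and, with $k=h/2$, $$K_1=\frac{\sqrt{\lambda_1}\tanh(k\sqrt{\lambda_1})-\sqrt{\lambda_2}\tanh(k\sqrt{\lambda_2})}{d},\qquad K_2=\frac{r_2}{d}\Big(\frac{\tanh(k\sqrt{\lambda_1})}{\sqrt{\lambda_1}}-\frac{\tanh(k\sqrt{\lambda_2})}{\sqrt{\lambda_2}}\Big),$$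 $$K_3=\tfrac12\Big(1-\frac{r_1}{d}\Big)\operatorname{sech}(k\sqrt{\lambda_1})+\tfrac12\Big(1+\frac{r_1}{d}\Big)\operatorname{sech}(k\sqrt{\lambda_2}),\qquad K_4=\frac{\operatorname{sech}(k\sqrt{\lambda_1})-\operatorname{sech}(k\sqrt{\lambda_2})}{d},$$ removable singularities being filled in by continuity (i.e. by the corresponding power series in $h$). These are such that $\tanh(\frac h2{\bm F})=K_1{\bm F}+K_2\hat{\bm F}$ with $\hat{\bm F}=\begin{pmatrix}\tilde E&iB\\-iB^{\intercal}&0\end{pmatrix}$, and $\operatorname{sech}(\frac h2{\bm F})=K_3{\bm I}+K_4{\bm F}^2$. Write $K_j(x)$ for the value at $x$, $S_j=K_j(x_0)$ for $j=1,\dots,4$, and $B_0=B(x_0)$. **Abbreviations.** $\delta^2x_n=\frac{x_{n+1}-2x_n+x_{n-1}}{h^2}$, $\delta x_n=\frac{x_{n+1}-x_{n-1}}{2h}$, and similarly $\delta^2t_n$, $\delta t_n$. All methods start from initial values $(x_0;t_0)$, $(v_0;w_0)$ and the starting value $(x_1;t_1)=(x_0;t_0)+h\,e^{\frac h2{\bm F}(x_0)}(v_0;w_0)$; the two-step recursions below are used for $n\ge1$. **M1.** $$\delta^2x_n=\tfrac2h\big(K_1(x_n)\tilde B(x_n)+K_2(x_n)\tilde E(x_n)\big)\delta x_n-\tfrac{2}{h}i\big(K_1(x_n)E(x_n)-K_2(x_n)B(x_n)\big)\delta t_n,$$ $$\delta^2t_n=\tfrac{2}{h}i\big(K_1(x_n)E(x_n)^{\intercal}-K_2(x_n)B(x_n)^{\intercal}\big)\delta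 x_n,$$ with momentum $(v_{n+1};w_{n+1})=e^{\frac h2{\bm F}(x_{n+1})}e^{\frac h2{\bm F}(x_n)}(v_n;w_n)$ for $n\ge0$. **M2.** $$\delta^2x_n=\tfrac2h\big(S_1\tilde B(x_n)+S_2\tilde E(x_n)\big)\delta x_n-\tfrac{2i}{h}\big(S_1E(x_n)-S_2B_0\big)\delta t_n,\qquad \delta^2t_n=\tfrac{2i}{h}\big(S_1E(x_n)^{\intercal}-S_2B_0^{\intercal}\big)\delta x_n,$$ with momentum, for $n\ge1$, $$v_n=\big(S_3I+S_4(\tilde B(x_n)^2+E(x_n)E(x_n)^{\intercal})\big)\delta x_n-iS_4\tilde B(x_n)E(x_n)\,\delta t_n,$$ $$w_n=iS_4E(x_n)^{\intercal}\tilde B(x_n)\,\delta x_n+\big(S_3+S_4E(x_n)^{\intercal}E(x_n)\big)\delta t_n.$$ **M3.** $\delta^2x_n=\tfrac2hS_1\big(\tilde B(x_n)\delta x_n-iE(x_n)\delta t_n\big)$, $\ \delta^2t_n=\tfrac{2i}{h}S_1E(x_n)^{\intercal}\delta x_n$, with momentum $v_n=S_3\,\delta x_n$, $w_n=S_3\,\delta t_n$ for $n\ge1$. **M4.** $\delta^2x_n=\tilde B(x_n)\delta x_n-iE(x_n)\delta t_n$, $\ \delta^2t_n=iE(x_n)^{\intercal}\delta x_n$, with momentum $v_n=\delta x_n$, $w_n=\delta t_n$ for $n\ge1$. *)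

(* Defs.v *)
From HB Require Import structures.
From mathcomp Require Import all_boot all_order all_algebra.
From mathcomp Require Import all_classical all_reals all_analysis.
From mathcomp Require Import complex.

Set Implicit Arguments.
Unset Strict Implicit.
Unset Printing Implicit Defensive.

Import Order.TTheory GRing.Theory Num.Theory.
Import numFieldNormedType.Exports.

Local Open Scope classical_set_scope.
Local Open Scope ring_scope.
Local Open Scope complex_scope.

Notation MtoC := (map_mx (real_complex _)).

Section Calculus.
Context {R : realType}.

Definition l2norm n (p : 'cV[R]_n) : R := Num.sqrt (\sum_i p i 0 ^+ 2).

Definition l2normC n (z : 'cV[R[i]]_n) : R :=
  Num.sqrt (\sum_i ComplexField.Normc.normc (z i 0) ^+ 2).

(* Class C^k on D, meant for open D: all iterated directional derivatives of
   order at most k exist and are continuous at every point of D. *)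
Fixpoint Ck_on (V W : normedModType R) (D : set V) (k : nat) (f : V -> W)
    {struct k} : Prop :=
  (forall p, D p -> {for p, continuous f}) /\
  if k is k'.+1 then
    (forall p v, D p -> derivable f p v) /\
    (forall v, Ck_on D k' (fun p => 'D_v f p))
  else True.

(* R[i] carries no normed module structure over R, so a complex-valued function
   of a real variable is differentiated through its real and imaginary parts. *)
Definition is_cderive (f : R -> R[i]) (s : R) (df : R[i]) : Prop :=
  is_derive s 1 (fun r => complex.Re (f r)) (complex.Re df) /\
  is_derive s 1 (fun r => complex.Im (f r)) (complex.Im df).

Definition lipschitz_near (L : R) (f : 'cV[R]_3 -> 'cV[R]_3) (p : 'cV[R]_3) :
    Prop :=
  exists2 r : R, 0 < r & forall p1 p2 : 'cV[R]_3,
    l2norm (p1 - p) < r -> l2norm (p2 - p) < r ->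
    l2norm (f p1 - f p2) <= L * l2norm (p1 - p2).

Definition partial (j : 'I_3) (f : 'cV[R]_3 -> R) (p : 'cV[R]_3) : R :=
  'D_(delta_mx j 0) f p.

Definition vec3 (a b c : R) : 'cV[R]_3 := \col_i [:: a; b; c]`_i.

Definition i1 : 'I_3 := @Ordinal 3 0 isT.
Definition i2 : 'I_3 := @Ordinal 3 1 isT.
Definition i3 : 'I_3 := @Ordinal 3 2 isT.

Definition cross (a b : 'cV[R]_3) : 'cV[R]_3 :=
  vec3 (a i2 0 * b i3 0 - a i3 0 * b i2 0)
       (a i3 0 * b i1 0 - a i1 0 * b i3 0)
       (a i1 0 * b i2 0 - a i2 0 * b i1 0).

Definition dot (a b : 'cV[R]_3) : R := (a^T *m b) 0 0.

Definition curl (A : 'cV[R]_3 -> 'cV[R]_3) (p : 'cV[R]_3) : 'cV[R]_3 :=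
  let D j k := partial j (fun q => A q k 0) p in
  vec3 (D i2 i3 - D i3 i2) (D i3 i1 - D i1 i3) (D i1 i2 - D i2 i1).

Definition grad (U : 'cV[R]_3 -> R) (p : 'cV[R]_3) : 'cV[R]_3 :=
  \col_j partial j U p.

Definition cexp (z : R[i]) : R[i] :=
  (expR (complex.Re z))%:C * (cos (complex.Im z) +i* sin (complex.Im z)).
Definition ctanh (z : R[i]) : R[i] :=
  (cexp z - cexp (- z)) / (cexp z + cexp (- z)).
Definition csech (z : R[i]) : R[i] := 2 / (cexp z + cexp (- z)).

End Calculus.

Definition expm (K : numFieldType) n (M : 'M[K]_n.+1) : 'M[K]_n.+1 :=
  limn (series (fun j : nat => (j`!%:R)^-1 *: M ^+ j)).

Section FieldMatrices.
Context {R : realType}.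
Implicit Types (b e : 'cV[R]_3) (h : R).

(* The matrix of the linear map a |-> a x b. *)
Definition tilde b : 'M[R]_3 := \matrix_(j, k) cross (delta_mx k 0) b j 0.

Lemma tilde_mul b (a : 'cV[R]_3) : tilde b *m a = cross a b.
Proof.
apply/colP => j; rewrite mxE !big_ord_recl big_ord0.
rewrite (_ : lift ord0 ord0 = i2) 1?(_ : lift ord0 (lift ord0 ord0) = i3);
  try exact/val_inj.
rewrite (_ : ord0 = i1); last exact/val_inj.
case: j => -[|[|[|//]]] jlt; rewrite /tilde /cross /vec3 !mxE /= ?eqxx /=.
all: rewrite ?(mul0r, mul1r, subr0, sub0r, oppr0, add0r, addr0, mulNr).
all: by rewrite ![b _ _ * _]mulrC // addrC.
Qed.

Definition Fmx b e : 'M[R[i]]_(3 + 1) :=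
  block_mx (MtoC (tilde b)) (- 'i *: MtoC e) ('i *: MtoC e^T) 0.

Definition r1 b e : R := dot e e - dot b b.
Definition r2 b e : R := - dot e b.
Definition dd b e : R := Num.sqrt (r1 b e ^+ 2 + 4 * r2 b e ^+ 2).
(* lambda2 <= 0, hence the complex square roots. *)
Definition sq1 b e : R[i] := sqrtc ((r1 b e + dd b e) / 2)%:C.
Definition sq2 b e : R[i] := sqrtc ((r1 b e - dd b e) / 2)%:C.

(* When dd = 0 both eigenvalues vanish and the values k, 0, 1, - k^2 / 2 are
   the limits of the general expressions.  In K2 with dd != 0, a vanishing
   eigenvalue forces r2 = 0, so the convention x / 0 = 0 yields the limit 0. *)
Definition K1 h b e : R[i] :=
  let k := (h / 2)%:C in
  if dd b e == 0 then k else
  (sq1 b e * ctanh (k * sq1 b e) - sq2 b e * ctanh (k * sq2 b e)) / (dd b e)%:C.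
Definition K2 h b e : R[i] :=
  let k := (h / 2)%:C in
  if dd b e == 0 then 0 else
  (r2 b e / dd b e)%:C *
    (ctanh (k * sq1 b e) / sq1 b e - ctanh (k * sq2 b e) / sq2 b e).
Definition K3 h b e : R[i] :=
  let k := (h / 2)%:C in
  if dd b e == 0 then 1 else
  2^-1 * (1 - r1 b e / dd b e)%:C * csech (k * sq1 b e) +
  2^-1 * (1 + r1 b e / dd b e)%:C * csech (k * sq2 b e).
Definition K4 h b e : R[i] :=
  let k := (h / 2)%:C in
  if dd b e == 0 then - (k ^+ 2) / 2 else
  (csech (k * sq1 b e) - csech (k * sq2 b e)) / (dd b e)%:C.

End FieldMatrices.

(* I = R for a solution of the system, I = nat for a numerical solution. *)
Record trajectory (R : realType) (I : Type) := Trajectory {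
  trj_x : I -> 'cV[R]_3;
  trj_t : I -> R[i];
  trj_v : I -> 'cV[R]_3;
  trj_w : I -> R[i]
}.

Section System.
Context {R : realType}.
Variables (B E : 'cV[R]_3 -> 'cV[R]_3).

Definition yvec I (s : trajectory R I) (n : I) : 'cV[R[i]]_(3 + 1) :=
  col_mx (MtoC (trj_x s n)) (trj_t s n)%:M.
Definition uvec I (s : trajectory R I) (n : I) : 'cV[R[i]]_(3 + 1) :=
  col_mx (MtoC (trj_v s n)) (trj_w s n)%:M.

Definition smooth_trajectory (J : set R) (k : nat) (s : trajectory R R) : Prop :=
  [/\ Ck_on J k (trj_x s : R^o -> _), Ck_on J k (trj_v s : R^o -> _),
      Ck_on J k ((fun r => complex.Re (trj_t s r)) : R^o -> R^o) /\
      Ck_on J k ((fun r => complex.Im (trj_t s r)) : R^o -> R^o) &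
      Ck_on J k ((fun r => complex.Re (trj_w s r)) : R^o -> R^o) /\
      Ck_on J k ((fun r => complex.Im (trj_w s r)) : R^o -> R^o)].

Definition is_solution (J : set R) (s : trajectory R R) : Prop :=
  forall r, J r ->
  [/\ complex.Re (trj_t s r) = 0 /\ complex.Re (trj_w s r) = 0,
      is_derive r 1 (trj_x s) (trj_v s r),
      is_cderive (trj_t s) r (trj_w s r),
      forall j : 'I_3, is_cderive (fun r' => MtoC (trj_v s r') j 0) r
        ((MtoC (cross (trj_v s r) (B (trj_x s r)))
          - ('i * trj_w s r) *: MtoC (E (trj_x s r))) j 0) &
      is_cderive (trj_w s) r ('i * (dot (E (trj_x s r)) (trj_v s r))%:C)].

Definition diff2 (K : fieldType) (V : lmodType K) (h : K) (f : nat -> V) n : V :=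
  (h ^+ 2)^-1 *: (f n.+1 - 2 *: f n + f n.-1).
Definition diff1 (K : fieldType) (V : lmodType K) (h : K) (f : nat -> V) n : V :=
  (2 * h)^-1 *: (f n.+1 - f n.-1).

Inductive method := M1 | M2 | M3 | M4.

Definition position_step (m : method) (h : R) (s : trajectory R nat) (n : nat) :
    Prop :=
  let b := B (trj_x s n) in let e := E (trj_x s n) in
  let b0 := B (trj_x s 0%N) in let e0 := E (trj_x s 0%N) in
  let S1 := K1 h b0 e0 in let S2 := K2 h b0 e0 in
  let dx := MtoC (diff1 h (trj_x s) n) in let dt := diff1 h%:C (trj_t s) n in
  let ddx := MtoC (diff2 h (trj_x s) n) in let ddt := diff2 h%:C (trj_t s) n in
  match m with
  | M1 =>
    ddx = (2 / h%:C) *: ((K1 h b e *: MtoC (tilde b)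
                          + K2 h b e *: MtoC (tilde e)) *m dx)
          - (2 / h%:C * 'i * dt) *: (K1 h b e *: MtoC e - K2 h b e *: MtoC b)
    /\ ddt = 2 / h%:C * 'i *
         ((K1 h b e *: MtoC e^T - K2 h b e *: MtoC b^T) *m dx) 0 0
  | M2 =>
    ddx = (2 / h%:C) *: ((S1 *: MtoC (tilde b) + S2 *: MtoC (tilde e)) *m dx)
          - (2 * 'i / h%:C * dt) *: (S1 *: MtoC e - S2 *: MtoC b0)
    /\ ddt = 2 * 'i / h%:C * ((S1 *: MtoC e^T - S2 *: MtoC b0^T) *m dx) 0 0
  | M3 =>
    ddx = (2 / h%:C * S1) *: (MtoC (tilde b) *m dx - ('i * dt) *: MtoC e)
    /\ ddt = 2 * 'i / h%:C * S1 * (MtoC e^T *m dx) 0 0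
  | M4 =>
    ddx = MtoC (tilde b) *m dx - ('i * dt) *: MtoC e
    /\ ddt = 'i * (MtoC e^T *m dx) 0 0
  end.

(* Determines (v_{n+1}; w_{n+1}). *)
Definition momentum_step (m : method) (h : R) (s : trajectory R nat) (n : nat) :
    Prop :=
  let b := B (trj_x s n.+1) in let e := E (trj_x s n.+1) in
  let b0 := B (trj_x s 0%N) in let e0 := E (trj_x s 0%N) in
  let S3 := K3 h b0 e0 in let S4 := K4 h b0 e0 in
  let dx := MtoC (diff1 h (trj_x s) n.+1) in let dt := diff1 h%:C (trj_t s) n.+1 in
  match m with
  | M1 => uvec s n.+1 =
      expm ((h / 2)%:C *: Fmx b e)
      *m expm ((h / 2)%:C *: Fmx (B (trj_x s n)) (E (trj_x s n))) *m uvec s n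
  | M2 =>
    MtoC (trj_v s n.+1) =
      (S3%:M + S4 *: MtoC (tilde b *m tilde b + e *m e^T)) *m dx
      - ('i * S4 * dt) *: MtoC (tilde b *m e)
    /\ trj_w s n.+1 =
      'i * S4 * (MtoC (e^T *m tilde b) *m dx) 0 0
      + (S3 + S4 * (dot e e)%:C) * dt
  | M3 => MtoC (trj_v s n.+1) = S3 *: dx /\ trj_w s n.+1 = S3 * dt
  | M4 => MtoC (trj_v s n.+1) = dx /\ trj_w s n.+1 = dt
  end.

(* The recursion is required only as far as needed to produce
   y_n and u_n for n h <= T; for M2, M3 and M4 the last momentum uses the next
   position, hence the step is required for all n h <= T. *)
Definition is_numerical_solution (m : method) (h T : R) (s : trajectory R nat) :
    Prop :=
  [/\ yvec s 1%N = yvec s 0%N +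
        h%:C *: (expm ((h / 2)%:C *: Fmx (B (trj_x s 0%N)) (E (trj_x s 0%N)))
                 *m uvec s 0%N),
      forall n : nat, (0 < n)%N -> n%:R * h <= T -> position_step m h s n &
      forall n : nat, n.+1%:R * h <= T -> momentum_step m h s n].

End System.

(* Main.v *)
Require Import Defs.
From HB Require Import structures.
From mathcomp Require Import all_boot all_order all_algebra.
From mathcomp Require Import all_classical all_reals all_analysis.
From mathcomp Require Import complex ring lra.

(** All four methods are treated as one two-step recursion for the complex vector
    [Y = (x; t)].  With the field matrix [F] of the system [U' = F U] for [U = (v; w)],
    every recursion has the form
      [Y_(n+1) - 2 Y_n + Y_(n-1) = h / 2 * G_n (Y_(n+1) - Y_(n-1))]
    with [G_n = F(x_n) + O(h ^+ 2)] ([position_step_matrix], [step_matrix_bound]).  This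
    rests on the size of the coefficients: the eigenvalues [lambda_1 >= 0] and
    [lambda_2 <= 0] of [F ^+ 2] have difference [d] and opposite signs, so the quotients
    by [d] stay bounded as the eigenvalues merge, and [K1 = h / 2 + O(h ^+ 3)], [K2 = O(h ^+ 3)],
    [K3 = 1 + O(h ^+ 2)], [K4 = O(h ^+ 2)] hold uniformly for bounded fields
    ([K1_bound] to [K4_bound]).

    By Taylor expansion the exact orbit satisfies the recursion up to [O(h ^+ 4)] and the
    starting value is exact up to [O(h ^+ 3)] ([step_error], [start_error]).  The quantity
    [h |e_n| + |e_n - e_(n-1)|] built from the error [e_n = Y_n - Y(t_n)] therefore grows
    by a factor [1 + O(h)] per step and stays [O(h ^+ 3)] ([two_step_stability]).  So
    the error is [O(h ^+ 2)], its increments are [O(h ^+ 3)], and the numerical positions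
    never leave the tube around the orbit where the fields are Lipschitz continuous, which
    is what the induction needs to continue ([lipschitz_tube]).

    For the last three methods the momentum is [(1 + O(h ^+ 2))] applied to the central
    difference of [Y], whose error is that of two increments divided by [2 h]
    ([difference_momentum_error]).  For the first method the product of two exponentials
    agrees with the trapezoidal rule up to [O(h ^+ 3)] ([exp_product_local_error]), and
    a one-step argument concludes ([exponential_momentum_error]). *)

Set Implicit Arguments.
Unset Strict Implicit.
Unset Printing Implicit Defensive.

Import Order.TTheory GRing.Theory Num.Theory.
Import numFieldNormedType.Exports ComplexField.Normc.

Local Open Scope classical_set_scope.
Local Open Scope ring_scope.

(** * Entrywise norms of complex vectors and matrices *)

Section ComplexModulus.
Context {R : realType}.
Implicit Types (x y : R) (z : R[i]).

Lemma normc_ge0 z : 0 <= normc z.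
Proof. by case: z => x y; exact: sqrtr_ge0. Qed.

Lemma normc_real x : normc (real_complex R x) = `|x|.
Proof. by rewrite /= expr0n addr0 sqrtr_sqr. Qed.

Lemma normc_imag : normc (Complex 0 1 : R[i]) = 1.
Proof. by rewrite /= expr0n add0r expr1n sqrtr1. Qed.

Lemma le_Re_normc z : `|complex.Re z| <= normc z.
Proof.
case: z => x y /=; rewrite -sqrtr_sqr ler_wsqrtr // lerDl sqr_ge0 //.
Qed.

Lemma le_Im_normc z : `|complex.Im z| <= normc z.
Proof.
case: z => x y /=; rewrite -sqrtr_sqr ler_wsqrtr // lerDr sqr_ge0 //.
Qed.

Lemma normc_le_ReIm z : normc z <= `|complex.Re z| + `|complex.Im z|.
Proof.
case: z => x y /=; rewrite -[leRHS]ger0_norm ?addr_ge0 // -sqrtr_sqr.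
rewrite ler_wsqrtr // sqrrD !real_normK ?num_real // lerD2r lerDl.
by rewrite mulrn_wge0 // mulr_ge0.
Qed.

End ComplexModulus.

Section EntryNorm.
Context {R : realType}.

(** The entrywise l1 norm: it is submultiplicative without any factor depending on the
    size, dominates the Euclidean norm, and takes values in [R] rather than in [R[i]]. *)
Definition nrm m n (A : 'M[R[i]]_(m, n)) : R := \sum_i \sum_j normc (A i j).

Lemma nrm_ge0 m n (A : 'M[R[i]]_(m, n)) : 0 <= nrm A.
Proof. by do 2![apply: sumr_ge0 => ? _]; exact: normc_ge0. Qed.

Lemma normc_le_nrm m n (A : 'M[R[i]]_(m, n)) i j : normc (A i j) <= nrm A.
Proof.
rewrite /nrm (bigD1 i) //= (bigD1 j) //= -addrA lerDl.
by rewrite addr_ge0 // !sumr_ge0 // => *; rewrite ?sumr_ge0 // => *; exact: normc_ge0.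
Qed.

Lemma nrm_le_entries m n (A : 'M[R[i]]_(m, n)) c :
  (forall i j, normc (A i j) <= c) -> nrm A <= (m * n)%:R * c.
Proof.
move=> Ac; apply: (@le_trans _ _ (\sum_(i < m) \sum_(j < n) c)).
  by apply: ler_sum => i _; apply: ler_sum => j _; exact: Ac.
by rewrite !sumr_const !card_ord -mulrnA mulr_natl mulnC.
Qed.

Lemma nrm0 m n : nrm (0 : 'M[R[i]]_(m, n)) = 0.
Proof. by rewrite /nrm !big1 // => i _; rewrite big1 // => j _; rewrite mxE normc0. Qed.

Lemma nrmD m n (A B : 'M[R[i]]_(m, n)) : nrm (A + B) <= nrm A + nrm B.
Proof.
rewrite /nrm -big_split; apply: ler_sum => i _ /=.
by rewrite -big_split; apply: ler_sum => j _ /=; rewrite mxE le_normcD.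
Qed.

Lemma nrmZ m n a (A : 'M[R[i]]_(m, n)) : nrm (a *: A) = normc a * nrm A.
Proof.
rewrite /nrm mulr_sumr; apply: eq_bigr => i _.
by rewrite mulr_sumr; apply: eq_bigr => j _; rewrite mxE normcM.
Qed.

Lemma nrmN m n (A : 'M[R[i]]_(m, n)) : nrm (- A) = nrm A.
Proof.
by do 2![apply: eq_bigr => ? _]; rewrite mxE normcN.
Qed.

Lemma nrmB m n (A B : 'M[R[i]]_(m, n)) : nrm (A - B) <= nrm A + nrm B.
Proof. by rewrite (le_trans (nrmD _ _)) // nrmN. Qed.

Lemma nrm_triangle m n (A B C : 'M[R[i]]_(m, n)) :
  nrm (A - C) <= nrm (A - B) + nrm (B - C).
Proof. by rewrite (le_trans _ (nrmD _ _)) // addrA subrK. Qed.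

Lemma normc_sum (I : finType) (F : I -> R[i]) :
  normc (\sum_i F i) <= \sum_i normc (F i).
Proof.
elim/big_ind2: _ => [|x1 x2 y1 y2 h1 h2|//]; first by rewrite normc0.
by rewrite (le_trans (le_normcD _ _)) // lerD.
Qed.

Lemma nrmM m n p (A : 'M[R[i]]_(m, n)) (B : 'M[R[i]]_(n, p)) :
  nrm (A *m B) <= nrm A * nrm B.
Proof.
rewrite /nrm mulr_suml; apply: ler_sum => i _.
apply: (@le_trans _ _ (\sum_j \sum_k normc (A i k) * normc (B k j))).
  apply: ler_sum => j _; rewrite mxE (le_trans (normc_sum _)) //.
  by apply: ler_sum => k _; rewrite normcM.
rewrite exchange_big /= mulr_suml; apply: ler_sum => k _.
rewrite -mulr_sumr ler_wpM2l ?normc_ge0 //.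
rewrite [leRHS](bigD1 k) //= lerDl.
by do 2![apply: sumr_ge0 => ? _]; exact: normc_ge0.
Qed.

Lemma nrm_le_mul m n p (A : 'M[R[i]]_(m, n)) (B : 'M[R[i]]_(n, p)) a b :
  nrm A <= a -> nrm B <= b -> nrm (A *m B) <= a * b.
Proof.
by move=> Aa Bb; rewrite (le_trans (nrmM _ _)) // ler_pM ?nrm_ge0.
Qed.

Lemma nrm_col_mx m1 m2 n (A : 'M[R[i]]_(m1, n)) (B : 'M[R[i]]_(m2, n)) :
  nrm (col_mx A B) = nrm A + nrm B.
Proof.
rewrite /nrm big_split_ord /=; congr (_ + _).
  by do 2![apply: eq_bigr => ? _]; rewrite col_mxEu.
by do 2![apply: eq_bigr => ? _]; rewrite col_mxEd.
Qed.

Lemma l2normC_le_nrm n (z : 'cV[R[i]]_n) : l2normC z <= nrm z.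
Proof.
rewrite /l2normC /nrm.
under [leRHS]eq_bigr do rewrite big_ord1.
suff H (F : 'I_n -> R) : (forall i, 0 <= F i) ->
    \sum_i F i ^+ 2 <= (\sum_i F i) ^+ 2.
  have F0 i : 0 <= normc (z i 0) by exact: normc_ge0.
  rewrite (le_trans (ler_wsqrtr (H _ F0))) //.
  by rewrite sqrtr_sqr ger0_norm // sumr_ge0.
move=> F0; rewrite expr2 mulr_suml; apply: ler_sum => i _.
rewrite expr2 ler_wpM2l // (bigD1 i) //= lerDl sumr_ge0 //.
Qed.

Lemma abs_le_l2norm n (p : 'cV[R]_n) i : `|p i 0| <= l2norm p.
Proof.
rewrite -sqrtr_sqr ler_wsqrtr // (bigD1 i) //= lerDl sumr_ge0 // => *.
exact: sqr_ge0.
Qed.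

Lemma l2norm_ge0 n (p : 'cV[R]_n) : 0 <= l2norm p.
Proof. exact: sqrtr_ge0. Qed.

Lemma l2norm0 n : l2norm (0 : 'cV[R]_n) = 0.
Proof. by rewrite /l2norm big1 ?sqrtr0 // => i _; rewrite mxE expr0n. Qed.

Lemma l2normN n (p : 'cV[R]_n) : l2norm (- p) = l2norm p.
Proof. by rewrite /l2norm; congr Num.sqrt; apply: eq_bigr => i _; rewrite mxE sqrrN. Qed.

Lemma l2normC_MtoC n (p : 'cV[R]_n) : l2norm p = l2normC (MtoC p).
Proof.
rewrite /l2norm /l2normC; congr Num.sqrt; apply: eq_bigr => i _.
by rewrite mxE normc_real real_normK ?num_real.
Qed.

Lemma l2norm_le_nrm n (p : 'cV[R]_n) : l2norm p <= nrm (MtoC p).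
Proof. by rewrite l2normC_MtoC l2normC_le_nrm. Qed.

Lemma nrm_MtoC_le n (p : 'cV[R]_n) : nrm (MtoC p) <= n%:R * l2norm p.
Proof.
rewrite -[X in X%:R]muln1; apply: nrm_le_entries => i j.
by rewrite mxE ord1 normc_real abs_le_l2norm.
Qed.

End EntryNorm.

Section ColumnEntries.
Variables (K : pzRingType) (p : nat).
Implicit Types (u v : 'cV[K]_p).

Lemma col_entryD u v j : (u + v) j 0 = u j 0 + v j 0. Proof. by rewrite mxE. Qed.
Lemma col_entryN u j : (- u) j 0 = - u j 0. Proof. by rewrite mxE. Qed.
Lemma col_entryZ k u j : (k *: u) j 0 = k * u j 0. Proof. by rewrite mxE. Qed.

(** Unlike [mxE], these rules leave the entries of matrix products as atoms, so that
    an identity between linear combinations of vectors becomes one for [ring]. *)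
Definition col_entryE := (col_entryD, col_entryN, col_entryZ).

End ColumnEntries.

(** * The field matrix *)

Section FieldMatrixBounds.
Context {R : realType}.
Implicit Types b e : 'cV[R]_3.

Lemma tildeE b : tilde b =
  \matrix_(j, k) [:: [:: 0; b i3 0; - b i2 0]`_k;
                     [:: - b i3 0; 0; b i1 0]`_k;
                     [:: b i2 0; - b i1 0; 0]`_k]`_j.
Proof.
apply/matrixP => j k; rewrite /tilde /cross /vec3 !mxE.
by case: j => -[|[|[|//]]] jlt; case: k => -[|[|[|//]]] klt;
   rewrite /= ?(mul0r, mul1r, subr0, sub0r, oppr0, mul1r).
Qed.

Lemma tildeB b b' : tilde (b - b') = tilde b - tilde b'.
Proof.
apply/matrixP => j k; rewrite !tildeE !mxE.
by case: j => -[|[|[|//]]] jlt; case: k => -[|[|[|//]]] klt /=; ring.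
Qed.

Lemma tilde_le b j k : `|tilde b j k| <= l2norm b.
Proof.
rewrite tildeE !mxE.
by case: j => -[|[|[|//]]] jlt; case: k => -[|[|[|//]]] klt;
   rewrite /= ?normr0 ?normrN ?l2norm_ge0 ?abs_le_l2norm.
Qed.

Lemma FmxB b e b' e' : Fmx b e - Fmx b' e' = Fmx (b - b') (e - e').
Proof.
rewrite /Fmx opp_block_mx add_block_mx tildeB !map_mxB oppr0 addr0.
by congr block_mx; rewrite ?linearB ?map_mxB -?scalerN -scalerDr.
Qed.

Lemma nrm_Fmx b e : nrm (Fmx b e) <= 16 * (l2norm b + l2norm e).
Proof.
have b0 := l2norm_ge0 b; have e0 := l2norm_ge0 e.
apply: nrm_le_entries => i j; rewrite /Fmx /block_mx.
rewrite -(splitK i) -(splitK j).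
case: (fintype.split i) => i'; case: (fintype.split j) => j' /=.
- rewrite col_mxEu row_mxEl mxE normc_real.
  by rewrite (le_trans (tilde_le _ _ _)) // lerDl.
- rewrite col_mxEu row_mxEr mxE normcM normcN normc_imag mul1r mxE normc_real.
  by rewrite ord1 (le_trans (abs_le_l2norm _ _)) // lerDr.
- rewrite col_mxEd row_mxEl mxE normcM normc_imag mul1r !mxE normc_real.
  by rewrite ord1 (le_trans (abs_le_l2norm _ _)) // lerDr.
- by rewrite col_mxEd row_mxEr mxE normc0 addr_ge0.
Qed.

End FieldMatrixBounds.

Section BlockAlgebra.
Variables (K : fieldType) (i : K).
Implicit Types (t : 'M[K]_3) (u : 'cV[K]_3) (r : 'rV[K]_3).

(** The shape of the field matrix over an arbitrary field, where the block computations
    are purely algebraic. *)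
Definition block_field t u r : 'M[K]_(3 + 1) :=
  block_mx t (- i *: u) (i *: r) 0.

Lemma block_field_col t u r (dx : 'cV[K]_3) (dt : K) :
  block_field t u r *m col_mx dx dt%:M =
  col_mx (t *m dx - (i * dt) *: u) (i * (r *m dx) 0 0)%:M.
Proof.
rewrite /block_field mul_block_col mul0mx addr0; congr col_mx.
  by rewrite mul_mx_scalar scalerA mulrN scaleNr [dt * _]mulrC.
apply/matrixP => j k; rewrite !ord1 -scalemxAl [LHS]mxE [RHS]mxE eqxx.
by [].
Qed.

(** The right-hand sides of the recursions, recognised as the action of a combination
    of two field matrices; the second one has the roles of the two fields exchanged. *)
Lemma block_field_combination (k1 k2 c1 c2 c3 : K) t1 t2 u1 u2 r1 r2
    (dx : 'cV[K]_3) (dt : K) : c2 = c1 * i * dt -> c3 = c1 * i ->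
  ((c1 * k1) *: block_field t1 u1 r1 + (c1 * k2) *: block_field t2 (- u2) (- r2))
    *m col_mx dx dt%:M =
  col_mx (c1 *: ((k1 *: t1 + k2 *: t2) *m dx) - c2 *: (k1 *: u1 - k2 *: u2))
         (c3 * ((k1 *: r1 - k2 *: r2) *m dx) 0 0)%:M.
Proof.
move=> -> ->; rewrite mulmxDl -!scalemxAl !block_field_col !scale_col_mx add_col_mx.
congr col_mx.
  rewrite mulmxDl -!scalemxAl !scalerBr !scalerN !scalerDr !scalerA addrACA.
  rewrite opprK opprB; congr (_ + _); rewrite addrC.
  by congr (_ *: _ - _ *: _); ring.
have mxD (x y : 'M[K]_1) : (x + y) 0 0 = x 0 0 + y 0 0 by rewrite mxE.
have mxZ c (x : 'M[K]_1) : (c *: x) 0 0 = c * x 0 0 by rewrite mxE.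
rewrite !scale_scalar_mx -raddfD mulmxBl -!scalemxAl mulNmx.
by congr (_%:M); rewrite -!scaleN1r mxD !mxZ; ring.
Qed.

Lemma block_field_quadratic (k3 k4 : K) t u r (dx : 'cV[K]_3) (dt : K) :
  i * i = -1 ->
  (k3%:M + k4 *: (block_field t u r *m block_field t u r)) *m col_mx dx dt%:M =
  col_mx ((k3%:M + k4 *: (t *m t + u *m r)) *m dx - (i * k4 * dt) *: (t *m u))
    (i * k4 * ((r *m t) *m dx) 0 0 + (k3 + k4 * (r *m u) 0 0) * dt)%:M.
Proof.
move=> ii; rewrite mulmxDl mul_scalar_mx -scalemxAl -mulmxA !block_field_col.
rewrite !scale_col_mx add_col_mx; congr col_mx.
  rewrite mulmxDl mul_scalar_mx -scalemxAl mulmxDl -!mulmxA.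
  have -> : u *m (r *m dx) = (r *m dx) 0 0 *: u.
    by rewrite {1}[r *m dx]mx11_scalar mul_mx_scalar.
  rewrite mulrA ii mulN1r scaleNr opprK.
  rewrite mulmxBr -scalemxAr -[RHS]addrA; congr (_ + _).
  by rewrite addrAC scalerBr scalerA [k4 * _]mulrCA mulrA.
rewrite !scale_scalar_mx -raddfD; congr (_%:M).
rewrite mulmxBr -scalemxAr -mulmxA.
have mxB (x y : 'M[K]_1) : (x - y) 0 0 = x 0 0 - y 0 0 by rewrite !mxE.
have mxZ c (x : 'M[K]_1) : (c *: x) 0 0 = c * x 0 0 by rewrite mxE.
by rewrite mxB mxZ; ring: ii.
Qed.

End BlockAlgebra.

Section FieldMatrixAction.
Context {R : realType}.
Local Notation "x %:C" := (real_complex R x).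
Local Notation ii := (Complex 0 1 : R[i]).
Implicit Types (b e : 'cV[R]_3).

Lemma FmxE b e : Fmx b e = block_field ii (MtoC (tilde b)) (MtoC e) (MtoC e^T).
Proof. by []. Qed.

Lemma FmxEN b e : Fmx b (- e) =
  block_field ii (MtoC (tilde b)) (- MtoC e) (- MtoC e^T).
Proof. by rewrite FmxE linearN !map_mxN. Qed.

Lemma Fmx_uvec b e (v : 'cV[R]_3) (w : R[i]) :
  Fmx b e *m col_mx (MtoC v) w%:M =
  col_mx (MtoC (cross v b) - (ii * w) *: MtoC e) ((ii * (dot e v)%:C)%:M).
Proof.
rewrite FmxE block_field_col -!map_mxM tilde_mul; congr (col_mx _ (_ * _)%:M).
by rewrite mxE.
Qed.

End FieldMatrixAction.

(** * The matrix exponential to second order *)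

Section MatrixExponential.

(** The limit of the exponential series is identified through its entries, because
    convergence over [R[i]] will be read off from the real and imaginary parts. *)
Lemma expm_eq (K : numFieldType) n (M L : 'M[K]_n.+1) :
  (forall i j (e : K), 0 < e -> \forall N \near \oo,
     `|L i j - \sum_(k < N) (k`!%:R)^-1 * (M ^+ k) i j| <= e) ->
  expm M = L.
Proof.
move=> ML; apply/cvg_lim => //=.
apply/cvgrPdist_le => /= e e0.
suff H : \forall N \near \oo, forall ij : 'I_n.+1 * 'I_n.+1,
    `|L ij.1 ij.2 - \sum_(k < N) (k`!%:R)^-1 * (M ^+ k) ij.1 ij.2| <= e.
  near=> N; rewrite -[leLHS]/(mx_norm _) mx_normE.
  elim/big_ind: _ => [|x y xe ye|ij _]; first exact: ltW.
    by rewrite /Num.max; case: ifP.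
  rewrite !mxE /series /= summxE big_mkord.
  under eq_bigr do rewrite mxE.
  by move: ij; near: N.
by apply: filter_forall => -[i j] /=; exact: ML.
Unshelve. all: by end_near. Qed.

Context {R : realType}.
Variables (n : nat) (M : 'M[R[i]]_n.+1).
Hypothesis M1 : nrm M <= 1.

Let term k : 'M[R[i]]_n.+1 := (k`!%:R)^-1 *: M ^+ k.
Let q := nrm M.

Let nrm_expr k : nrm (M ^+ k.+1) <= q ^+ k.+1.
Proof.
elim: k => [|k IH]; first by rewrite !expr1.
rewrite exprS [leRHS]exprS; exact: nrm_le_mul.
Qed.

Lemma normc_natrV k : normc ((k%:R : R[i])^-1) = k%:R^-1.
Proof.
rewrite normcV; congr (_^-1).
by rewrite -(rmorph_nat (real_complex R)) normc_real normr_nat.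
Qed.

Let nrm_tail k : nrm (term k.+3) <= q ^+ 3 * exp_coeff 1 k.+3.
Proof.
rewrite /term nrmZ normc_natrV /exp_coeff /= expr1n mulrC mul1r.
rewrite ler_wpM2r ?invr_ge0 // (le_trans (nrm_expr _)) //.
by rewrite -[k.+3]/(3 + k)%N exprD ler_piMr ?exprn_ge0 ?exprn_ile1 ?nrm_ge0.
Qed.

Let nrm_term k : nrm (term k) <= (n.+1 * n.+1)%:R * exp_coeff 1 k.
Proof.
rewrite /term nrmZ normc_natrV /exp_coeff /= expr1n mulrC mul1r.
rewrite ler_wpM2r ?invr_ge0 //.
case: k => [|k]; last first.
  rewrite (le_trans (nrm_expr _)) // (@le_trans _ _ 1) ?ler1n //.
  by rewrite exprn_ile1 // nrm_ge0.
rewrite expr0 -[leRHS]mulr1; apply: nrm_le_entries => i j.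
by rewrite mxE; case: (i == j); rewrite ?normc1 ?normc0.
Qed.

(** Applied to the real and to the imaginary part of an entry. *)
Let series_tail (f : 'M[R[i]]_n.+1 -> R) :
  (forall A, `|f A| <= nrm A) ->
  cvgn (series (f \o term)) /\
  `|limn (series (f \o term)) - (f (term 0%N) + f (term 1%N) + f (term 2%N))|
    <= q ^+ 3 * expR 1.
Proof.
move=> fle.
have e1 := @is_cvg_series_exp_coeff R 1.
have ec0 k : 0 <= exp_coeff (1 : R) k by rewrite exp_coeff_ge0.
have cf : cvgn (series (f \o term)).
  apply: normed_cvg.
  apply: (@series_le_cvg R _ (fun k => (n.+1 * n.+1)%:R * exp_coeff 1 k)) => [k|k|k|].
  - exact: normr_ge0.
  - by rewrite mulr_ge0.
  - by rewrite /= (le_trans (fle _)).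
  - exact: is_cvg_seriesZ.
split=> //.
set c := f (term 0%N) + _ + _.
have bnd N : `|series (f \o term) (N + 3)%N - c| <= q ^+ 3 * expR 1.
  have -> : c = series (f \o term) 3%N.
    by rewrite /c seriesEnat /= !big_nat_recr //= big_geq // add0r.
  rewrite series_addn addrC addKr.
  rewrite (le_trans (ler_norm_sum _ _ _)) //.
  apply: (@le_trans _ _ (\sum_(3 <= k < N + 3) q ^+ 3 * exp_coeff 1 k)).
    apply: ler_sum_nat => k /andP[k3 _].
    by rewrite -(subnK k3) addn3 (le_trans (fle _)).
  rewrite -mulr_sumr ler_wpM2l ?exprn_ge0 ?nrm_ge0 //.
  apply: (@le_trans _ _ (series (exp_coeff 1) (N + 3)%N)).
    by rewrite series_addn lerDr /series /= sumr_ge0.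
  apply: nondecreasing_cvgn_le => //.
  exact/nondecreasing_series.
have cf3 : (fun N => series (f \o term) (N + 3)%N) @ \oo --> limn (series (f \o term)).
  by rewrite (cvg_shiftn 3).
have cfB : (fun N => `|series (f \o term) (N + 3)%N - c|) @ \oo -->
    `|limn (series (f \o term)) - c|.
  by apply: cvg_norm; apply: cvgB => //; exact: cvg_cst.
rewrite -(cvg_lim _ cfB) //; apply: limr_le; first by apply/cvg_ex; eexists; exact: cfB.
by near=> N; exact: bnd.
Unshelve. all: by end_near. Qed.

(** The first three terms of the series are all that a second-order method sees of
    the exponential. *)
Lemma expm_taylor2 :
  nrm (expm M - (1 + M + 2^-1 *: (M * M)))
    <= (n.+1 * n.+1)%:R * (2 * expR 1) * nrm M ^+ 3.
Proof.
pose fre i j (A : 'M[R[i]]_n.+1) := complex.Re (A i j).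
pose fim i j (A : 'M[R[i]]_n.+1) := complex.Im (A i j).
have fre_le i j A : `|fre i j A| <= nrm A.
  by rewrite (le_trans (le_Re_normc _)) // normc_le_nrm.
have fim_le i j A : `|fim i j A| <= nrm A.
  by rewrite (le_trans (le_Im_normc _)) // normc_le_nrm.
pose L : 'M[R[i]]_n.+1 := \matrix_(i, j)
  Complex (limn (series (fre i j \o term))) (limn (series (fim i j \o term))).
have Re_sum (I : Type) (r : seq I) (F : I -> R[i]) :
    complex.Re (\sum_(k <- r) F k) = \sum_(k <- r) complex.Re (F k).
  exact: (raddf_sum (@complex.Re R : Rcomplex R -> R)).
have Im_sum (I : Type) (r : seq I) (F : I -> R[i]) :
    complex.Im (\sum_(k <- r) F k) = \sum_(k <- r) complex.Im (F k).
  exact: (raddf_sum (@complex.Im R : Rcomplex R -> R)).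
have -> : expm M = L.
  apply: expm_eq => i j e e0.
  have eE : e = real_complex R (complex.Re e) by rewrite RRe_real // gtr0_real.
  have e'0 : 0 < complex.Re e / 2.
    by rewrite divr_gt0 //; move: e0; rewrite {1}eE ltcE /= => /andP[].
  have [/cvgrPdist_le cre _] := series_tail (fre_le i j).
  have [/cvgrPdist_le cim _] := series_tail (fim_le i j).
  near=> N.
  rewrite eE.
  change (real_complex R (normc (L i j - \sum_(k < N) (k`!%:R)^-1 * (M ^+ k) i j)) <= real_complex R (complex.Re e)).
  rewrite lecR (le_trans (normc_le_ReIm _)) // [leRHS]splitr lerD //.
    have : `|limn (series (fre i j \o term)) - series (fre i j \o term) N| <= complex.Re e / 2.
      by near: N; exact: cre.
    congr (`|_| <= _); rewrite /series /= big_mkord mxE.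
    rewrite (raddfB (@complex.Re R : Rcomplex R -> R)) /= Re_sum.
    by congr (_ - _); apply: eq_bigr => k _; rewrite /fre /term !mxE.
  have : `|limn (series (fim i j \o term)) - series (fim i j \o term) N| <= complex.Re e / 2.
    by near: N; exact: cim.
  congr (`|_| <= _); rewrite /series /= big_mkord mxE.
  rewrite (raddfB (@complex.Im R : Rcomplex R -> R)) /= Im_sum.
  by congr (_ - _); apply: eq_bigr => k _; rewrite /fim /term !mxE.
have -> : 1 + M + 2^-1 *: (M * M) = term 0%N + term 1%N + term 2%N.
  by rewrite /term /= !fact0 !invr1 !scale1r expr0 expr1 expr2.
have entryE (A B C D : 'M[R[i]]_n.+1) i j :
    (A - (B + C + D)) i j = A i j - (B i j + C i j + D i j) by rewrite !mxE.
rewrite -mulrA; apply: nrm_le_entries => i j.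
rewrite (le_trans (normc_le_ReIm _)) // -mulrA mulr_natl mulr2n.
rewrite [expR 1 * _]mulrC entryE mxE lerD //.
  have [_] := series_tail (fre_le i j); rewrite /= /fre.
  by case: (term 0%N i j) (term 1%N i j) (term 2%N i j) => [? ?] [? ?] [].
have [_] := series_tail (fim_le i j); rewrite /= /fim.
by case: (term 0%N i j) (term 1%N i j) (term 2%N i j) => [? ?] [? ?] [].
Unshelve. all: by end_near. Qed.

Let N0 : R := (n.+1 * n.+1)%:R * (2 * expR 1).

Definition exp_const : R := N0 + 2.

Let N0_ge0 : 0 <= N0. Proof. by rewrite mulr_ge0 // mulr_ge0 // expR_ge0. Qed.

Lemma exp_const_ge0 : 0 <= exp_const. Proof. exact: addr_ge0. Qed.

Let nrm_half : nrm (2^-1 *: (M * M)) <= q ^+ 2.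
Proof.
rewrite nrmZ normc_natrV expr2 (le_trans (ler_wpM2l _ (nrmM M M))) ?invr_ge0 //.
by rewrite ler_piMl ?mulr_ge0 ?nrm_ge0 // invf_le1 // ler1n.
Qed.

Lemma expm_taylor1 : nrm (expm M - (1 + M)) <= exp_const * nrm M ^+ 2.
Proof.
have -> : expm M - (1 + M) = (expm M - (1 + M + 2^-1 *: (M * M))) + 2^-1 *: (M * M).
  by rewrite [in RHS]opprD addrA subrK.
rewrite (le_trans (nrmD _ _)) // (le_trans (lerD expm_taylor2 nrm_half)) //.
have q0 : 0 <= q := nrm_ge0 M.
have : N0 * q ^+ 3 <= N0 * q ^+ 2.
  by rewrite ler_wpM2l // exprS ler_piMl ?exprn_ge0.
have : 0 <= q ^+ 2 by rewrite exprn_ge0.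
rewrite /exp_const -/q -/N0; lra.
Qed.

Lemma expm_sub1 : nrm (expm M - 1) <= (exp_const + 1) * nrm M.
Proof.
have -> : expm M - 1 = (expm M - (1 + M)) + M by rewrite opprD addrA subrK.
rewrite (le_trans (nrmD _ _)) // mulrDl mul1r lerD2r (le_trans expm_taylor1) //.
by rewrite expr2 ler_wpM2l ?exp_const_ge0 // ler_piMl ?nrm_ge0.
Qed.

End MatrixExponential.

(** * Tangents and secants of both kinds near zero *)

Section MeanValue.
Context {R : realType}.

Lemma is_derive_continuous (f : R -> R) x (df : R) :
  is_derive x (1 : R) f df -> {for x, continuous f}.
Proof. by case=> fx _; exact/differentiable_continuous/derivable1_diffP. Qed.

(** A derivative vanishing to order [k] at [s] makes the function constant to order
    [k + 1]; the interval is symmetric around [s] to serve forward and backward steps. *)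
Lemma mean_value_power (f df : R -> R) (s r c : R) (k : nat) :
  0 <= c ->
  (forall u, `|u - s| <= `|r - s| -> is_derive u (1 : R) f (df u)) ->
  (forall u, `|u - s| <= `|r - s| -> `|df u| <= c * `|u - s| ^+ k) ->
  `|f r - f s| <= c * `|r - s| ^+ k.+1.
Proof.
move=> c0 fd dfle.
have aux u v : u <= v -> (forall w, u <= w <= v -> `|w - s| <= `|r - s|) ->
    `|f v - f u| <= c * `|r - s| ^+ k * (v - u).
  move=> uv H.
  have [||w wuv ->] := @MVT_segment R f df u v uv.
  - by move=> x; rewrite in_itv /= => /andP[/ltW ux /ltW xv]; apply/fd/H/andP.
  - apply: continuous_in_subspaceT => x; rewrite inE /= in_itv /= => xuv.
    by apply: is_derive_continuous; apply/fd/H.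
  move: wuv; rewrite in_itv /= => wuv.
  rewrite normrM (ger0_norm (_ : 0 <= v - u)) ?subr_ge0 // ler_wpM2r ?subr_ge0 //.
  rewrite (le_trans (dfle _ (H _ wuv))) // ler_wpM2l // lerXn2r ?nnegrE //.
  exact: H.
rewrite exprSr mulrA; have [rs|/ltW sr] := leP r s.
  rewrite -normrN opprB -[`|r - s|]normrN opprB.
  rewrite {2}(ger0_norm (_ : 0 <= s - r)) ?subr_ge0 //.
  rewrite -[`|s - r|]normrN opprB aux // => w /andP[rw ws].
  by rewrite !ler0_norm ?subr_le0 // lerN2 lerB.
rewrite {2}(ger0_norm (_ : 0 <= r - s)) ?subr_ge0 //.
by apply: aux => // w /andP[sw wr]; rewrite !ger0_norm ?subr_ge0 // lerB.
Qed.

End MeanValue.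

Section ScalarTanh.
Context {R : realType}.

(** Hyperbolic and circular functions are treated at once: a pair with [S' = C] and
    [C' = eps S], where [eps] is 1 or -1. *)
Section SineCosinePair.
Variables (S C : R -> R) (eps M : R).
Hypotheses (dS : forall x, is_derive x (1 : R) S (C x))
  (dC : forall x, is_derive x (1 : R) C (eps * S x)).
Hypotheses (eps1 : `|eps| <= 1) (S0 : S 0 = 0)
  (CM : forall x, `|x| <= 1 -> `|C x| <= M).

Let M0 : 0 <= M. Proof. by rewrite (le_trans _ (CM (_ : `|0| <= 1))) // normr0. Qed.

Let S_le x : `|x| <= 1 -> `|S x| <= M * `|x|.
Proof.
move=> x1; have := @mean_value_power R S C 0 x M 0 M0.
rewrite subr0 S0 subr0; apply=> // u; rewrite subr0 => ux.
by rewrite expr0 mulr1 CM // (le_trans ux).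
Qed.

Lemma cosine_quadratic x : `|x| <= 1 -> `|C x - C 0| <= M * `|x| ^+ 2.
Proof.
move=> x1; have := @mean_value_power R C (fun u => eps * S u) 0 x M 1 M0.
rewrite subr0; apply=> // u; rewrite subr0 => ux.
rewrite normrM expr1 -[leRHS]mul1r ler_pM // S_le //.
exact: le_trans ux x1.
Qed.

(** The derivative of [S x - x C x] is [- eps x S x], which is quadratic in [x]. *)
Lemma sine_minus_arg_cosine x : `|x| <= 1 -> `|S x - x * C x| <= M * `|x| ^+ 3.
Proof.
move=> x1.
have := @mean_value_power R (fun u => S u - u * C u) (fun u => - (u * (eps * S u))) 0 x M 2 M0.
rewrite subr0 S0 mul0r !subr0; apply=> // u; rewrite subr0 => ux.
  have D : is_derive u (1 : R) (S \- id * C) _ :=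
    is_deriveB (dS u) (is_deriveM (is_derive_id u 1) (dC u)).
  by apply: (is_derive_eq D); rewrite /= /GRing.scale /=; ring.
rewrite normrN !normrM (_ : M * _ = `|u| * (1 * (M * `|u|))); last by ring.
rewrite ler_wpM2l // ler_pM // S_le //.
exact: le_trans ux x1.
Qed.

(** Away from the zeros of the cosine, the two estimates become expansions of
    tangent and secant. *)
Lemma tangent_cubic x : `|x| <= 1 -> 0 < C 0 -> C 0 / 2 <= C x ->
  `|S x / C x - x| <= (2 * M / C 0) * `|x| ^+ 3.
Proof.
move=> x1 C0 Cx; have Cx0 : 0 < C x by rewrite (lt_le_trans _ Cx) // divr_gt0.
have -> : S x / C x - x = (S x - x * C x) / C x by field; rewrite gt_eqF.
rewrite normrM normfV (gtr0_norm Cx0) ler_pdivrMr //.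
rewrite (le_trans (sine_minus_arg_cosine x1)) //.
rewrite (_ : _ * C x = (M * `|x| ^+ 3) * (2 * C x / C 0)); last first.
  by field; rewrite gt_eqF.
rewrite ler_peMr ?mulr_ge0 ?exprn_ge0 // ler_pdivlMr // mul1r.
by rewrite -ler_pdivrMl // mulrC.
Qed.

Lemma secant_quadratic x : `|x| <= 1 -> 0 < C 0 -> C 0 / 2 <= C x ->
  `|C 0 / C x - 1| <= (2 * M / C 0) * `|x| ^+ 2.
Proof.
move=> x1 C0 Cx; have Cx0 : 0 < C x by rewrite (lt_le_trans _ Cx) // divr_gt0.
have -> : C 0 / C x - 1 = (C 0 - C x) / C x by field; rewrite gt_eqF.
rewrite normrM normfV (gtr0_norm Cx0) ler_pdivrMr // distrC.
rewrite (le_trans (cosine_quadratic x1)) //.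
rewrite (_ : _ * C x = (M * `|x| ^+ 2) * (2 * C x / C 0)); last first.
  by field; rewrite gt_eqF.
rewrite ler_peMr ?mulr_ge0 ?exprn_ge0 // ler_pdivlMr // mul1r.
by rewrite -ler_pdivrMl // mulrC.
Qed.

End SineCosinePair.

Definition rtanh (x : R) := (expR x - expR (- x)) / (expR x + expR (- x)).
Definition rsech (x : R) := 2 / (expR x + expR (- x)).
(** A bound of [exp x + exp (- x)] on the unit interval, common to all estimates. *)
Definition two_e : R := 2 * expR 1.

Let is_derive_expRN (x : R) : is_derive x (1 : R) (fun u => expR (- u)) (- expR (- x)).
Proof.
have D : is_derive x (1 : R) (expR \o -%R) _ :=
  is_derive1_comp (is_derive_expR _) (is_deriveN (is_derive_id x 1)).
by apply: (is_derive_eq D); rewrite /GRing.scale /= mulrN1.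
Qed.

Let dsinh (x : R) :
  is_derive x (1 : R) (fun u => expR u - expR (- u)) (expR x + expR (- x)).
Proof.
have D : is_derive x (1 : R) (expR \- (fun u => expR (- u))) _ :=
  is_deriveB (is_derive_expR x) (is_derive_expRN x).
by apply: (is_derive_eq D); rewrite opprK.
Qed.

Let dcosh (x : R) :
  is_derive x (1 : R) (fun u => expR u + expR (- u)) (1 * (expR x - expR (- x))).
Proof.
have D : is_derive x (1 : R) (expR \+ (fun u => expR (- u))) _ :=
  is_deriveD (is_derive_expR x) (is_derive_expRN x).
by apply: (is_derive_eq D); rewrite mul1r.
Qed.

Let cosh_le (x : R) : `|x| <= 1 -> `|expR x + expR (- x)| <= two_e.
Proof.
rewrite ler_norml => /andP[x1 x2].
rewrite ger0_norm ?addr_ge0 ?expR_ge0 // /two_e mulr_natl mulr2n.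
by rewrite lerD // ler_expR // lerNl.
Qed.

Let cosh_ge (x : R) : 2 <= expR x + expR (- x).
Proof.
have := expR_ge1Dx x; have := expR_ge1Dx (- x); lra.
Qed.

Lemma two_e_ge2 : 2 <= two_e.
Proof. by have := expR_ge1Dx (1 : R); rewrite /two_e; lra. Qed.

Let cosh0 : expR (0 : R) + expR (- 0) = 2.
Proof. by rewrite oppr0 expR0. Qed.

Let one_le : `|1 : R| <= 1. Proof. by rewrite normr1. Qed.
Let mone_le : `|- 1 : R| <= 1. Proof. by rewrite normrN normr1. Qed.
Let sinh0 : expR (0 : R) - expR (- 0) = 0. Proof. by rewrite oppr0 subrr. Qed.

Lemma rtanh_cubic x : `|x| <= 1 -> `|rtanh x - x| <= two_e * `|x| ^+ 3.
Proof.
move=> x1; have := tangent_cubic dsinh dcosh one_le sinh0 cosh_le x1.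
rewrite cosh0 (_ : 2 * two_e / 2 = two_e) ?divff //; last by field.
apply=> //.
by rewrite (le_trans _ (cosh_ge x)) // ler1n.
Qed.

Lemma rsech_quadratic x : `|x| <= 1 -> `|rsech x - 1| <= two_e * `|x| ^+ 2.
Proof.
move=> x1; have := secant_quadratic dsinh dcosh one_le sinh0 cosh_le x1.
rewrite cosh0 (_ : 2 * two_e / 2 = two_e) ?divff //; last by field.
apply=> //.
by rewrite (le_trans _ (cosh_ge x)) // ler1n.
Qed.

Let dcos (x : R) : is_derive x (1 : R) cos (- 1 * sin x).
Proof. by rewrite mulN1r; exact: is_derive_cos. Qed.

Let cos_le (x : R) : `|x| <= 1 -> `|cos x| <= 1.
Proof. by move=> _; rewrite ler_norml cos_geN1 cos_le1. Qed.

Lemma cos_ge_half (x : R) : `|x| <= 1 / 2 -> 1 / 2 <= cos x.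
Proof.
move=> x2; have x1 : `|x| <= 1 by rewrite (le_trans x2) //; lra.
have := cosine_quadratic (@is_derive_sin R) dcos mone_le (@sin0 R) cos_le x1.
rewrite cos0 mul1r.
rewrite ler_norml => /andP[+ _].
have : `|x| ^+ 2 <= (1 / 2) ^+ 2 by rewrite lerXn2r ?nnegrE.
lra.
Qed.

Lemma tan_cubic (x : R) : `|x| <= 1 / 2 -> `|sin x / cos x - x| <= two_e * `|x| ^+ 3.
Proof.
move=> x2; have x1 : `|x| <= 1 by rewrite (le_trans x2) //; lra.
have := tangent_cubic (@is_derive_sin R) dcos mone_le (@sin0 R) cos_le x1.
rewrite cos0 mulr1 divr1 => /(_ ltr01 (cos_ge_half x2)).
by move/le_trans; apply; rewrite ler_wpM2r ?exprn_ge0 // two_e_ge2.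
Qed.

Lemma sec_quadratic (x : R) : `|x| <= 1 / 2 -> `|(cos x)^-1 - 1| <= two_e * `|x| ^+ 2.
Proof.
move=> x2; have x1 : `|x| <= 1 by rewrite (le_trans x2) //; lra.
have := secant_quadratic (@is_derive_sin R) dcos mone_le (@sin0 R) cos_le x1.
rewrite cos0 mulr1 divr1 => /(_ ltr01 (cos_ge_half x2)).
rewrite div1r; move/le_trans; apply; rewrite ler_wpM2r ?exprn_ge0 // two_e_ge2 //.
Qed.

End ScalarTanh.

(** * The coefficients of the filtered methods *)

Section Coefficients.
Context {R : realType}.
Implicit Types (b e : 'cV[R]_3) (h x : R).
Local Notation "x %:C" := (real_complex R x).

Lemma cexp_real x : cexp (x%:C) = (expR x)%:C.
Proof. by rewrite /cexp /= cos0 sin0 mulr1. Qed.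

Lemma cexp_imag x : cexp (Complex 0 x) = Complex (cos x) (sin x).
Proof. by rewrite /cexp /= expR0 mul1r. Qed.

Lemma ctanh_real x : ctanh (x%:C) = (rtanh x)%:C.
Proof.
by rewrite /ctanh -rmorphN !cexp_real -rmorphB -rmorphD -fmorphV -rmorphM.
Qed.

Lemma csech_real x : csech (x%:C) = (rsech x)%:C.
Proof.
rewrite /csech -rmorphN !cexp_real -rmorphD -fmorphV.
by rewrite -(rmorph_nat (real_complex R)) -rmorphM.
Qed.

Let cexp_sum x : cexp (Complex 0 x) + cexp (- Complex 0 x) = (2 * cos x)%:C.
Proof.
rewrite [- _](_ : _ = Complex 0 (- x)); last by congr Complex; rewrite oppr0.
rewrite !cexp_imag cosN sinN; congr Complex; rewrite ?subrr //; ring.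
Qed.

Lemma ctanh_imag x : cos x != 0 ->
  ctanh (Complex 0 x) = Complex 0 1 * (sin x / cos x)%:C.
Proof.
move=> c0; rewrite /ctanh cexp_sum.
have -> : cexp (Complex 0 x) - cexp (- Complex 0 x) = Complex 0 1 * (2 * sin x)%:C.
  rewrite [- Complex 0 x](_ : _ = Complex 0 (- x)); last by congr Complex; rewrite oppr0.
  rewrite !cexp_imag cosN sinN; congr Complex; ring.
rewrite -mulrA -fmorphV -rmorphM; congr (_ * _%:C).
by field; rewrite c0.
Qed.

Lemma csech_imag x : cos x != 0 -> csech (Complex 0 x) = ((cos x)^-1)%:C.
Proof.
move=> c0; rewrite /csech cexp_sum -fmorphV -(rmorph_nat (real_complex R)) -rmorphM.
by congr (_%:C); field; rewrite c0.
Qed.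

Variables (b e : 'cV[R]_3).
Let r1 := r1 b e. Let r2 := r2 b e. Let d := dd b e.
Let s1 := Num.sqrt ((r1 + d) / 2).
Let s2 := Num.sqrt ((d - r1) / 2).

Let d_ge0 : 0 <= d. Proof. exact: sqrtr_ge0. Qed.

Let d2 : d ^+ 2 = r1 ^+ 2 + 4 * r2 ^+ 2.
Proof.
rewrite sqr_sqrtr //; have := sqr_ge0 r1; have := sqr_ge0 r2.
rewrite -/r1 -/r2; lra.
Qed.

Let r1_le : `|r1| <= d.
Proof.
rewrite -sqrtr_sqr ler_wsqrtr //; have := sqr_ge0 r2; rewrite -/r1 -/r2; lra.
Qed.

Let r1d : - d <= r1 <= d. Proof. by rewrite -ler_norml. Qed.

Let s1_ge0 : 0 <= s1. Proof. exact: sqrtr_ge0. Qed.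
Let s2_ge0 : 0 <= s2. Proof. exact: sqrtr_ge0. Qed.
Let s1E : s1 ^+ 2 = (r1 + d) / 2.
Proof. by rewrite sqr_sqrtr //; move/andP: r1d => []; lra. Qed.
Let s2E : s2 ^+ 2 = (d - r1) / 2.
Proof. by rewrite sqr_sqrtr //; move/andP: r1d => []; lra. Qed.
Let s1s2 : s1 ^+ 2 + s2 ^+ 2 = d. Proof. by rewrite s1E s2E; field. Qed.
Let s1_le : s1 ^+ 2 <= d. Proof. by rewrite -s1s2 lerDl sqr_ge0. Qed.
Let s2_le : s2 ^+ 2 <= d. Proof. by rewrite -s1s2 lerDr sqr_ge0. Qed.

Let sq1E : sq1 b e = s1%:C.
Proof.
have /andP[d1 d2'] := r1d; have L0 : 0 <= (r1 + d) / 2 by lra.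
by rewrite /sq1 sqrtc_sqrtr // ler0c.
Qed.

Let sq2E : sq2 b e = Complex 0 s2.
Proof.
have /andP[d1 d2'] := r1d.
have L0 : (r1 - d) / 2 <= 0 by lra.
rewrite /sq2 /sqrtc /= -/r1 -/d eqxx mul1r expr0n addr0 sqrtr_sqr ler0_norm //.
by rewrite addNr mul0r sqrtr0; congr Complex; congr Num.sqrt; field.
Qed.

Variable h : R.
Let k := h / 2.
Hypotheses (h0 : 0 <= h) (hd : h ^+ 2 * d <= 1).

Let k_ge0 : 0 <= k. Proof. by rewrite divr_ge0. Qed.

Let ks_le s : 0 <= s -> s ^+ 2 <= d -> `|k * s| <= 1 / 2.
Proof.
move=> s0 sd; rewrite ger0_norm ?mulr_ge0 // /k.
have : (h * s) ^+ 2 <= 1 ^+ 2.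
  by rewrite exprMn expr1n (le_trans _ hd) // ler_wpM2l ?sqr_ge0.
rewrite ler_pXn2r ?nnegrE ?mulr_ge0 // => hs; lra.
Qed.

Let ks1 : `|k * s1| <= 1. Proof. by rewrite (le_trans (ks_le s1_ge0 s1_le)) //; lra. Qed.
Let ks2 : `|k * s2| <= 1 / 2. Proof. exact: ks_le. Qed.
Let cos_neq0 : cos (k * s2) != 0.
Proof. by rewrite gt_eqF // (lt_le_trans _ (cos_ge_half ks2)). Qed.

Let t1 := rtanh (k * s1). Let t2 := sin (k * s2) / cos (k * s2).
Let c1 := rsech (k * s1). Let c2 := (cos (k * s2))^-1.

Let t1E : `|t1 - k * s1| <= two_e * (k * s1) ^+ 3.
Proof. by rewrite (le_trans (rtanh_cubic ks1)) // ger0_norm ?mulr_ge0. Qed.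
Let t2E : `|t2 - k * s2| <= two_e * (k * s2) ^+ 3.
Proof. by rewrite (le_trans (tan_cubic ks2)) // ger0_norm ?mulr_ge0. Qed.
Let c1E : `|c1 - 1| <= two_e * (k * s1) ^+ 2.
Proof. by rewrite (le_trans (rsech_quadratic ks1)) // ger0_norm ?mulr_ge0. Qed.
Let c2E : `|c2 - 1| <= two_e * (k * s2) ^+ 2.
Proof. by rewrite (le_trans (sec_quadratic ks2)) // ger0_norm ?mulr_ge0. Qed.

Let mulkC x : (h / 2)%:C * x%:C = (k * x)%:C. Proof. by rewrite -rmorphM. Qed.
Let mulkI x : (h / 2)%:C * Complex 0 x = Complex 0 (k * x).
Proof. congr Complex; rewrite /k; ring. Qed.
Let iE x : Complex 0 x = Complex 0 1 * x%:C :> R[i].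
Proof. congr Complex; ring. Qed.
Let sqr_i : Complex 0 1 * Complex 0 1 = - 1 :> R[i].
Proof. by congr Complex; ring. Qed.

Let CD x y : (x + y)%:C = x%:C + y%:C. Proof. exact: rmorphD. Qed.
Let CB x y : (x - y)%:C = x%:C - y%:C. Proof. exact: rmorphB. Qed.
Let CM x y : (x * y)%:C = x%:C * y%:C. Proof. exact: rmorphM. Qed.
Let CV x : (x^-1)%:C = (x%:C)^-1. Proof. exact: fmorphV. Qed.

Let K1E : d != 0 -> K1 h b e = ((s1 * t1 + s2 * t2) / d)%:C.
Proof.
move=> d0; rewrite /K1 -/d (negPf d0) sq1E sq2E mulkC mulkI.
rewrite ctanh_real ctanh_imag // [Complex 0 s2]iE mulrACA sqr_i mulN1r opprK.
by rewrite (CM (s1 * t1 + s2 * t2) d^-1) (CV d) (CD (s1 * t1)) (CM s1 t1) (CM s2 t2).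
Qed.

Let K2E : d != 0 -> r2 != 0 -> K2 h b e = (r2 / d * (t1 / s1 - t2 / s2))%:C.
Proof.
move=> d0 r20; rewrite /K2 -/d (negPf d0) sq1E sq2E mulkC mulkI.
rewrite ctanh_real ctanh_imag // [Complex 0 s2]iE.
rewrite -mulf_div divff; last by rewrite eq_complex /= oner_eq0 andbF.
by rewrite mul1r (CM (r2 / d) (t1 / s1 - t2 / s2)) (CB (t1 / s1)) (CM t1 s1^-1) (CM t2 s2^-1) (CV s1) (CV s2).
Qed.

Let K3E : d != 0 -> K3 h b e =
  (2^-1 * (1 - r1 / d) * c1 + 2^-1 * (1 + r1 / d) * c2)%:C.
Proof.
move=> d0; rewrite /K3 -/d (negPf d0) sq1E sq2E mulkC mulkI.
rewrite csech_real csech_imag // (CD (2^-1 * (1 - r1 / d) * c1)) (CM (2^-1 * _) c1) (CM (2^-1 * _) c2) !(CM 2^-1) (CV 2).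
by rewrite (rmorph_nat (real_complex R)).
Qed.

Let K4E : d != 0 -> K4 h b e = ((c1 - c2) / d)%:C.
Proof.
move=> d0; rewrite /K4 -/d (negPf d0) sq1E sq2E mulkC mulkI.
by rewrite csech_real csech_imag // (CM (c1 - c2) d^-1) (CV d) (CB c1).
Qed.

Let d_gt0 : d != 0 -> 0 < d. Proof. by rewrite lt0r d_ge0 andbT. Qed.
Let two_e0 : 0 <= two_e :> R. Proof. by rewrite (le_trans _ two_e_ge2). Qed.

Let k_le : k <= h. Proof. by move: h0; rewrite /k; lra. Qed.
Let k2_le : k ^+ 2 <= h ^+ 2. Proof. by rewrite lerXn2r ?nnegrE. Qed.
Let k3_le : k ^+ 3 <= h ^+ 3. Proof. by rewrite lerXn2r ?nnegrE. Qed.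
Let k30 : 0 <= k ^+ 3. Proof. exact: exprn_ge0. Qed.

(** The numbers [s1] and [i s2] have squares of opposite signs, so that
    [d = s1 ^+ 2 + s2 ^+ 2]: the division by [d] is absorbed by the powers of
    [s1] and [s2] in the numerator, uniformly as [d] tends to zero. *)
Lemma K1_bound : normc (K1 h b e - (h / 2)%:C) <= two_e * d * h ^+ 3.
Proof.
have [d0|d0] := eqVneq d 0.
  by rewrite /K1 -/d d0 eqxx subrr normc0 mulr0 mul0r.
rewrite K1E // -rmorphB normc_real.
have -> : (s1 * t1 + s2 * t2) / d - h / 2 =
    (s1 * (t1 - k * s1) + s2 * (t2 - k * s2)) / d.
  have -> : s1 * (t1 - k * s1) + s2 * (t2 - k * s2) =
      s1 * t1 + s2 * t2 - k * d by rewrite -s1s2; ring.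
  by rewrite /k; field.
rewrite normrM normfV (gtr0_norm (d_gt0 d0)) ler_pdivrMr ?d_gt0 //.
rewrite (le_trans (ler_normD _ _)) // !normrM (ger0_norm s1_ge0) (ger0_norm s2_ge0).
apply: (@le_trans _ _ (s1 * (two_e * (k * s1) ^+ 3) + s2 * (two_e * (k * s2) ^+ 3))).
  by rewrite lerD // ler_wpM2l.
have -> : s1 * (two_e * (k * s1) ^+ 3) + s2 * (two_e * (k * s2) ^+ 3) =
  two_e * k ^+ 3 * ((s1 ^+ 2) ^+ 2 + (s2 ^+ 2) ^+ 2) by ring.
have -> : two_e * d * h ^+ 3 * d = two_e * h ^+ 3 * d ^+ 2 by ring.
apply: ler_pM; rewrite ?mulr_ge0 ?addr_ge0 ?exprn_ge0 //; first by rewrite ler_wpM2l.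
have := mulr_ge0 (sqr_ge0 s1) (sqr_ge0 s2); rewrite -s1s2.
by move: (s1 ^+ 2) (s2 ^+ 2) => A1 A2; nra.
Qed.

(** A vanishing [s1] or [s2] forces [r2 = 0], because [(s1 s2) ^+ 2 = r2 ^+ 2];
    otherwise the two quotients agree up to third order. *)
Lemma K2_bound : normc (K2 h b e) <= two_e * d * h ^+ 3.
Proof.
have B0 : 0 <= two_e * d * h ^+ 3 by apply: mulr_ge0; [exact: mulr_ge0|exact: exprn_ge0].
have [d0|d0] := eqVneq d 0; first by rewrite /K2 -/d d0 eqxx normc0 mulr0 mul0r.
have [r20|r20] := eqVneq r2 0.
  by rewrite /K2 -/d -/r2 (negPf d0) r20 mul0r mul0r normc0.
have ss : (s1 * s2) ^+ 2 = r2 ^+ 2 by rewrite exprMn s1E s2E; move: d2; nra.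
have : s1 * s2 != 0.
  by apply: contra r20 => /eqP s0; move: ss; rewrite s0 expr0n => /esym/eqP; rewrite expf_eq0.
rewrite mulf_eq0 negb_or => /andP[s10 s20].
have s1_gt0 : 0 < s1 by rewrite lt0r s10.
have s2_gt0 : 0 < s2 by rewrite lt0r s20.
have quo s t : 0 < s -> `|t - k * s| <= two_e * (k * s) ^+ 3 ->
    `|t / s - k| <= two_e * k ^+ 3 * s ^+ 2.
  move=> s0 H; have -> : t / s - k = (t - k * s) / s by field; rewrite gt_eqF.
  rewrite normrM normfV (gtr0_norm s0) ler_pdivrMr // (le_trans H) //.
  by rewrite le_eqVlt; apply/orP; left; apply/eqP; ring.
rewrite K2E // normc_real normrM normrM normfV (gtr0_norm (d_gt0 d0)).
have r2d : `|r2| <= d.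
  rewrite -sqrtr_sqr ler_wsqrtr //; have := sqr_ge0 r1; have := sqr_ge0 r2.
  rewrite -/r1 -/r2; lra.
have H : `|t1 / s1 - t2 / s2| <= two_e * h ^+ 3 * d.
  rewrite (_ : _ - _ = (t1 / s1 - k) - (t2 / s2 - k)); last by ring.
  rewrite (le_trans (ler_normB _ _)) //.
  apply: (@le_trans _ _ (two_e * k ^+ 3 * s1 ^+ 2 + two_e * k ^+ 3 * s2 ^+ 2)).
    by rewrite lerD // quo.
  by rewrite -mulrDr s1s2 ler_wpM2r // ler_wpM2l.
rewrite (_ : two_e * d * h ^+ 3 = 1 * (two_e * h ^+ 3 * d)); last by ring.
by rewrite ler_pM // ?divr_ge0 // ler_pdivrMr ?d_gt0 // mul1r.
Qed.

(** The two weights [1/2 (1 -+ r1 / d)] are nonnegative and sum to 1. *)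
Lemma K3_bound : normc (K3 h b e - 1) <= two_e * d * h ^+ 2.
Proof.
have [d0|d0] := eqVneq d 0.
  by rewrite /K3 -/d d0 eqxx subrr normc0 mulr0 mul0r.
rewrite K3E // -(rmorph1 (real_complex R)) -rmorphB normc_real.
have -> : 2^-1 * (1 - r1 / d) * c1 + 2^-1 * (1 + r1 / d) * c2 - 1 =
    2^-1 * (1 - r1 / d) * (c1 - 1) + 2^-1 * (1 + r1 / d) * (c2 - 1) by field.
have /andP[l1 l2] : - 1 <= r1 / d <= 1.
  by rewrite ler_pdivlMr ?ler_pdivrMr ?d_gt0 // mulN1r mul1r.
rewrite (le_trans (ler_normD _ _)) //.
apply: (@le_trans _ _ (1 * (two_e * (k * s1) ^+ 2) + 1 * (two_e * (k * s2) ^+ 2))).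
  rewrite lerD // normrM ler_pM // ger0_norm //; lra.
have -> : 1 * (two_e * (k * s1) ^+ 2) + 1 * (two_e * (k * s2) ^+ 2) =
  two_e * (s1 ^+ 2 + s2 ^+ 2) * k ^+ 2 by ring.
by rewrite s1s2 ler_wpM2l // mulr_ge0.
Qed.

Lemma K4_bound : normc (K4 h b e) <= two_e * h ^+ 2.
Proof.
have [d0|d0] := eqVneq d 0.
  rewrite /K4 -/d d0 eqxx normcM normcN normc_natrV -rmorphXn normc_real.
  rewrite -/k ger0_norm ?exprn_ge0 //.
  have := two_e_ge2 (R := R); have := sqr_ge0 h; rewrite /k; nra.
rewrite K4E // normc_real normrM normfV (gtr0_norm (d_gt0 d0)).
rewrite ler_pdivrMr ?d_gt0 // (_ : c1 - c2 = (c1 - 1) - (c2 - 1)); last by ring.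
rewrite (le_trans (ler_normB _ _)) // (le_trans (lerD c1E c2E)) //.
have -> : two_e * (k * s1) ^+ 2 + two_e * (k * s2) ^+ 2 =
  two_e * k ^+ 2 * (s1 ^+ 2 + s2 ^+ 2) by ring.
by rewrite s1s2 ler_wpM2r // ler_wpM2l.
Qed.

End Coefficients.

Section FieldStrength.
Context {R : realType}.

Lemma dot_le (a b : 'cV[R]_3) m : l2norm a <= m -> l2norm b <= m ->
  `|dot a b| <= 3 * m ^+ 2.
Proof.
move=> am bm; rewrite /dot mxE (le_trans (ler_norm_sum _ _ _)) //.
apply: (@le_trans _ _ (\sum_(i < 3) m ^+ 2)).
  apply: ler_sum => i _; rewrite mxE normrM expr2.
  by rewrite ler_pM // (le_trans (abs_le_l2norm _ _)).
by rewrite sumr_const card_ord mulr_natl.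
Qed.

Lemma dd_le (b e : 'cV[R]_3) m : l2norm b <= m -> l2norm e <= m ->
  dd b e <= 12 * m ^+ 2.
Proof.
move=> bm em; have m0 : 0 <= m by rewrite (le_trans (l2norm_ge0 b)).
rewrite /dd -[leRHS]ger0_norm ?mulr_ge0 ?exprn_ge0 // -sqrtr_sqr ler_wsqrtr //.
have H2 : `|r2 b e| <= 3 * m ^+ 2 by rewrite normrN dot_le.
have H1 : `|r1 b e| <= 6 * m ^+ 2.
  rewrite (le_trans (ler_normB _ _)) // (_ : 6 * _ = 3 * m ^+ 2 + 3 * m ^+ 2) ?lerD ?dot_le //.
  by ring.
have sq (x y : R) : `|x| <= y -> x ^+ 2 <= y ^+ 2.
  by move=> xy; rewrite -real_normK ?num_real // lerXn2r ?nnegrE // (le_trans _ xy).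
have := sq _ _ H1; have := sq _ _ H2; have := sqr_ge0 (m ^+ 2); nra.
Qed.

End FieldStrength.

(** * Taylor expansion and finite differences *)

Section Taylor.
Context {R : realType}.

Lemma is_derive_monomial (s u c : R) j :
  is_derive u (1 : R) (fun x => (x - s) ^+ j.+1 / j.+1`!%:R * c)
    ((u - s) ^+ j / j`!%:R * c).
Proof.
have D1 : is_derive u (1 : R) (id \- cst s) (1 - 0) :=
  is_deriveB (is_derive_id u 1) (is_derive_cst s u 1).
have D2 : is_derive u (1 : R) ((id \- cst s) ^+ j.+1) _ := is_deriveX _ D1.
have -> : (fun x => (x - s) ^+ j.+1 / j.+1`!%:R * c) =
    (j.+1`!%:R^-1 * c) *: (id \- cst s) ^+ j.+1.
  by apply/funext => x; rewrite !fctE /GRing.scale /=; ring.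
apply: is_derive_eq; rewrite /GRing.scale /= subr0 mulr1 factS natrM; field.
by rewrite nat1r !pnatr_eq0 -lt0n fact_gt0.
Qed.

(** The derivatives are given as a sequence of functions, so that the induction on [k]
    shifts the sequence and integrates the remainder of the derivative once. *)
Lemma taylor_bound (f : nat -> R -> R) (s r M : R) k : 0 <= M ->
  (forall j u, (j < k)%N -> `|u - s| <= `|r - s| ->
     is_derive u (1 : R) (f j) (f j.+1 u)) ->
  (forall u, `|u - s| <= `|r - s| -> `|f k u| <= M) ->
  `|f 0%N r - \sum_(j < k) (r - s) ^+ j / j`!%:R * f j s| <= M * `|r - s| ^+ k.
Proof.
move=> M0; elim: k f r => [|k IH] f r fd fM.
  by rewrite big_ord0 subr0 expr0 mulr1 fM.
pose P u := \sum_(j < k.+1) (u - s) ^+ j / j`!%:R * f j s.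
pose dP u := \sum_(j < k) (u - s) ^+ j / j`!%:R * f j.+1 s.
have Ps : P s = f 0%N s.
  rewrite /P big_ord_recl /= expr0 fact0 divr1 mul1r big1 ?addr0 // => i _.
  by rewrite subrr expr0n mul0r mul0r.
have dPE u : is_derive u (1 : R) P (dP u).
  have -> : P = \sum_(j < k.+1) (fun u => (u - s) ^+ j / j`!%:R * f j s).
    by apply/funext => x; rewrite /P fct_sumE.
  rewrite big_ord_recl /dP -[X in is_derive _ _ _ X]add0r; apply: is_deriveD.
    rewrite (_ : (fun _ => _) = cst (f 0%N s)); first exact: is_derive_cst.
    by apply/funext => x /=; rewrite expr0 fact0 divr1 mul1r.
  apply: is_derive_sum => i; exact: is_derive_monomial.
have := @mean_value_power R (fun u => f 0%N u - P u) (fun u => f 1%N u - dP u) s r M k M0.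
rewrite Ps subrr subr0; apply=> u us.
  have D : is_derive u (1 : R) (f 0%N \- P) _ := is_deriveB (fd 0%N u isT us) (dPE u).
  exact: D.
apply: (IH (fun j => f j.+1)) => [j v jk vs|v vs].
  by apply: fd => //; exact: le_trans us.
by apply: fM; exact: le_trans us.
Qed.

End Taylor.

Section VectorTaylor.
Context {R : realType} {m : nat}.
Local Notation "x %:C" := (real_complex R x).
Implicit Types f : R -> 'cV[R[i]]_m.

Definition vderive f (s : R) (df : 'cV[R[i]]_m) : Prop :=
  forall j, is_cderive (fun r => f r j 0) s (df j 0).

Lemma vderive_unique f s df df' : vderive f s df -> vderive f s df' -> df = df'.
Proof.
move=> fd fd'; apply/colP => j; move: (fd j) (fd' j).
move: (df j 0) (df' j 0) => [a b] [a' b'] [/= D1 D2] [/= D1' D2'].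
have := @derive_val _ _ _ _ _ _ _ D1; have := @derive_val _ _ _ _ _ _ _ D2.
by rewrite (@derive_val _ _ _ _ _ _ _ D1') (@derive_val _ _ _ _ _ _ _ D2') => -> ->.
Qed.

Lemma taylor_vector (f : nat -> R -> 'cV[R[i]]_m) (s r M : R) k : 0 <= M ->
  (forall j u, (j < k)%N -> `|u - s| <= `|r - s| -> vderive (f j) u (f j.+1 u)) ->
  (forall u, `|u - s| <= `|r - s| -> nrm (f k u) <= M) ->
  nrm (f 0%N r - \sum_(j < k) ((r - s) ^+ j / j`!%:R)%:C *: f j s)
    <= m%:R * (2 * M) * `|r - s| ^+ k.
Proof.
move=> M0 fd fM.
have Re_sum (I : Type) (l : seq I) (F : I -> R[i]) :
    complex.Re (\sum_(k <- l) F k) = \sum_(k <- l) complex.Re (F k).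
  exact: (raddf_sum (@complex.Re R : Rcomplex R -> R)).
have Im_sum (I : Type) (l : seq I) (F : I -> R[i]) :
    complex.Im (\sum_(k <- l) F k) = \sum_(k <- l) complex.Im (F k).
  exact: (raddf_sum (@complex.Im R : Rcomplex R -> R)).
have ReZ (x : R) z : complex.Re (x%:C * z) = x * complex.Re z.
  by case: z => a b /=; rewrite mul0r subr0.
have ImZ (x : R) z : complex.Im (x%:C * z) = x * complex.Im z.
  by case: z => a b /=; rewrite mul0r addr0.
have ReB (z1 z2 : R[i]) : complex.Re (z1 - z2) = complex.Re z1 - complex.Re z2.
  by case: z1 z2 => [? ?] [].
have ImB (z1 z2 : R[i]) : complex.Im (z1 - z2) = complex.Im z1 - complex.Im z2.
  by case: z1 z2 => [? ?] [].
rewrite -mulrA -[X in X%:R]muln1; apply: nrm_le_entries => i j; rewrite ord1.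
rewrite (le_trans (normc_le_ReIm _)) //.
rewrite (_ : 2 * M * _ = M * `|r - s| ^+ k + M * `|r - s| ^+ k); last by ring.
rewrite lerD //.
  have := @taylor_bound R (fun n u => complex.Re (f n u i 0)) s r M k M0.
  rewrite mxE [X in complex.Re (_ + X)]mxE summxE ReB Re_sum.
  under [in X in _ -> X]eq_bigr do rewrite mxE ReZ.
  apply=> [n u nk us|u us]; first by have [] := fd n u nk us i.
  by rewrite (le_trans (le_Re_normc _)) // (le_trans (normc_le_nrm _ _ _)) // fM.
have := @taylor_bound R (fun n u => complex.Im (f n u i 0)) s r M k M0.
rewrite mxE [X in complex.Im (_ + X)]mxE summxE ImB Im_sum.
under [in X in _ -> X]eq_bigr do rewrite mxE ImZ.
apply=> [n u nk us|u us]; first by have [] := fd n u nk us i.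
by rewrite (le_trans (le_Im_normc _)) // (le_trans (normc_le_nrm _ _ _)) // fM.
Qed.

End VectorTaylor.

Section Consistency.
Context {R : realType} {m : nat}.
Local Notation "x %:C" := (real_complex R x).
Variables (f : nat -> R -> 'cV[R[i]]_m) (s h M : R).
Hypotheses (M0 : 0 <= M) (h0 : 0 <= h).
Hypothesis fd : forall j u, (j < 4)%N -> `|u - s| <= h -> vderive (f j) u (f j.+1 u).
Hypothesis fM : forall j u, (j <= 4)%N -> `|u - s| <= h -> nrm (f j u) <= M.

Let c : R := m%:R * (2 * M).

Lemma taylor_sub n k r : (n + k <= 4)%N -> `|r - s| = h ->
  nrm (f n r - \sum_(j < k) ((r - s) ^+ j / j`!%:R)%:C *: f (n + j)%N s) <= c * h ^+ k.
Proof.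
move=> nk4 rs; rewrite -[X in X ^+ k]rs.
have := @taylor_vector R m (fun j => f (n + j)%N) s r M k M0.
rewrite addn0; apply=> [j u jk|u]; rewrite rs => us.
  by rewrite addnS; apply: fd => //; rewrite (leq_trans _ nk4) // ltn_add2l.
exact: fM.
Qed.

Let sh : `|s + h - s| = h. Proof. by rewrite addrAC subrr add0r ger0_norm. Qed.
Let smh : `|s - h - s| = h. Proof. by rewrite addrAC subrr add0r normrN ger0_norm. Qed.

Let hp : s + h - s = h. Proof. by rewrite addrAC subrr add0r. Qed.
Let hm : s - h - s = - h. Proof. by rewrite addrAC subrr add0r. Qed.

Lemma first_difference n : (n < 4)%N -> nrm (f n (s + h) - f n s) <= c * h.
Proof.
move=> n4; have := @taylor_sub n 1 (s + h); rewrite addn1 => /(_ n4 sh).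
by rewrite big_ord1 expr0 fact0 divr1 expr1 scale1r addn0.
Qed.

Let sum2 (x : R) n : \sum_(j < 2) (x ^+ j / j`!%:R)%:C *: f (n + j)%N s =
  f n s + x%:C *: f n.+1 s.
Proof.
by rewrite !big_ord_recl big_ord0 addr0 expr0 fact0 divr1 scale1r addn0
  expr1 divr1 addn1.
Qed.

Let sum3 (x : R) n : \sum_(j < 3) (x ^+ j / j`!%:R)%:C *: f (n + j)%N s =
  f n s + x%:C *: f n.+1 s + (x ^+ 2 / 2)%:C *: f n.+2 s.
Proof. by rewrite big_ord_recr sum2 addn2. Qed.

Let sum4 (x : R) n : \sum_(j < 4) (x ^+ j / j`!%:R)%:C *: f (n + j)%N s =
  f n s + x%:C *: f n.+1 s + (x ^+ 2 / 2)%:C *: f n.+2 s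
  + (x ^+ 3 / 6)%:C *: f n.+3 s.
Proof. by rewrite big_ord_recr sum3 addn3. Qed.

Let double k : c * h ^+ k + c * h ^+ k = 2 * c * h ^+ k. Proof. by ring. Qed.

(** Odd powers of [h] cancel between the two sides, leaving a fourth-order remainder. *)
Lemma second_central_difference :
  nrm (f 0%N (s + h) - 2 *: f 0%N s + f 0%N (s - h) - (h ^+ 2)%:C *: f 2%N s)
    <= 2 * c * h ^+ 4.
Proof.
have := le_trans (nrmD _ _) (lerD (@taylor_sub 0 4 (s + h) isT sh)
  (@taylor_sub 0 4 (s - h) isT smh)).
rewrite double hp hm !sum4; congr (nrm _ <= _).
move: (f 0%N s) (f 1%N s) (f 2%N s) (f 3%N s) => x0 x1 x2 x3.
move: (f 0%N (s + h)) (f 0%N (s - h)) => y z.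
have id4 (K : comNzRingType) (H p q : K) (a0 a1 a2 a3 bp bm : 'cV[K]_m) :
    bp - (a0 + H *: a1 + p *: a2 + q *: a3) +
    (bm - (a0 + - H *: a1 + p *: a2 + - q *: a3)) =
    bp - 2 *: a0 + bm - (2 * p) *: a2.
  by apply/colP => j; rewrite !mxE; ring.
have e1 : (- h)%:C = - h%:C by rewrite rmorphN.
have e2 : ((- h) ^+ 2 / 2)%:C = (h ^+ 2 / 2)%:C by rewrite sqrrN.
have e3 : ((- h) ^+ 3 / 6)%:C = - (h ^+ 3 / 6)%:C.
  by rewrite -rmorphN; congr (_%:C); ring.
have e4 : 2 * (h ^+ 2 / 2)%:C = (h ^+ 2)%:C.
  by rewrite -(rmorph_nat (real_complex R)) -rmorphM; congr (_%:C); field.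
by rewrite e1 e2 e3 id4 e4.
Qed.

Lemma first_central_difference :
  nrm (f 0%N (s + h) - f 0%N (s - h) - (2 * h)%:C *: f 1%N s) <= 2 * c * h ^+ 3.
Proof.
have := le_trans (nrmB _ _) (lerD (@taylor_sub 0 3 (s + h) isT sh)
  (@taylor_sub 0 3 (s - h) isT smh)).
rewrite double hp hm !sum3; congr (nrm _ <= _).
move: (f 0%N s) (f 1%N s) (f 2%N s) => x0 x1 x2.
move: (f 0%N (s + h)) (f 0%N (s - h)) => y z.
by apply/colP => j; rewrite !mxE; field.
Qed.

Lemma second_order_start :
  nrm (f 0%N (s + h) - (f 0%N s + h%:C *: (f 1%N s + (h / 2)%:C *: f 2%N s)))
    <= c * h ^+ 3.
Proof.
have := @taylor_sub 0 3 (s + h) isT sh.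
rewrite hp !sum3; congr (nrm _ <= _).
move: (f 0%N s) (f 1%N s) (f 2%N s) (f 0%N (s + h)) => x0 x1 x2 y.
by apply/colP => j; rewrite !mxE; field.
Qed.

Lemma explicit_euler :
  nrm (f 1%N (s + h) - f 1%N s - h%:C *: f 2%N s) <= c * h ^+ 2.
Proof.
have := @taylor_sub 1 2 (s + h) isT sh.
by rewrite hp (sum2 h 1) opprD addrA.
Qed.

(** The second derivative is eliminated between the expansions of the curve and of
    its derivative, which is why only values of the derivative appear. *)
Lemma trapezoidal_rule :
  nrm (f 1%N (s + h) - f 1%N s - (h / 2)%:C *: (f 2%N (s + h) + f 2%N s))
    <= 2 * c * h ^+ 3.
Proof.
have c0 : 0 <= c by rewrite !mulr_ge0.
have T1 := @taylor_sub 1 3 (s + h) isT sh.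
have T2 := @taylor_sub 2 2 (s + h) isT sh.
have {}T2 : nrm ((h / 2)%:C *: (f 2%N (s + h) -
    \sum_(j < 2) ((s + h - s) ^+ j / j`!%:R)%:C *: f (2 + j)%N s)) <= c * h ^+ 3.
  rewrite nrmZ normc_real ger0_norm ?divr_ge0 //.
  apply: (@le_trans _ _ (h * (c * h ^+ 2))); last by rewrite exprS mulrCA.
  by apply: ler_pM => //; rewrite ?divr_ge0 ?nrm_ge0 //; move: h0; lra.
have := le_trans (nrmB _ _) (lerD T1 T2).
rewrite (double 3).
rewrite hp.
rewrite (sum2 h 2).
rewrite (sum3 h 1).
set u := (X in nrm X <= _ -> _); set w := (X in _ -> nrm X <= _).
suff -> : w = u by []; rewrite {}/w {}/u.
move: (f 1%N s) (f 2%N s) (f 3%N s) (f 1%N (s + h)) (f 2%N (s + h)) => x1 x2 x3 y z.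
by apply/colP => j; rewrite !mxE; field.
Qed.

End Consistency.

(** * The exact orbit *)

Section SmoothTrajectory.
Context {R : realType}.
Local Notation "x %:C" := (real_complex R x).

Definition iterD (W : normedModType R) (f : R^o -> W) n : R^o -> W :=
  iter n (fun g p => 'D_(1 : R^o) g p) f.

Lemma Ck_on_iterD (W : normedModType R) (D : set R^o) k (f : R^o -> W) :
  Ck_on D k f -> forall j, (j <= k)%N ->
  (forall p, D p -> {for p, continuous (iterD f j)}) /\
  ((j < k)%N -> forall p, D p -> derivable (iterD f j) p 1).
Proof.
elim: k f => [|k IH] f /= [fc fd] j.
  by rewrite leqn0 => /eqP ->.
case: j => [_|j jk]; first by split=> // _ p Dp; exact: fd.1.
by rewrite /iterD iterSr; apply: IH => //; exact: fd.2.
Qed.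

Lemma iterD_is_derive (W : normedModType R) (D : set R^o) k (f : R^o -> W) j p :
  Ck_on D k f -> (j < k)%N -> D p -> is_derive p (1 : R^o) (iterD f j) (iterD f j.+1 p).
Proof.
move=> fk jk Dp; have [_ /(_ jk p Dp) fd] := Ck_on_iterD fk (ltnW jk).
exact: DeriveDef.
Qed.

Lemma vderive_col (x : R -> 'cV[R]_3) (t : R -> R[i]) s dx dt :
  is_derive s (1 : R) x dx -> is_cderive t s dt ->
  vderive (fun r => col_mx (MtoC (x r)) (t r)%:M) s (col_mx (MtoC dx) dt%:M).
Proof.
move=> [xd xE] [t1 t2] j; rewrite -(splitK j); case: (fintype.split j) => i /=.
  split.
    rewrite (_ : (fun r => _) = (fun r => x r i 0)); last first.
      by apply/funext => r; rewrite col_mxEu mxE.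
    rewrite col_mxEu mxE /=; apply: DeriveDef; first by move/derivable_mxP: xd; exact.
    by rewrite -xE derive_mx // mxE.
  rewrite (_ : (fun r => _) = cst 0); last first.
    by apply/funext => r; rewrite col_mxEu mxE.
  by rewrite col_mxEu mxE /=; exact: is_derive_cst.
split.
  rewrite (_ : (fun r => _) = (fun r => complex.Re (t r))); last first.
    by apply/funext => r; rewrite col_mxEd mxE ord1.
  by rewrite col_mxEd mxE ord1.
rewrite (_ : (fun r => _) = (fun r => complex.Im (t r))); last first.
  by apply/funext => r; rewrite col_mxEd mxE ord1.
by rewrite col_mxEd mxE ord1.
Qed.

Definition vcontinuous m (f : R -> 'cV[R[i]]_m) (s : R) :=
  forall j, {for s, continuous (fun r => complex.Re (f r j 0))} /\
            {for s, continuous (fun r => complex.Im (f r j 0))}.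

Lemma vcontinuous_col (x : R^o -> 'cV[R]_3) (t : R -> R[i]) s :
  {for s, continuous x} ->
  {for s, continuous (fun r => complex.Re (t r))} ->
  {for s, continuous (fun r => complex.Im (t r))} ->
  vcontinuous (fun r => col_mx (MtoC (x r)) (t r)%:M) s.
Proof.
move=> xc t1 t2 j; rewrite -(splitK j); case: (fintype.split j) => i /=.
  have xE r : col_mx (MtoC (x r)) (t r)%:M (lshift 1 i) 0 = (x r i 0)%:C.
    by rewrite col_mxEu mxE.
  split.
    rewrite (eq_fun (fun r => congr1 (@complex.Re R) (xE r))).
    apply: (continuous_comp xc (g := fun M : 'cV[R]_3 => M i 0)).
    exact: coord_continuous.
  rewrite (eq_fun (fun r => congr1 (@complex.Im R) (xE r))).
  exact: cst_continuous.
have tE r : col_mx (MtoC (x r)) (t r)%:M (rshift 3 i) 0 = t r.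
  by rewrite col_mxEd mxE ord1.
by split; rewrite (eq_fun (fun r => congr1 _ (tE r))).
Qed.

Lemma vderive_continuous m (f : R -> 'cV[R[i]]_m) s df :
  vderive f s df -> vcontinuous f s.
Proof. by move=> fd j; have [? ?] := fd j; split; apply: is_derive_continuous. Qed.

Lemma vcontinuous_bounded m (f : R -> 'cV[R[i]]_m) a b : a <= b ->
  (forall s, a <= s <= b -> vcontinuous f s) ->
  exists M, forall s, a <= s <= b -> nrm (f s) <= M.
Proof.
move=> ab fc.
have /fin_all_exists[M HM] : forall j, exists M, forall s, a <= s <= b -> normc (f s j 0) <= M.
  move=> j.
  have bnd (g : R -> R) : (forall s, a <= s <= b -> {for s, continuous g}) ->
      exists M, forall s, a <= s <= b -> `|g s| <= M.
    move=> gc; have [|c _ gM] := @EVT_max R (fun s => `|g s|) a b ab.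
      apply: continuous_in_subspaceT => s; rewrite inE /= in_itv /= => sab.
      by apply: cvg_norm; exact: gc.
    by exists `|g c| => s sab; apply: gM; rewrite in_itv.
  have [s sab|M1 H1] := bnd (fun r => complex.Re (f r j 0)); first by have [] := fc s sab j.
  have [s sab|M2 H2] := bnd (fun r => complex.Im (f r j 0)); first by have [] := fc s sab j.
  exists (M1 + M2) => s sab; rewrite (le_trans (normc_le_ReIm _)) //.
  by rewrite lerD ?H1 ?H2.
exists (\sum_j M j) => s sab; rewrite /nrm; apply: ler_sum => i _.
by rewrite big_ord1 HM.
Qed.

Variables (J : set R) (s : trajectory R R).

(** State, momentum and the derivatives of the momentum, as one sequence of complex
    vectors of which each is the derivative of the previous one. *)
Definition trajectory_jet n : R -> 'cV[R[i]]_(3 + 1) :=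
  if n is n'.+1 then fun r =>
    col_mx (MtoC (iterD (trj_v s) n' r))
      (Complex (iterD ((fun r => complex.Re (trj_w s r)) : R^o -> R^o) n' r)
               (iterD ((fun r => complex.Im (trj_w s r)) : R^o -> R^o) n' r))%:M
  else yvec s.

Lemma trajectory_jet1 : trajectory_jet 1 = uvec s.
Proof.
apply/funext => r; rewrite /trajectory_jet /uvec /iterD /=.
by case: (trj_w s r).
Qed.

Variables (B E : 'cV[R]_3 -> 'cV[R]_3).
Hypotheses (sol : is_solution B E J s) (smooth : smooth_trajectory J 3 s).

Lemma solution_yvec r : J r -> vderive (yvec s) r (uvec s r).
Proof. by move=> /sol [_ xd td _ _]; exact: vderive_col. Qed.

Lemma solution_uvec r : J r ->
  vderive (uvec s) r (Fmx (B (trj_x s r)) (E (trj_x s r)) *m uvec s r).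
Proof.
move=> /sol [_ _ _ vd wd] j; rewrite Fmx_uvec.
rewrite -(splitK j); case: (fintype.split j) => i /=.
  rewrite col_mxEu; rewrite (_ : (fun r => _) = (fun r => MtoC (trj_v s r) i 0)) //.
  by apply/funext => u; rewrite col_mxEu.
rewrite col_mxEd (_ : (fun r => _) = trj_w s).
  by rewrite mxE !ord1.
by apply/funext => u; rewrite col_mxEd mxE !ord1.
Qed.

Lemma trajectory_jet_derive n r : (n < 4)%N -> J r ->
  vderive (trajectory_jet n) r (trajectory_jet n.+1 r).
Proof.
have [_ vs _ [ws1 ws2]] := smooth.
case: n => [|n] n4 Jr; first by rewrite trajectory_jet1; exact: solution_yvec.
apply: vderive_col; first exact: (iterD_is_derive vs).
by split; [exact: (iterD_is_derive ws1)|exact: (iterD_is_derive ws2)].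
Qed.

Lemma trajectory_jet_continuous n r : (n <= 4)%N -> J r ->
  vcontinuous (trajectory_jet n) r.
Proof.
rewrite leq_eqVlt => /predU1P[->|n4] Jr; last first.
  exact: vderive_continuous (trajectory_jet_derive n4 Jr).
have [_ vs _ [ws1 ws2]] := smooth.
have [/(_ r Jr) vc _] := Ck_on_iterD vs (leqnn 3).
have [/(_ r Jr) wc1 _] := Ck_on_iterD ws1 (leqnn 3).
have [/(_ r Jr) wc2 _] := Ck_on_iterD ws2 (leqnn 3).
exact: (@vcontinuous_col _ (fun r => Complex
  (iterD ((fun r => complex.Re (trj_w s r)) : R^o -> R^o) 3 r)
  (iterD ((fun r => complex.Im (trj_w s r)) : R^o -> R^o) 3 r)) _ vc wc1 wc2).
Qed.

Lemma trajectory_jet2 r : J r ->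
  trajectory_jet 2 r = Fmx (B (trj_x s r)) (E (trj_x s r)) *m uvec s r.
Proof.
move=> Jr; apply: (@vderive_unique R _ (trajectory_jet 1) r).
  exact: trajectory_jet_derive.
by rewrite trajectory_jet1; exact: solution_uvec.
Qed.

End SmoothTrajectory.

(** * A tube around the orbit *)

Section Tube.
Context {R : realType}.

Lemma l2norm_triangle n (p q r : 'cV[R]_n) :
  l2norm (p - r) <= n%:R * (l2norm (p - q) + l2norm (q - r)).
Proof.
rewrite (le_trans (l2norm_le_nrm _)) // mulrDr.
rewrite (_ : p - r = (p - q) + (q - r)); last by rewrite addrA subrK.
rewrite map_mxD (le_trans (nrmD _ _)) //.
by rewrite lerD // nrm_MtoC_le.
Qed.

(** By compactness the local Lipschitz bounds along the orbit hold on a tube of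
    constant radius around it. *)
Lemma lipschitz_tube (x : R -> 'cV[R]_3) (F : 'cV[R]_3 -> 'cV[R]_3) (L T : R) :
  (forall r, 0 <= r <= T -> forall e, 0 < e ->
     \forall u \near r, l2norm (x u - x r) < e) ->
  (forall r, 0 <= r <= T -> lipschitz_near L F (x r)) ->
  exists rho m, [/\ 0 < rho, 0 <= m &
    forall r, 0 <= r <= T -> l2norm (F (x r)) <= m /\
      forall p, l2norm (p - x r) < rho ->
        l2norm (F p - F (x r)) <= `|L| * l2norm (p - x r)].
Proof.
move=> xc FL.
have /compact_near_coveringP cov := @segment_compact R 0 T.
have xL p q : l2norm (F p - F q) <= L * l2norm (p - q) ->
    l2norm (F p - F q) <= `|L| * l2norm (p - q).
  by move/le_trans; apply; rewrite ler_wpM2r ?l2norm_ge0 // ler_norm.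
have [rho rho0 Hrho] : exists2 rho, 0 < rho & forall r, 0 <= r <= T ->
    forall p, l2norm (p - x r) < rho ->
      l2norm (F p - F (x r)) <= `|L| * l2norm (p - x r).
  have := cov R (at_right (0 : R)) (fun rho r => forall p, l2norm (p - x r) < rho ->
      l2norm (F p - F (x r)) <= `|L| * l2norm (p - x r)).
  move=> /(_ _) [].
    move=> r; rewrite /= in_itv /= => rT; have [d d0 Hd] := FL r rT.
    have d6 : 0 < d / 6 by rewrite divr_gt0.
    near=> u rho => /= p pu.
    have ur : l2norm (x u - x r) < d / 6 by near: u; exact: xc.
    have rd : rho < d / 6 by near: rho; exact: nbhs_right_lt.
    apply: xL => //; apply: Hd; last by rewrite (lt_trans ur) //; lra.
    rewrite (le_lt_trans (l2norm_triangle p (x u) (x r))) //; lra.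
  move=> e /= e0 He; exists (e / 2); rewrite ?divr_gt0 // => r rT.
  have e2 : 0 < e / 2 by rewrite divr_gt0.
  have ball_e : `|0 - e / 2| < e by rewrite sub0r normrN gtr0_norm //; lra.
  by apply: (He (e / 2) ball_e e2); rewrite /= in_itv.
have [m m0 Hm] : exists2 m, 0 <= m & forall r, 0 <= r <= T -> l2norm (F (x r)) <= m.
  have := cov R (pinfty_nbhs R) (fun m r => l2norm (F (x r)) <= m).
  move=> /(_ _) [].
    move=> r; rewrite /= in_itv /= => rT; have [d d0 Hd] := FL r rT.
    near=> u m => /=.
    have ur : l2norm (x u - x r) < d by near: u; exact: xc.
    have := Hd (x u) (x r) ur; rewrite subrr l2norm0 => /(_ d0) => FuL.
    have := l2norm_triangle (F (x u)) (F (x r)) 0; rewrite !subr0 => /le_trans; apply.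
    apply: (@le_trans _ _ (3 * (`|L| * d + l2norm (F (x r))))).
      rewrite ler_wpM2l // lerD2r (le_trans (xL _ _ FuL)) //.
      by rewrite ler_wpM2l // ltW.
    by near: m; apply: nbhs_pinfty_ge; rewrite num_real.
  move=> M [_ HM]; exists (Num.max 0 (M + 1)); first by rewrite le_max lexx.
  move=> r rT; rewrite le_max; apply/orP; right.
  have M1 : M < M + 1 by rewrite ltrDl.
  by apply: (HM (M + 1) M1); rewrite /= in_itv.
by exists rho, m; split=> // r rT; split; [exact: Hm|exact: Hrho].
Unshelve. all: by end_near. Qed.

End Tube.

(** * The methods in matrix form *)

Section OneMatrixForm.
Context {R : realType}.
Local Notation "x %:C" := (real_complex R x).
Local Notation ii := (Complex 0 1 : R[i]).
Implicit Types (b e : 'cV[R]_3) (m : method) (h : R) (z : trajectory R nat).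

(** Each recursion equates the second difference of the state to one matrix times its
    first difference; the dual field matrix of the filtered methods is [Fmx e (- b)],
    with [b0] for [b] in the method that freezes it. *)
Definition step_matrix m h b e b0 e0 : 'M[R[i]]_(3 + 1) :=
  let c := 2 / h%:C in
  match m with
  | M1 => (c * K1 h b e) *: Fmx b e + (c * K2 h b e) *: Fmx e (- b)
  | M2 => (c * K1 h b0 e0) *: Fmx b e + (c * K2 h b0 e0) *: Fmx e (- b0)
  | M3 => (c * K1 h b0 e0) *: Fmx b e
  | M4 => Fmx b e
  end.

(** The exponential update of the first method is not the action of one matrix on the
    first difference of the state; the value given to it here is a placeholder. *)
Definition momentum_matrix m h b e b0 e0 : 'M[R[i]]_(3 + 1) :=
  match m with
  | M2 => (K3 h b0 e0)%:M + K4 h b0 e0 *: (Fmx b e *m Fmx b e)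
  | M3 => (K3 h b0 e0)%:M
  | _ => 1%:M
  end.

Lemma yvec_diff1 h z n :
  col_mx (MtoC (diff1 h (trj_x z) n)) (diff1 h%:C (trj_t z) n)%:M =
  (2 * h)%:C^-1 *: (yvec z n.+1 - yvec z n.-1).
Proof.
rewrite /diff1 /yvec opp_col_mx add_col_mx scale_col_mx.
rewrite map_mxZ map_mxB fmorphV; congr col_mx.
by rewrite -raddfB scale_scalar_mx (rmorphM _ 2) rmorph_nat.
Qed.

Lemma yvec_diff2 h z n :
  col_mx (MtoC (diff2 h (trj_x z) n)) (diff2 h%:C (trj_t z) n)%:M =
  (h ^+ 2)%:C^-1 *: (yvec z n.+1 - 2 *: yvec z n + yvec z n.-1).
Proof.
rewrite /diff2 /yvec scale_col_mx opp_col_mx !add_col_mx scale_col_mx.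
rewrite map_mxZ map_mxD map_mxB map_mxZ fmorphV rmorph_nat; congr col_mx.
by rewrite scale_scalar_mx -raddfB -raddfD scale_scalar_mx rmorphXn.
Qed.

Lemma position_step_matrix m h (B E : 'cV[R]_3 -> 'cV[R]_3) z n : h != 0 ->
  position_step B E m h z n ->
  yvec z n.+1 - 2 *: yvec z n + yvec z n.-1 =
  (h / 2)%:C *: (step_matrix m h (B (trj_x z n)) (E (trj_x z n))
       (B (trj_x z 0%N)) (E (trj_x z 0%N)) *m (yvec z n.+1 - yvec z n.-1)).
Proof.
move=> h0 st.
pose G := step_matrix m h (B (trj_x z n)) (E (trj_x z n))
       (B (trj_x z 0%N)) (E (trj_x z 0%N)).
suff H : col_mx (MtoC (diff2 h (trj_x z) n)) (diff2 h%:C (trj_t z) n)%:M =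
    G *m col_mx (MtoC (diff1 h (trj_x z) n)) (diff1 h%:C (trj_t z) n)%:M.
  have hC0 : (h ^+ 2)%:C != 0 by rewrite fmorph_eq0 expf_eq0.
  apply: (scalerI (invr_neq0 hC0)); rewrite -yvec_diff2 H yvec_diff1 -/G.
  rewrite -scalemxAr scalerA; congr (_ *: _).
  by rewrite -!fmorphV -rmorphM; congr (_%:C); field.
rewrite /G {G}; case: m st => /= -[-> ->].
- by rewrite FmxEN FmxE; symmetry; apply: block_field_combination.
- by rewrite FmxEN FmxE; symmetry; apply: block_field_combination; rewrite [2 * ii / _]mulrAC.
- rewrite -scalemxAl FmxE block_field_col scale_col_mx scale_scalar_mx.
  by congr (col_mx _ _%:M); rewrite [2 * ii / _]mulrAC -!mulrA [ii * (K1 _ _ _ * _)]mulrCA.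
- by rewrite FmxE block_field_col.
Qed.

Lemma momentum_step_matrix m h (B E : 'cV[R]_3 -> 'cV[R]_3) z n : h != 0 -> m <> M1 ->
  momentum_step B E m h z n ->
  uvec z n.+1 =
  (2 * h)%:C^-1 *: (momentum_matrix m h (B (trj_x z n.+1)) (E (trj_x z n.+1))
       (B (trj_x z 0%N)) (E (trj_x z 0%N)) *m (yvec z n.+2 - yvec z n)).
Proof.
move=> h0 mM1 st; rewrite scalemxAr -(yvec_diff1 h z n.+1) /uvec.
case: m mM1 st => //= _ [-> ->].
- rewrite FmxE block_field_quadratic; last by rewrite -expr2 sqr_i.
  have -> : (dot (E (trj_x z n.+1)) (E (trj_x z n.+1)))%:C =
    (MtoC (E (trj_x z n.+1))^T *m MtoC (E (trj_x z n.+1))) 0 0.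
    by rewrite -map_mxM mxE.
  by rewrite map_mxD !map_mxM.
- by rewrite mul_scalar_mx scale_col_mx scale_scalar_mx.
- by rewrite mul1mx.
Qed.

End OneMatrixForm.

Section MatrixBounds.
Context {R : realType}.
Local Notation "x %:C" := (real_complex R x).
Implicit Types (b e : 'cV[R]_3) (m : method) (h : R).
Variable M : R.
Hypothesis M0 : 0 <= M.

Let two_e0 : 0 <= two_e :> R. Proof. by rewrite (le_trans _ two_e_ge2). Qed.
Let D : R := 12 * M ^+ 2.
Let D0 : 0 <= D. Proof. by rewrite mulr_ge0 ?exprn_ge0. Qed.

Let kD0 : 0 <= two_e * D. Proof. exact: mulr_ge0. Qed.
Let kD2 : 0 <= 2 * two_e * D. Proof. by rewrite -mulrA; apply: mulr_ge0. Qed.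
Let M32 : 0 <= 32 * M. Proof. exact: mulr_ge0. Qed.

Let Fmx_le b e : l2norm b <= M -> l2norm e <= M -> nrm (Fmx b e) <= 32 * M.
Proof. by move=> bM eM; rewrite (le_trans (nrm_Fmx b e)) //; lra. Qed.

Let sizes h b e : 0 < h -> h ^+ 2 * D <= 1 -> l2norm b <= M -> l2norm e <= M ->
  dd b e <= D /\ h ^+ 2 * dd b e <= 1.
Proof.
move=> h0 hD bM eM; have dM := dd_le bM eM; split=> //.
by rewrite (le_trans _ hD) // ler_wpM2l ?exprn_ge0 // ltW.
Qed.

Let K1_scaled h b e : 0 < h -> h ^+ 2 * D <= 1 -> l2norm b <= M -> l2norm e <= M ->
  normc (2 / h%:C * K1 h b e - 1) <= 2 * two_e * D * h ^+ 2.
Proof.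
move=> h0 hD bM eM; have [dD hd] := sizes h0 hD bM eM; have h0' := ltW h0.
have -> : 2 / h%:C * K1 h b e - 1 = (2 / h)%:C * (K1 h b e - (h / 2)%:C).
  rewrite mulrBr -rmorphM (_ : 2 / h * (h / 2) = 1); last by field; rewrite gt_eqF.
  by rewrite rmorph1 fmorph_div rmorph_nat.
rewrite normcM normc_real ger0_norm ?divr_ge0 //.
apply: (@le_trans _ _ (2 / h * (two_e * D * h ^+ 3))).
  rewrite ler_wpM2l ?divr_ge0 // (le_trans (K1_bound (ltW h0) hd)) //.
  by rewrite ler_wpM2r ?exprn_ge0 // ler_wpM2l.
by rewrite le_eqVlt; apply/orP; left; apply/eqP; field; rewrite gt_eqF.
Qed.

Let K2_scaled h b e : 0 < h -> h ^+ 2 * D <= 1 -> l2norm b <= M -> l2norm e <= M ->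
  normc (2 / h%:C * K2 h b e) <= 2 * two_e * D * h ^+ 2.
Proof.
move=> h0 hD bM eM; have [dD hd] := sizes h0 hD bM eM; have h0' := ltW h0.
have -> : 2 / h%:C = (2 / h)%:C by rewrite fmorph_div rmorph_nat.
rewrite normcM normc_real ger0_norm ?divr_ge0 //.
apply: (@le_trans _ _ (2 / h * (two_e * D * h ^+ 3))).
  rewrite ler_wpM2l ?divr_ge0 // (le_trans (K2_bound (ltW h0) hd)) //.
  by rewrite ler_wpM2r ?exprn_ge0 // ler_wpM2l.
by rewrite le_eqVlt; apply/orP; left; apply/eqP; field; rewrite gt_eqF.
Qed.

Let C : R := 2 * (2 * two_e * D * (32 * M)).

(** All four methods are second-order perturbations of the unfiltered one, since
    [2 / h * K1 = 1 + O(h ^+ 2)] and [2 / h * K2 = O(h ^+ 2)]. *)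
Lemma step_matrix_bound m h b e b0 e0 : 0 < h -> h ^+ 2 * (12 * M ^+ 2) <= 1 ->
  l2norm b <= M -> l2norm e <= M -> l2norm b0 <= M -> l2norm e0 <= M ->
  nrm (step_matrix m h b e b0 e0 - Fmx b e) <= C * h ^+ 2.
Proof.
move=> h0 hD bM eM bM0 eM0; rewrite -/D in hD.
have h20 : 0 <= h ^+ 2 by exact: sqr_ge0.
have E0 : 0 <= 2 * two_e * D * h ^+ 2 by exact: mulr_ge0.
have term k b' e' : normc k <= 2 * two_e * D * h ^+ 2 -> l2norm b' <= M -> l2norm e' <= M ->
    nrm (k *: Fmx b' e') <= 2 * two_e * D * h ^+ 2 * (32 * M).
  move=> kE b'M e'M; rewrite nrmZ ler_pM ?normc_ge0 ?nrm_ge0 //.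
  exact: Fmx_le.
have E1 : 0 <= 2 * two_e * D * h ^+ 2 * (32 * M) by exact: mulr_ge0.
have two (k1 k2 : R[i]) (X Y : 'M[R[i]]_(3 + 1)) :
    nrm ((k1 - 1) *: X) <= 2 * two_e * D * h ^+ 2 * (32 * M) ->
    nrm (k2 *: Y) <= 2 * two_e * D * h ^+ 2 * (32 * M) ->
    nrm (k1 *: X + k2 *: Y - X) <= C * h ^+ 2.
  move=> H1 H2; rewrite addrAC -{2}[X]scale1r -scalerBl (le_trans (nrmD _ _)) //.
  by rewrite (le_trans (lerD H1 H2)) // /C; lra.
case: m; rewrite /step_matrix.
- by apply: two; apply: term; rewrite ?l2normN // ?K1_scaled ?K2_scaled.
- by apply: two; apply: term; rewrite ?l2normN // ?K1_scaled ?K2_scaled.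
- rewrite -[X in X - _]addr0 -(scale0r (Fmx b e)); apply: two.
    by apply: term; rewrite // ?K1_scaled.
  by rewrite scale0r nrm0.
- by rewrite subrr nrm0 /C; lra.
Qed.

Let nrm1 : nrm (1%:M : 'M[R[i]]_(3 + 1)) <= 16.
Proof.
rewrite -[leRHS]mulr1; apply: nrm_le_entries => i j.
by rewrite mxE; case: (i == j); rewrite ?normc1 ?normc0.
Qed.

Let C' : R := 16 * (two_e * D) + two_e * (32 * M * (32 * M)).

Lemma momentum_matrix_bound m h b e b0 e0 : 0 < h -> h ^+ 2 * (12 * M ^+ 2) <= 1 ->
  l2norm b <= M -> l2norm e <= M -> l2norm b0 <= M -> l2norm e0 <= M ->
  nrm (momentum_matrix m h b e b0 e0 - 1%:M) <= C' * h ^+ 2.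
Proof.
move=> h0 hD bM eM bM0 eM0; rewrite -/D in hD.
have h20 : 0 <= h ^+ 2 by exact: sqr_ge0.
have [dD hd] := sizes h0 hD bM0 eM0.
have T3 : nrm ((K3 h b0 e0)%:M - 1%:M : 'M[R[i]]_(3 + 1)) <= 16 * (two_e * D) * h ^+ 2.
  rewrite -[(K3 _ _ _)%:M]scalemx1 -{2}[1%:M]scale1r -scalerBl nrmZ.
  apply: (@le_trans _ _ (two_e * D * h ^+ 2 * 16)); last by rewrite le_eqVlt; apply/orP; left; apply/eqP; ring.
  rewrite ler_pM ?normc_ge0 ?nrm_ge0 // (le_trans (K3_bound (ltW h0) hd)) //.
  by rewrite ler_wpM2r // ler_wpM2l.
have T4 : nrm (K4 h b0 e0 *: (Fmx b e *m Fmx b e)) <= two_e * (32 * M * (32 * M)) * h ^+ 2.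
  rewrite nrmZ mulrAC ler_pM ?normc_ge0 ?nrm_ge0 //.
    exact: (K4_bound (ltW h0) hd).
  by apply: nrm_le_mul; exact: Fmx_le.
have P3 : 0 <= 16 * (two_e * D) * h ^+ 2 by apply: mulr_ge0 => //; exact: mulr_ge0.
have P4 : 0 <= two_e * (32 * M * (32 * M)) * h ^+ 2.
  by apply: mulr_ge0 => //; apply: mulr_ge0 => //; exact: mulr_ge0.
rewrite /C' mulrDl; case: m; rewrite /momentum_matrix.
- by rewrite subrr nrm0 addr_ge0.
- by rewrite addrAC (le_trans (nrmD _ _)) // lerD.
- by rewrite (le_trans T3) // lerDl.
- by rewrite subrr nrm0 addr_ge0.
Qed.

End MatrixBounds.

(** * Stability of the recursions *)

Section Stability.
Context {R : realType}.
Local Notation "x %:C" := (real_complex R x).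

Lemma geometric_le_exp (a h T : R) n : 0 <= a -> 0 <= h -> n%:R * h <= T ->
  (1 + a * h) ^+ n <= expR (a * T).
Proof.
move=> a0 h0 nT; apply: (@le_trans _ _ (expR (a * h) ^+ n)).
  by rewrite lerXn2r ?nnegrE ?expR_ge0 ?addr_ge0 ?mulr_ge0 // expR_ge1Dx.
by rewrite -expRM_natl ler_expR mulrCA ler_wpM2l.
Qed.

(** Adding [h ^+ 2] to the error absorbs the defect [c h ^+ 3] into the growth factor. *)
Lemma one_step_stability p (g : nat -> 'cV[R[i]]_p) (h c T : R) :
  0 <= h -> 0 <= c -> g 0%N = 0 ->
  (forall n, n.+1%:R * h <= T ->
     nrm (g n.+1) <= (1 + c * h) * nrm (g n) + c * h ^+ 3) ->
  forall n, n%:R * h <= T -> nrm (g n) <= expR (c * T) * h ^+ 2.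
Proof.
move=> h0 c0 g0 step.
have mono n : n.+1%:R * h <= T -> n%:R * h <= T.
  by apply: le_trans; rewrite ler_wpM2r // ler_nat.
have H n : n%:R * h <= T -> nrm (g n) + h ^+ 2 <= (1 + c * h) ^+ n * h ^+ 2.
  elim: n => [_|n IH nT]; first by rewrite g0 nrm0 expr0 add0r mul1r.
  have := IH (mono n nT); have := step n nT => s1 s2.
  have : (1 + c * h) * (nrm (g n) + h ^+ 2) <= (1 + c * h) * ((1 + c * h) ^+ n * h ^+ 2).
    by rewrite ler_wpM2l // addr_ge0 // mulr_ge0.
  rewrite mulrA -[(1 + c * h) * (1 + c * h) ^+ n]exprS; apply: le_trans.
  have : h ^+ 3 = h * h ^+ 2 by rewrite exprS.
  nra.
move=> n nT; have := H n nT; have := geometric_le_exp c0 h0 nT.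
have h2 := sqr_ge0 h => s1 s2.
have : (1 + c * h) ^+ n * h ^+ 2 <= expR (c * T) * h ^+ 2 by rewrite ler_wpM2r.
lra.
Qed.

(** Each step moves the weighted error [h |e_n| + |e_n - e_(n-1)|] by a factor
    [1 + O(h)] and a defect [O(h ^+ 4)]; adding [h ^+ 3] to it absorbs the defect.
    The bound on [e_n] obtained so far keeps the next step inside the region of
    radius [rho] where the step is controlled. *)
Lemma two_step_stability p (e : nat -> 'cV[R[i]]_p) (h c T rho : R) :
  let K := (2 * c + 1) * expR ((1 + 4 * c) * T) in
  0 < h -> h <= 1 -> 0 <= c -> c * h <= 1 -> K * h ^+ 2 < rho ->
  e 0%N = 0 -> nrm (e 1%N) <= c * h ^+ 3 ->
  (forall n, (0 < n)%N -> n%:R * h <= T -> nrm (e n) < rho ->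
     exists2 G, nrm G <= c &
       nrm (e n.+1 - 2 *: e n + e n.-1 - (h / 2)%:C *: (G *m (e n.+1 - e n.-1)))
         <= c * h ^+ 2 * nrm (e n) + c * h ^+ 4) ->
  forall n, n%:R * h <= T ->
    nrm (e n.+1 - e n) <= K * h ^+ 3 /\ nrm (e n.+1) <= K * h ^+ 2.
Proof.
move=> K h0 h1 c0 ch Krho e0 e1 step.
have h0' := ltW h0.
have a0 : 0 <= 1 + 4 * c by rewrite addr_ge0 ?mulr_ge0.
pose w n := h * nrm (e n.+1) + nrm (e n.+1 - e n) + h ^+ 3.
have h3 : 0 < h ^+ 3 by rewrite exprn_gt0.
have wK n : n%:R * h <= T ->
    w n <= (1 + (1 + 4 * c) * h) ^+ n * ((2 * c + 1) * h ^+ 3) -> w n <= K * h ^+ 3.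
  move=> nT; move/le_trans; apply; rewrite mulrA /K [(2 * c + 1) * expR _]mulrC (ler_wpM2r (ltW h3)) //.
  by rewrite ler_wpM2r ?addr_ge0 ?mulr_ge0 // geometric_le_exp.
have wE n : w n <= K * h ^+ 3 ->
    nrm (e n.+1 - e n) <= K * h ^+ 3 /\ nrm (e n.+1) <= K * h ^+ 2.
  have d0 := nrm_ge0 (e n.+1 - e n); have e0' := nrm_ge0 (e n.+1).
  have he0 : 0 <= h * nrm (e n.+1) by rewrite mulr_ge0.
  rewrite /w => H; split; first lra.
  rewrite -(ler_pM2l h0) [h * (K * _)]mulrCA -exprS; lra.
have mono n : n.+1%:R * h <= T -> n%:R * h <= T.
  by apply: le_trans; rewrite ler_wpM2r // ler_nat.
suff H n : n%:R * h <= T ->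
    w n <= (1 + (1 + 4 * c) * h) ^+ n * ((2 * c + 1) * h ^+ 3).
  by move=> n nT; apply: wE; apply: wK => //; exact: H.
elim: n => [_|n IH nT].
  rewrite expr0 mul1r /w e0 subr0.
  have : h * nrm (e 1%N) <= 1 * nrm (e 1%N) by rewrite ler_wpM2r ?nrm_ge0.
  lra.
have nT' := mono n nT; have IHn := IH nT'.
have [_ en] := wE n (wK n nT' IHn).
have [G Gc] := step n.+1 isT nT (le_lt_trans en Krho).
rewrite /=; set d' := e n.+2 - e n.+1; set d := e n.+1 - e n.
have -> : e n.+2 - 2 *: e n.+1 + e n = d' - d.
  by rewrite /d' /d scaler_nat mulr2n opprD opprB !addrA [LHS]addrAC.
have -> : e n.+2 - e n = d' + d by rewrite /d' /d addrA subrK.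
move=> res.
have x0 : 0 <= nrm d by exact: nrm_ge0.
have y0 : 0 <= nrm d' by exact: nrm_ge0.
have z0 : 0 <= nrm (e n.+1) by exact: nrm_ge0.
have key : nrm d' <= nrm d + h / 2 * (c * (nrm d' + nrm d)) +
    (c * h ^+ 2 * nrm (e n.+1) + c * h ^+ 4).
  pose S := (h / 2)%:C *: (G *m (d' + d)).
  have dE : d' = d + S + (d' - d - S) by rewrite -(addrA d') -opprD [RHS]addrC subrK.
  rewrite {1}dE (le_trans (nrmD _ _)) // lerD // (le_trans (nrmD _ _)) // lerD2l.
  rewrite nrmZ normc_real ger0_norm ?divr_ge0 // ler_wpM2l ?divr_ge0 //.
  by rewrite (le_trans (nrmM _ _)) // ler_pM ?nrm_ge0 // nrmD.
have en1 : nrm (e n.+2) <= nrm (e n.+1) + nrm d'.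
  by rewrite -{1}[e n.+2](subrK (e n.+1)) addrC (le_trans (nrmD _ _)) // addrC.
have fin : w n.+1 <= (1 + (1 + 4 * c) * h) * w n.
  rewrite /w -/d -/d'.
  move: (nrm d) (nrm d') (nrm (e n.+1)) (nrm (e n.+2)) x0 y0 z0 key en1.
  move=> x y z z' x0 y0 z0 key en1.
  have ch0 : 0 <= c * h by rewrite mulr_ge0.
  (* (1 + a) / (1 - a) <= 1 + 4 a for a = c h / 2 <= 1 / 2 *)
  have key2 : y <= (1 + 2 * (c * h)) * x + 2 * (c * h) * (h * z) + 2 * (c * h) * h ^+ 3.
    pose a := c * h / 2.
    have a1 : 0 <= 1 - 2 * a by rewrite /a; lra.
    have a2 : 0 <= a by rewrite /a; lra.
    have a3 : 0 < 1 - a by lra.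
    have b0 : 0 <= h * z + h ^+ 3 by rewrite addr_ge0 ?mulr_ge0 // ltW.
    have p1 : 0 <= a * (1 - 2 * a) * x by rewrite mulr_ge0 // mulr_ge0.
    have p2 : 0 <= a * (1 - 2 * a) * (h * z + h ^+ 3) by rewrite mulr_ge0 // mulr_ge0.
    have cE : c * h = 2 * a by rewrite /a; field.
    rewrite cE -(ler_pM2l a3).
    have key' : y <= x + a * (y + x) + 2 * a * (h * z + h ^+ 3).
      have -> : a * (y + x) = h / 2 * (c * (y + x)) by rewrite /a; field.
      have -> : 2 * a * (h * z + h ^+ 3) = c * h ^+ 2 * z + c * h ^+ 4.
        by rewrite /a; field.
      lra.
    nra.
  have hz : h * z' <= h * z + h * y by rewrite -mulrDr ler_wpM2l.
  have t0 : 0 <= c * h * (x + h * z + h ^+ 3).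
    by rewrite mulr_ge0 // addr_ge0 ?(ltW h3) // addr_ge0 // mulr_ge0.
  have t1 : h * (c * h * (x + h * z + h ^+ 3)) <= 1 * (c * h * (x + h * z + h ^+ 3)).
    by rewrite ler_wpM2r.
  have t2 : h * y <= h * ((1 + 2 * (c * h)) * x + 2 * (c * h) * (h * z) + 2 * (c * h) * h ^+ 3).
    by rewrite ler_wpM2l.
  have t3 : 0 <= h * (h * z + h ^+ 3).
    by rewrite mulr_ge0 // addr_ge0 ?(ltW h3) // mulr_ge0.
  nra.
rewrite exprS -mulrA (le_trans fin) // ler_wpM2l // addr_ge0 // mulr_ge0 //.
Qed.

End Stability.

(** * Local error of a product of exponentials *)

Section LinearIdentities.
Variables (K : numFieldType) (p : nat).
Implicit Types (X Q R S P : 'M[K]_p) (u v w : 'cV[K]_p) (k H : K).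

(** With [R0] and [R1] the remainders of the two factors, everything on the right but
    the defects of the trapezoidal rule and of Euler's method has an explicit factor
    of third order or contains the difference [P1 - P0]. *)
Lemma two_factor_expansion H P0 P1 S X0 X1 w0 w1 :
  let Q0 := (H / 2) *: P0 + S in
  let Q1 := (H / 2) *: P1 + S in
  let R0 := X0 - (1%:M + Q0) in
  let R1 := X1 - (1%:M + Q1) in
  S = (H ^+ 2 / 8) *: (P0 *m P0) ->
  w1 - X1 *m (X0 *m w0) =
    (w1 - w0 - (H / 2) *: (P1 *m w1 + P0 *m w0))
    + (H / 2) *: (P1 *m (w1 - w0 - H *: (P0 *m w0)))
    + (H ^+ 2 / 4) *: ((P1 - P0) *m (P0 *m w0))
    - (R0 *m w0 + R1 *m (X0 *m w0) + Q1 *m (R0 *m w0)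
       + (H / 2) *: (P1 *m (S *m w0)) + S *m (Q0 *m w0)).
Proof.
move=> Q0 Q1 R0 R1 SE.
have X1e : X1 = 1%:M + Q1 + R1 by rewrite /R1 addrC subrK.
have X1E v : X1 *m v = v + Q1 *m v + R1 *m v by rewrite {1}X1e !mulmxDl mul1mx.
have X0e : X0 = 1%:M + Q0 + R0 by rewrite /R0 addrC subrK.
have X0E v : X0 *m v = v + Q0 *m v + R0 *m v by rewrite {1}X0e !mulmxDl mul1mx.
rewrite X1E; move: (R1 *m _) => r1; clear R1 X1e X1E.
rewrite X0E; move: R0 {X0e X0E} => R0.
have Q1E v : Q1 *m v = (H / 2) *: (P1 *m v) + S *m v by rewrite mulmxDl scalemxAl.
have Q0E v : Q0 *m v = (H / 2) *: (P0 *m v) + S *m v by rewrite mulmxDl scalemxAl.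
rewrite !mulmxDr Q0E; move: (Q1 *m (R0 *m w0)) (R0 *m w0) => q r0.
rewrite !Q1E !mulmxDr !mulmxBl -!scalemxAr.
have -> : S *m w0 = (H ^+ 2 / 8) *: (P0 *m (P0 *m w0)).
  by rewrite SE -scalemxAl mulmxA.
rewrite ?mulmxDr ?mulmxN -?scalemxAr.
apply/colP => j; rewrite !col_entryE.
by field.
Qed.

End LinearIdentities.

Section UniformO.
Context {R : realType}.
Local Notation "x %:C" := (real_complex R x).
Variables (I : Type) (h : I -> R).
Hypothesis h01 : forall i, 0 < h i <= 1.

Let h0 i k : 0 <= h i ^+ k.
Proof. by have /andP[/ltW ? _] := h01 i; rewrite exprn_ge0. Qed.

(** The constant is uniform over the index type, which will collect step sizes,
    numerical solutions and time indices; orders then combine by algebra. *)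
Definition unifO k m n (A : I -> 'M[R[i]]_(m, n)) : Prop :=
  exists2 c, 0 <= c & forall i, nrm (A i) <= c * h i ^+ k.

Lemma unifOD k m n (A B : I -> 'M[R[i]]_(m, n)) :
  unifO k A -> unifO k B -> unifO k (fun i => A i + B i).
Proof.
move=> [a a0 Aa] [b b0 Bb]; exists (a + b); first exact: addr_ge0.
by move=> i; rewrite (le_trans (nrmD _ _)) // mulrDl lerD.
Qed.

Lemma unifON k m n (A : I -> 'M[R[i]]_(m, n)) : unifO k A -> unifO k (fun i => - A i).
Proof. by move=> [a a0 Aa]; exists a => // i; rewrite nrmN. Qed.

Lemma unifOB k m n (A B : I -> 'M[R[i]]_(m, n)) :
  unifO k A -> unifO k B -> unifO k (fun i => A i - B i).
Proof. by move=> Ak Bk; apply: unifOD => //; exact: unifON. Qed.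

Lemma unifOM k l k' m n p (A : I -> 'M[R[i]]_(m, n)) (B : I -> 'M[R[i]]_(n, p)) :
  k' = (k + l)%N -> unifO k A -> unifO l B -> unifO k' (fun i => A i *m B i).
Proof.
move=> -> [a a0 Aa] [b b0 Bb]; exists (a * b); first exact: mulr_ge0.
by move=> i; rewrite exprD mulrACA; apply: nrm_le_mul.
Qed.

Lemma unifOZ k l k' x m n (A : I -> 'M[R[i]]_(m, n)) : k' = (k + l)%N ->
  unifO l A -> unifO k' (fun i => (h i ^+ k / x)%:C *: A i).
Proof.
move=> -> [a a0 Aa]; exists (`|x^-1| * a); first exact: mulr_ge0.
move=> i; rewrite nrmZ normc_real normrM [`|h i ^+ k|]ger0_norm //.
rewrite [leRHS](_ : _ = h i ^+ k * `|x^-1| * (a * h i ^+ l)); last first.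
  by rewrite exprD; ring.
by apply: ler_wpM2l => //; exact: mulr_ge0.
Qed.

Lemma unifO_weaken k l m n (A : I -> 'M[R[i]]_(m, n)) : (k <= l)%N ->
  unifO l A -> unifO k A.
Proof.
move=> kl [a a0 Aa]; exists a => // i; rewrite (le_trans (Aa i)) // ler_wpM2l //.
by have /andP[/ltW ? ?] := h01 i; rewrite ler_wiXn2l.
Qed.

Lemma eq_unifO k m n (A B : I -> 'M[R[i]]_(m, n)) : A =1 B -> unifO k A -> unifO k B.
Proof. by move=> AB [a a0 Aa]; exists a => // i; rewrite -AB. Qed.

Lemma unifO_one p : unifO 0 (fun _ => 1%:M : 'M[R[i]]_p).
Proof.
exists (nrm (1%:M : 'M[R[i]]_p)); first exact: nrm_ge0.
by move=> i; rewrite expr0 mulr1.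
Qed.

Variable p : nat.
Variables (F0 F1 P0 P1 : I -> 'M[R[i]]_p.+1) (w0 w1 : I -> 'cV[R[i]]_p.+1).
Hypotheses (P0b : unifO 0 P0) (P1b : unifO 0 P1) (w0b : unifO 0 w0).
Hypotheses (FP0 : unifO 2 (fun i => F0 i - P0 i)) (FP1 : unifO 2 (fun i => F1 i - P1 i)).
Hypothesis P10 : unifO 1 (fun i => P1 i - P0 i).
Hypothesis euler : unifO 2 (fun i => w1 i - w0 i - (h i)%:C *: (P0 i *m w0 i)).
Hypothesis trapezoid :
  unifO 3 (fun i => w1 i - w0 i - (h i / 2)%:C *: (P1 i *m w1 i + P0 i *m w0 i)).
Hypotheses (F0s : forall i, nrm ((h i / 2)%:C *: F0 i) <= 1)
  (F1s : forall i, nrm ((h i / 2)%:C *: F1 i) <= 1).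

Let S i := (h i ^+ 2 / 8)%:C *: (P0 i *m P0 i).

Lemma exp_step_expansion (F P : I -> 'M[R[i]]_p.+1) :
  unifO 0 P -> unifO 2 (fun i => F i - P i) -> unifO 1 (fun i => P i - P0 i) ->
  (forall i, nrm ((h i / 2)%:C *: F i) <= 1) ->
  unifO 3 (fun i => expm ((h i / 2)%:C *: F i) - (1%:M + ((h i / 2)%:C *: P i + S i))).
Proof.
move=> Pb FP PP Fs.
have Fb : unifO 0 F.
  apply: (@eq_unifO _ _ _ (fun i => F i - P i + P i)) => [i|]; first by rewrite subrK.
  by apply: unifOD => //; exact: unifO_weaken FP.
have FP0' : unifO 1 (fun i => F i - P0 i).
  apply: (@eq_unifO _ _ _ (fun i => (F i - P i) + (P i - P0 i))) => [i|].
    by rewrite addrA subrK.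
  by apply: unifOD => //; exact: unifO_weaken FP.
have T1 : unifO 3 (fun i => expm ((h i / 2)%:C *: F i) -
   (1 + (h i / 2)%:C *: F i + 2^-1 *: ((h i / 2)%:C *: F i * ((h i / 2)%:C *: F i)))).
  have [c c0 Fc] := Fb.
  pose C : R := (p.+1 * p.+1)%:R * (2 * expR 1).
  have C0 : 0 <= C by rewrite mulr_ge0 // mulr_ge0 // expR_ge0.
  exists (C * c ^+ 3); first by rewrite mulr_ge0 // exprn_ge0.
  move=> i; have /andP[/ltW hi0 _] := h01 i.
  apply: (le_trans (expm_taylor2 (Fs i))); rewrite -[leRHS]mulrA.
  apply: ler_wpM2l => //; rewrite -exprMn.
  rewrite lerXn2r ?nnegrE ?nrm_ge0 ?mulr_ge0 //.
  rewrite nrmZ normc_real ger0_norm ?divr_ge0 // mulrC.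
  apply: ler_pM; rewrite ?nrm_ge0 ?divr_ge0 //; last lra.
  by have := Fc i; rewrite expr0 mulr1.
have T2 : unifO 3 (fun i => (h i ^+ 1 / 2)%:C *: (F i - P i)) by exact: unifOZ FP.
have T3 : unifO 3 (fun i => (h i ^+ 2 / 8)%:C *: (F i *m (F i - P0 i) + (F i - P0 i) *m P0 i)).
  apply: (@unifOZ 2 1) => //; apply: unifOD.
    exact: (@unifOM 0 1).
  exact: (@unifOM 1 0).
apply: eq_unifO (unifOD T1 (unifOD T2 T3)) => i; rewrite /S expr1.
rewrite -[X in 2^-1 *: X]/(((h i / 2)%:C *: F i) *m ((h i / 2)%:C *: F i)).
rewrite -scalemxAl -scalemxAr !scalerA.
have -> : 2^-1 * (h i / 2)%:C * (h i / 2)%:C = (h i ^+ 2 / 8)%:C.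
  rewrite -(rmorph_nat (real_complex R)) -fmorphV -!rmorphM.
  by congr (_%:C); field.
move: (expm _) => X.
have -> : F i *m (F i - P0 i) + (F i - P0 i) *m P0 i = F i *m F i - P0 i *m P0 i.
  by rewrite mulmxBr mulmxBl addrA subrK.
rewrite !scalerBr -[1]/(1%:M).
move: (1%:M) (_ *: F i) (_ *: P i) (_ *: (F i *m F i)) (_ *: (P0 i *m P0 i)) => u q r s t.
apply/matrixP => j l; rewrite !mxE.
by move: (X j l) (u j l) (q j l) (r j l) (s j l) (t j l) => x1 x2 x3 x4 x5 x6; ring.
Qed.

(** Two half steps with the exponentials of the fields at both ends reproduce the
    trapezoidal rule up to third order, although the exponentials do not commute:
    the commutator is multiplied by [h ^+ 2] and the two fields differ by [O(h)]. *)
Lemma exp_product_local_error : exists2 C, 0 <= C & forall i,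
  nrm (w1 i - expm ((h i / 2)%:C *: F1 i) *m (expm ((h i / 2)%:C *: F0 i) *m w0 i))
    <= C * h i ^+ 3.
Proof.
have PP0 : unifO 1 (fun i => P0 i - P0 i).
  by exists 0 => // i; rewrite subrr nrm0 mul0r.
have R0 := exp_step_expansion P0b FP0 PP0 F0s.
have R1 := exp_step_expansion P1b FP1 P10 F1s.
have Sb : unifO 2 S by apply: (@unifOZ 2 0) => //; exact: (@unifOM 0 0).
have Qb P : unifO 0 P -> unifO 1 (fun i => (h i / 2)%:C *: P i + S i).
  move=> Pb; apply: unifOD; last exact: unifO_weaken Sb.
  by apply: eq_unifO (@unifOZ 1 0 1 2 _ _ P erefl Pb) => i; rewrite expr1.
pose X0 i := expm ((h i / 2)%:C *: F0 i).
pose X1 i := expm ((h i / 2)%:C *: F1 i).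
have Xb : unifO 0 X0.
  apply: (@eq_unifO _ _ _ (fun i => (X0 i - (1%:M + ((h i / 2)%:C *: P0 i + S i)))
     + (1%:M + ((h i / 2)%:C *: P0 i + S i)))) => [i|]; first by rewrite subrK.
  apply: unifOD; first exact: unifO_weaken R0.
  by apply: unifOD; [exact: unifO_one|exact: unifO_weaken (Qb _ P0b)].
suff [C C0 H] : unifO 3 (fun i => w1 i - X1 i *m (X0 i *m w0 i)) by exists C.
have T1 : unifO 3 (fun i => (h i ^+ 1 / 2)%:C *:
    (P1 i *m (w1 i - w0 i - (h i)%:C *: (P0 i *m w0 i)))).
  by apply: (@unifOZ 1 2) => //; exact: (@unifOM 0 2).
have T2 : unifO 3 (fun i => (h i ^+ 2 / 4)%:C *: ((P1 i - P0 i) *m (P0 i *m w0 i))).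
  by apply: (@unifOZ 2 1) => //; apply: (@unifOM 1 0) => //; exact: (@unifOM 0 0).
have T3 : unifO 3 (fun i => (X0 i - (1%:M + ((h i / 2)%:C *: P0 i + S i))) *m w0 i).
  exact: (@unifOM 3 0).
have T4 : unifO 3 (fun i => (X1 i - (1%:M + ((h i / 2)%:C *: P1 i + S i))) *m (X0 i *m w0 i)).
  by apply: (@unifOM 3 0) => //; exact: (@unifOM 0 0).
have T5 : unifO 3 (fun i => ((h i / 2)%:C *: P1 i + S i) *m
    ((X0 i - (1%:M + ((h i / 2)%:C *: P0 i + S i))) *m w0 i)).
  by apply: (@unifOM 0 3) => //; exact: unifO_weaken (Qb _ P1b).
have T6 : unifO 3 (fun i => (h i ^+ 1 / 2)%:C *: (P1 i *m (S i *m w0 i))).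
  exact: (@unifOZ 1 2 3 2 _ _ _ erefl (@unifOM 0 2 2 _ _ _ _ _ erefl P1b
    (@unifOM 2 0 2 _ _ _ _ _ erefl Sb w0b))).
have T7 : unifO 3 (fun i => S i *m (((h i / 2)%:C *: P0 i + S i) *m w0 i)).
  exact: (@unifOM 2 1 3 _ _ _ _ _ erefl Sb
    (@unifOM 1 0 1 _ _ _ _ _ erefl (Qb _ P0b) w0b)).
have := unifOB (unifOD (unifOD trapezoid T1) T2)
  (unifOD (unifOD (unifOD (unifOD T3 T4) T5) T6) T7).
apply: eq_unifO => i; rewrite expr1.
have cast k n : (h i ^+ k / n%:R)%:C = (h i)%:C ^+ k / n%:R.
  by rewrite fmorph_div rmorphXn rmorph_nat.
have SE : S i = ((h i)%:C ^+ 2 / 8) *: (P0 i *m P0 i) by rewrite /S cast.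
have H2 : (h i / 2)%:C = (h i)%:C / 2 by rewrite -[h i in LHS]expr1 cast expr1.
by rewrite cast !H2 (two_factor_expansion (P1 i) (X0 i) (X1 i) (w0 i) (w1 i) SE).
Qed.

End UniformO.

(** * Global error under uniform bounds *)

Section DefectIdentity.
Variables (K : comNzRingType) (p : nat).
Implicit Types (u v : 'cV[K]_p).

(** The defect of the error recursion splits into the defect of the second difference,
    that of the first difference, and the perturbation of the field. *)
Lemma defect_identity (G P : 'M[K]_p) (Y2 Y1 Y0 y2 y1 y0 w : 'cV[K]_p) (a k k' : K) :
  Y2 - 2 *: Y1 + Y0 = a *: (G *m (Y2 - Y0)) -> k' = a * k ->
  (Y2 - y2) - 2 *: (Y1 - y1) + (Y0 - y0) - a *: (G *m ((Y2 - y2) - (Y0 - y0))) =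
  - ((y2 - 2 *: y1 + y0 - k' *: (P *m w)) - a *: (P *m (y2 - y0 - k *: w))
     - a *: ((G - P) *m (y2 - y0))).
Proof.
move=> eqY ->; have -> : (Y2 - y2) - (Y0 - y0) = (Y2 - Y0) - (y2 - y0).
  by apply/colP => j; rewrite !col_entryE; ring.
rewrite [P *m (_ - k *: w)]mulmxBr mulmxBl mulmxBr -scalemxAr !scalerBr -eqY.
move: (G *m _) (P *m (y2 - y0)) (P *m w) => u v q.
by apply/colP => j; rewrite !col_entryE; ring.
Qed.

Lemma start_identity (X N : 'M[K]_p) (y0 y1 w : 'cV[K]_p) (k : K) :
  y0 + k *: (X *m w) - y1 =
  k *: ((X - (1%:M + N)) *m w) - (y1 - (y0 + k *: (w + N *m w))).
Proof.
rewrite mulmxBl mulmxDl mul1mx; move: (X *m w) (N *m w) => u v.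
by apply/colP => j; rewrite !col_entryE; ring.
Qed.

Lemma product_identity (X1 X0 : 'M[K]_p) (u v v' : 'cV[K]_p) :
  X1 *m (X0 *m u) - v' = X1 *m (X0 *m (u - v)) - (v' - X1 *m (X0 *m v)).
Proof. by rewrite [X0 *m (_ - _)]mulmxBr mulmxBr opprB addrA subrK. Qed.

Lemma momentum_identity (Kf : fieldType) (Mo : 'M[Kf]_p) (Y D v : 'cV[Kf]_p) (k : Kf) :
  k != 0 ->
  k^-1 *: (Mo *m Y) - v =
  k^-1 *: (Mo *m (Y - D)) + k^-1 *: (Mo *m (D - k *: v)) + (Mo - 1%:M) *m v.
Proof.
move=> k0; rewrite !mulmxBr mulmxBl mul1mx -scalemxAr !scalerBr scalerA mulVf // scale1r.
by rewrite !subrKA.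
Qed.

End DefectIdentity.

Lemma defect_arithmetic (R : realFieldType) (c M S h q : R) :
  let C := 2 * c + 32 * M * c + S * (M + c) + 32 * M * (M + c) + S + 32 * M in
  0 <= c -> 0 <= M -> 0 <= S -> 0 <= h -> 0 <= q ->
  2 * c * h ^+ 4 + 32 * M * c * h ^+ 4 + (S * h ^+ 2 + 32 * M * q) * (M + c) * h ^+ 2
    <= C * h ^+ 2 * q + C * h ^+ 4.
Proof.
move=> C c0 M0 S0 h0 q0.
have Mc0 : 0 <= 32 * M * c by apply: mulr_ge0 => //; exact: mulr_ge0.
have SMc : 0 <= S * (M + c) by rewrite mulr_ge0 ?addr_ge0.
have MMc : 0 <= 32 * M * (M + c) by apply: mulr_ge0; [exact: mulr_ge0|exact: addr_ge0].
have s1 : 0 <= (2 * c + 32 * M * c + S * (M + c) + S + 32 * M) * (h ^+ 2 * q).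
  by apply: mulr_ge0; [lra|rewrite mulr_ge0 ?exprn_ge0].
have s2 : 0 <= (32 * M * (M + c) + S + 32 * M) * h ^+ 4.
  by apply: mulr_ge0; [lra|rewrite exprn_ge0].
have -> : (S * h ^+ 2 + 32 * M * q) * (M + c) * h ^+ 2 =
  S * (M + c) * h ^+ 4 + 32 * M * (M + c) * (h ^+ 2 * q) by ring.
rewrite /C; lra.
Qed.

Lemma growth_arithmetic (R : realFieldType) (a C h q : R) :
  0 <= a -> 0 <= C -> 0 <= h -> h <= 1 -> 0 <= q ->
  (1 + a * h) * ((1 + a * h) * q) + C * h ^+ 3
    <= (1 + (2 * a + a ^+ 2 + C) * h) * q + (2 * a + a ^+ 2 + C) * h ^+ 3.
Proof.
move=> a0 C0 h0 h1 q0.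
have aq : a ^+ 2 * h * q * h <= a ^+ 2 * h * q * 1.
  by apply: ler_wpM2l => //; rewrite !mulr_ge0 ?exprn_ge0.
have Cq : 0 <= C * h * q by rewrite !mulr_ge0.
have p1 : 0 <= (2 * a + a ^+ 2) * h ^+ 3.
  by rewrite mulr_ge0 ?exprn_ge0 // addr_ge0 ?exprn_ge0 ?mulr_ge0.
lra.
Qed.

Lemma small_enough (R : realFieldType) (l : seq R) (eta : R) : 0 < eta ->
  exists2 h0, 0 < h0 <= eta &
    forall h, 0 <= h -> h <= h0 -> forall k, k \in l -> k * h <= 1.
Proof.
move=> eta0; pose S := \sum_(k <- l) `|k|.
have S1 : 0 < 1 + S by rewrite ltr_pwDl // sumr_ge0.
exists (Num.min eta (1 + S)^-1).
  by rewrite lt_min eta0 invr_gt0 S1 ge_min lexx.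
move=> h h0; rewrite le_min => /andP[_ hS] k kl.
have kS : k <= 1 + S.
  rewrite (le_trans (ler_norm k)) // /S (big_rem k) //= addrCA lerDl.
  by rewrite addr_ge0 // sumr_ge0.
by rewrite -(divff (lt0r_neq0 S1)) (le_trans (ler_wpM2r h0 kS)) // ler_pM2l.
Qed.

(** The hypotheses are those that compactness provides: bounds by a single [M] of the
    orbit, of its derivatives, and of the fields in a tube of radius [rho]. *)
Section Convergence.
Context {R : realType}.
Local Notation "x %:C" := (real_complex R x).
Variables (B E : 'cV[R]_3 -> 'cV[R]_3) (s : trajectory R R) (T M rho eta : R).
Local Notation x := (trj_x s).
Local Notation y := (yvec s).
Local Notation w := (uvec s).
Local Notation field p := (Fmx (B p) (E p)).

Hypotheses (T0 : 0 < T) (M0 : 0 <= M) (rho0 : 0 < rho) (eta0 : 0 < eta) (eta1 : eta <= 1).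
Variable f : nat -> R -> 'cV[R[i]]_(3 + 1).
Hypotheses (f0 : f 0%N = y) (f1 : f 1%N = w).
Hypothesis f2 : forall r, 0 <= r <= T -> f 2%N r = field (x r) *m w r.
Hypothesis fd : forall j r u, 0 <= r <= T -> `|u - r| <= eta -> (j < 4)%N ->
  vderive (f j) u (f j.+1 u).
Hypothesis fM : forall j r u, 0 <= r <= T -> `|u - r| <= eta -> (j <= 4)%N ->
  nrm (f j u) <= M.
Hypothesis BEM : forall r, 0 <= r <= T -> l2norm (B (x r)) <= M /\ l2norm (E (x r)) <= M.
Hypothesis tube : forall r p, 0 <= r <= T -> l2norm (p - x r) < rho ->
  [/\ l2norm (B p) <= M, l2norm (E p) <= M,
      l2norm (B p - B (x r)) <= M * l2norm (p - x r) &
      l2norm (E p - E (x r)) <= M * l2norm (p - x r)].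

Let c : R := (3 + 1)%:R * (2 * M).
Let c0 : 0 <= c. Proof. by apply: mulr_ge0 => //; exact: mulr_ge0. Qed.

Lemma position_le_state (I I' : Type) (z : trajectory R I) (z' : trajectory R I') n n' :
  l2norm (trj_x z n - trj_x z' n') <= nrm (yvec z n - yvec z' n').
Proof.
rewrite /yvec opp_col_mx add_col_mx nrm_col_mx -map_mxB.
by rewrite (le_trans (l2norm_le_nrm _)) // lerDl nrm_ge0.
Qed.

Let field_le b e : l2norm b <= M -> l2norm e <= M -> nrm (Fmx b e) <= 32 * M.
Proof. by move=> bM eM; rewrite (le_trans (nrm_Fmx b e)) //; lra. Qed.

Let orbit_field r : 0 <= r <= T -> nrm (field (x r)) <= 32 * M.
Proof. by move=> /BEM[? ?]; exact: field_le. Qed.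

Let tube_field r p : 0 <= r <= T -> l2norm (p - x r) < rho ->
  nrm (field p) <= 32 * M /\ nrm (field p - field (x r)) <= 32 * M * l2norm (p - x r).
Proof.
move=> rT pr; have [Bp Ep BL EL] := tube rT pr; split; first exact: field_le.
rewrite FmxB (le_trans (nrm_Fmx _ _)) //.
apply: (@le_trans _ _ (16 * (M * l2norm (p - x r) + M * l2norm (p - x r)))).
  by rewrite ler_wpM2l // lerD.
lra.
Qed.

Section Consistency.
Variables (h r : R).
Hypotheses (h0 : 0 <= h) (heta : h <= eta) (rT : 0 <= r <= T).

Let d j u : (j < 4)%N -> `|u - r| <= h -> vderive (f j) u (f j.+1 u).
Proof. by move=> j4 uh; apply: (fd rT) => //; exact: le_trans heta. Qed.

Let b j u : (j <= 4)%N -> `|u - r| <= h -> nrm (f j u) <= M.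
Proof. by move=> j4 uh; apply: (fM rT) => //; exact: le_trans heta. Qed.

Lemma orbit_second_difference :
  nrm (y (r + h) - 2 *: y r + y (r - h) - (h ^+ 2)%:C *: (field (x r) *m w r))
    <= 2 * c * h ^+ 4.
Proof. by have := second_central_difference M0 h0 d b; rewrite f0 f2. Qed.

Lemma orbit_first_difference :
  nrm (y (r + h) - y (r - h) - (2 * h)%:C *: w r) <= 2 * c * h ^+ 3.
Proof. by have := first_central_difference M0 h0 d b; rewrite f0 f1. Qed.

Lemma orbit_start :
  nrm (y (r + h) - (y r + h%:C *: (w r + (h / 2)%:C *: (field (x r) *m w r))))
    <= c * h ^+ 3.
Proof. by have := second_order_start M0 h0 d b; rewrite f0 f1 f2. Qed.

Lemma orbit_increment : nrm (y (r + h) - y r) <= c * h.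
Proof. by have := first_difference M0 h0 d b (isT : (0 < 4)%N); rewrite f0. Qed.

Lemma orbit_euler :
  nrm (w (r + h) - w r - h%:C *: (field (x r) *m w r)) <= c * h ^+ 2.
Proof. by have := explicit_euler M0 h0 d b; rewrite f1 f2. Qed.

Lemma orbit_trapezoid : 0 <= r + h <= T ->
  nrm (w (r + h) - w r - (h / 2)%:C *:
    (field (x (r + h)) *m w (r + h) + field (x r) *m w r)) <= 2 * c * h ^+ 3.
Proof. by move=> rhT; have := trapezoidal_rule M0 h0 d b; rewrite f1 !f2. Qed.

Lemma orbit_velocity : nrm (w r) <= M.
Proof. by rewrite -f1 b // subrr normr0. Qed.

Lemma field_increment : c * h < rho -> 0 <= r + h <= T ->
  nrm (field (x (r + h)) - field (x r)) <= 32 * M * c * h.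
Proof.
move=> chrho rhT.
have xh : l2norm (x (r + h) - x r) <= c * h.
  exact: le_trans (position_le_state _ _ _ _) orbit_increment.
have [_ H] := tube_field rT (le_lt_trans xh chrho).
by rewrite (le_trans H) // -[leRHS]mulrA ler_wpM2l // mulr_ge0.
Qed.

End Consistency.

Section NumericalSolution.
Variables (m : method) (h : R) (z : trajectory R nat).
Hypotheses (h0 : 0 < h) (heta : h <= eta) (hM2 : h ^+ 2 * (12 * M ^+ 2) <= 1)
  (hM : 16 * M * h <= 1).
Hypotheses (y0 : yvec z 0%N = y 0) (w0 : uvec z 0%N = w 0).
Hypothesis numerical : is_numerical_solution B E m h T z.

Let h0' : 0 <= h := ltW h0.
Let h1 : h <= 1 := le_trans heta eta1.
Let e n := yvec z n - y (n%:R * h).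

Let x0 : trj_x z 0%N = x 0.
Proof.
have := y0; rewrite /yvec => /eq_col_mx[+ _] => /matrixP xx.
by apply/colP => j; have := xx j 0; rewrite !mxE => -[].
Qed.

Let tS n : n.+1%:R * h = n%:R * h + h.
Proof. by rewrite -natr1 mulrDl mul1r. Qed.

Let tP n : (0 < n)%N -> n.-1%:R * h = n%:R * h - h.
Proof. by case: n => // n _; rewrite tS addrK. Qed.

Let t_ge0 n : 0 <= n%:R * h. Proof. exact: mulr_ge0. Qed.

Let O0 : (0 : R) <= 0 <= T. Proof. by rewrite lexx ltW. Qed.

Let small (F : 'M[R[i]]_(3 + 1)) : nrm F <= 32 * M -> nrm ((h / 2)%:C *: F) <= 16 * M * h.
Proof.
move=> FM; rewrite nrmZ normc_real ger0_norm ?divr_ge0 //.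
rewrite (le_trans (ler_wpM2l _ FM)) ?divr_ge0 //; lra.
Qed.

Let Cs : R := 2 * (2 * two_e * (12 * M ^+ 2) * (32 * M)).
Let Cs0 : 0 <= Cs.
Proof.
have k0 : 0 <= two_e :> R by rewrite (le_trans _ two_e_ge2).
apply: mulr_ge0 => //; apply: mulr_ge0; last exact: mulr_ge0.
by apply: mulr_ge0; [exact: mulr_ge0|apply: mulr_ge0 => //; exact: sqr_ge0].
Qed.

Definition start_const : R := exp_const 3 * (16 * M) ^+ 2 * M + c.

(** The prescribed starting value agrees with the second-order Taylor polynomial of the
    orbit up to [O(h ^+ 3)]. *)
Lemma start_error : nrm (e 1%N) <= start_const * h ^+ 3.
Proof.
have [st _ _] := numerical.
have [B0 E0] := BEM O0.
have Fs := small (field_le B0 E0).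
rewrite /e st y0 w0 x0 mul1r.
have os := orbit_start h0' heta O0; rewrite add0r in os.
pose N := (h / 2)%:C *: field (x 0).
have -> : y 0 + h%:C *: (expm N *m w 0) - y h =
    h%:C *: ((expm N - (1 + N)) *m w 0)
    - (y h - (y 0 + h%:C *: (w 0 + (h / 2)%:C *: (field (x 0) *m w 0)))).
  by rewrite [(h / 2)%:C *: (_ *m _)]scalemxAl; exact: start_identity.
rewrite (le_trans (nrmB _ _)) // /start_const mulrDl lerD //.
rewrite nrmZ normc_real ger0_norm //.
have -> : exp_const 3 * (16 * M) ^+ 2 * M * h ^+ 3 =
    h * (exp_const 3 * (16 * M * h) ^+ 2 * M) by ring.
rewrite ler_wpM2l //; apply: nrm_le_mul; last exact: (orbit_velocity h0' heta O0).
rewrite (le_trans (expm_taylor1 (le_trans Fs hM))) //.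
rewrite ler_wpM2l ?exp_const_ge0 // lerXn2r ?nnegrE ?nrm_ge0 //.
by rewrite mulr_ge0 // mulr_ge0.
Qed.

Definition step_const : R :=
  2 * c + 32 * M * c + Cs * (M + c) + 32 * M * (M + c) + Cs + 32 * M.

(** Inside the tube the field at the numerical position is controlled by the error
    itself, which gives the term [h ^+ 2 * nrm (e n)]. *)
Lemma step_error n : (0 < n)%N -> n%:R * h <= T -> nrm (e n) < rho ->
  exists2 G, nrm G <= step_const &
    nrm (e n.+1 - 2 *: e n + e n.-1 - (h / 2)%:C *: (G *m (e n.+1 - e n.-1)))
      <= step_const * h ^+ 2 * nrm (e n) + step_const * h ^+ 4.
Proof.
move=> n0 nT en; have [_ /(_ n n0 nT) st _] := numerical.
have := position_step_matrix (lt0r_neq0 h0) st.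
set r := n%:R * h in nT; have rT : 0 <= r <= T by rewrite t_ge0.
have xr : l2norm (trj_x z n - x r) <= nrm (e n) by exact: position_le_state.
have [Bn En _ _] := tube rT (le_lt_trans xr en).
have [B0 E0] := BEM O0; rewrite x0.
have Gs := step_matrix_bound M0 m h0 hM2 Bn En B0 E0; rewrite -/Cs in Gs.
have [Fn FP] := tube_field rT (le_lt_trans xr en).
have C1 : 0 <= M + c by exact: addr_ge0.
have M32 : 0 <= 32 * M by exact: mulr_ge0.
have h2 : h ^+ 2 <= 1 by rewrite exprn_ile1.
have Mc : 0 <= 32 * M * c by exact: mulr_ge0.
have CsMc : 0 <= Cs * (M + c) by exact: mulr_ge0.
have MMc : 0 <= 32 * M * (M + c) by exact: mulr_ge0.
move: Gs; set G := step_matrix _ _ _ _ _ _ => Gs stG; exists G.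
  rewrite -(subrK (field (trj_x z n)) G) (le_trans (nrmD _ _)) //.
  rewrite (le_trans (lerD Gs Fn)) // /step_const.
  rewrite lerD2r ler_wpDl ?ler_piMr //.
  by rewrite !addr_ge0 //; exact: mulr_ge0.
have GP : nrm (G - field (x r)) <= Cs * h ^+ 2 + 32 * M * nrm (e n).
  rewrite (le_trans (nrm_triangle _ (field (trj_x z n)) _)) // lerD //.
  by rewrite (le_trans FP) // ler_wpM2l.
rewrite /e (tP n0) tS -/r.
have hk : (h ^+ 2)%:C = (h / 2)%:C * (2 * h)%:C.
  by rewrite -rmorphM; congr (_%:C); field.
rewrite (defect_identity (field (x r)) (y (r + h)) (y r) (y (r - h)) (w r) stG hk) nrmN.
have D2 := orbit_second_difference h0' heta rT.
have D1 := orbit_first_difference h0' heta rT.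
have wr := orbit_velocity h0' heta rT.
have DY : nrm (y (r + h) - y (r - h)) <= 2 * (M + c) * h.
  rewrite -(subrK ((2 * h)%:C *: w r) (y (r + h) - _)) (le_trans (nrmD _ _)) //.
  rewrite (le_trans (lerD D1 (lexx _))) // nrmZ normc_real ger0_norm ?mulr_ge0 //.
  rewrite mulrDr mulrDl addrC lerD //.
    by rewrite [2 * M * h]mulrAC ler_wpM2l // mulr_ge0.
  by rewrite ler_wpM2l ?mulr_ge0 // exprS ler_piMr.
have a0 : 0 <= h / 2 by rewrite divr_ge0.
have t2 : nrm ((h / 2)%:C *: (field (x r) *m (y (r + h) - y (r - h) - (2 * h)%:C *: w r)))
    <= 32 * M * c * h ^+ 4.
  rewrite nrmZ normc_real ger0_norm //.
  rewrite (_ : 32 * M * c * h ^+ 4 = h / 2 * (32 * M * (2 * c * h ^+ 3))); last by field.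
  by rewrite (ler_wpM2l a0) // (nrm_le_mul (orbit_field rT) D1).
have t3 : nrm ((h / 2)%:C *: ((G - field (x r)) *m (y (r + h) - y (r - h))))
    <= (Cs * h ^+ 2 + 32 * M * nrm (e n)) * (M + c) * h ^+ 2.
  rewrite nrmZ normc_real ger0_norm //.
  rewrite (_ : _ * h ^+ 2 = h / 2 * ((Cs * h ^+ 2 + 32 * M * nrm (e n)) * (2 * (M + c) * h))).
    by rewrite (ler_wpM2l a0) // (nrm_le_mul GP DY).
  by field.
rewrite (le_trans (nrmB _ _)) // (le_trans (lerD (nrmB _ _) (lexx _))) //.
rewrite (le_trans (lerD (lerD D2 t2) t3)) //.
by apply: defect_arithmetic => //; exact: nrm_ge0.
Qed.

Let cs : R := step_const + start_const.
Definition orbit_const : R := (2 * cs + 1) * expR ((1 + 4 * cs) * T).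
Local Notation K := orbit_const.

Hypotheses (csh : cs * h <= 1) (Kh : K * h ^+ 2 < rho).

Lemma step_const_ge0 : 0 <= step_const.
Proof.
by rewrite /step_const !addr_ge0 //; apply: mulr_ge0 => //;
  rewrite ?addr_ge0 //; exact: mulr_ge0.
Qed.

Lemma start_const_ge0 : 0 <= start_const.
Proof.
rewrite /start_const addr_ge0 //; apply: mulr_ge0 => //.
by apply: mulr_ge0; [exact: exp_const_ge0|exact: sqr_ge0].
Qed.

Lemma orbit_const_ge0 : 0 <= K.
Proof.
apply: mulr_ge0; last exact: expR_ge0.
by rewrite addr_ge0 // mulr_ge0 // addr_ge0 // ?step_const_ge0 ?start_const_ge0.
Qed.

Let K0 := orbit_const_ge0.
Let step_ge0 := step_const_ge0.
Let start_ge0 := start_const_ge0.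

Let e0 : e 0%N = 0. Proof. by rewrite /e mul0r y0 subrr. Qed.

Let position_increment n : n%:R * h <= T ->
  nrm (e n.+1 - e n) <= K * h ^+ 3 /\ nrm (e n.+1) <= K * h ^+ 2.
Proof.
have cs0 : 0 <= cs by exact: addr_ge0.
have le1 : step_const <= cs by rewrite lerDl.
have le2 : start_const <= cs by rewrite lerDr.
apply: (two_step_stability h0 h1 cs0 csh Kh e0).
  by rewrite (le_trans start_error) // ler_wpM2r // exprn_ge0.
move=> k k0 kT ek; have [G Gc Gr] := step_error k0 kT ek.
exists G; first exact: le_trans le1.
rewrite (le_trans Gr) // lerD //; last by rewrite ler_wpM2r // exprn_ge0.
by rewrite ler_wpM2r ?nrm_ge0 // ler_wpM2r // exprn_ge0.
Qed.

Lemma position_error n : n%:R * h <= T -> nrm (yvec z n - y (n%:R * h)) <= K * h ^+ 2.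
Proof.
case: n => [_|n nT].
  by rewrite -/(e 0) e0 nrm0 mulr_ge0 // sqr_ge0.
have nT' : n%:R * h <= T by rewrite (le_trans _ nT) // ler_wpM2r // ler_nat.
by have [_] := position_increment nT'.
Qed.

Lemma numerical_field n : n%:R * h <= T ->
  nrm (field (trj_x z n)) <= 32 * M /\
  nrm (field (trj_x z n) - field (x (n%:R * h))) <= 32 * M * K * h ^+ 2.
Proof.
move=> nT; have rT : 0 <= n%:R * h <= T by rewrite t_ge0.
have xK : l2norm (trj_x z n - x (n%:R * h)) <= K * h ^+ 2.
  exact: le_trans (position_le_state _ _ _ _) (position_error nT).
have [F1 F2] := tube_field rT (le_lt_trans xK Kh); split=> //.
by rewrite (le_trans F2) // -[leRHS]mulrA ler_wpM2l // mulr_ge0.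
Qed.

Let Cm : R := 16 * (two_e * (12 * M ^+ 2)) + two_e * (32 * M * (32 * M)).
Let Q : R := Cm + nrm (1%:M : 'M[R[i]]_(3 + 1)).

Definition difference_momentum_const : R := Q * K + Q * c + Cm * M.

(** The increments of the error are [O(h ^+ 3)], so that dividing by [2 h] still leaves
    second order. *)
Lemma difference_momentum_error n : m <> M1 -> n.+1%:R * h <= T ->
  nrm (uvec z n.+1 - w (n.+1%:R * h)) <= difference_momentum_const * h ^+ 2.
Proof.
move=> mM1 nT; have [_ _ /(_ n nT) st] := numerical.
have nT' : n%:R * h <= T by rewrite (le_trans _ nT) // ler_wpM2r // ler_nat.
rewrite (momentum_step_matrix (lt0r_neq0 h0) mM1 st) x0.
have [d1 _] := position_increment nT'; have [d2 _] := position_increment nT.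
set r := n.+1%:R * h; have rT : 0 <= r <= T by rewrite t_ge0.
have xK : l2norm (trj_x z n.+1 - x r) <= K * h ^+ 2.
  exact: le_trans (position_le_state _ _ _ _) (position_error nT).
have [Bn En _ _] := tube rT (le_lt_trans xK Kh).
have [B0 E0] := BEM O0.
have := momentum_matrix_bound M0 m h0 hM2 Bn En B0 E0; rewrite -/Cm.
set Mo := momentum_matrix _ _ _ _ _ _ => Mo1.
have h2 : h ^+ 2 <= 1 by rewrite exprn_ile1.
have k0 : 0 <= two_e :> R by rewrite (le_trans _ two_e_ge2).
have Cm0 : 0 <= Cm.
  apply: addr_ge0; apply: mulr_ge0 => //; last by apply: mulr_ge0; exact: mulr_ge0.
  by apply: mulr_ge0 => //; apply: mulr_ge0 => //; exact: sqr_ge0.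
have MoQ : nrm Mo <= Q.
  rewrite -(subrK 1%:M Mo) (le_trans (nrmD _ _)) // lerD2r (le_trans Mo1) //.
  by rewrite ler_piMr.
have D1 := orbit_first_difference h0' heta rT.
have wr := orbit_velocity h0' heta rT.
have ee : nrm (e n.+2 - e n) <= 2 * K * h ^+ 3.
  rewrite (le_trans (nrm_triangle _ (e n.+1) _)) // (le_trans (lerD d2 d1)) //.
  by rewrite -mulrA mulr_natl mulr2n.
have -> : (2 * h)%:C^-1 *: (Mo *m (yvec z n.+2 - yvec z n)) - w r =
    (2 * h)%:C^-1 *: (Mo *m (e n.+2 - e n))
    + (2 * h)%:C^-1 *: (Mo *m (y (r + h) - y (r - h) - (2 * h)%:C *: w r))
    + (Mo - 1%:M) *m w r.
  have -> : e n.+2 - e n = yvec z n.+2 - yvec z n - (y (r + h) - y (r - h)).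
    rewrite /e -(tS n.+1) -(tP (isT : (0 < n.+1)%N)) /=.
    by rewrite !opprD !opprK addrACA.
  have hC : (2 * h)%:C != 0 by rewrite fmorph_eq0 mulf_neq0 // ?lt0r_neq0.
  exact: momentum_identity.
have hV : normc (2 * h)%:C^-1 = (2 * h)^-1.
  by rewrite -fmorphV normc_real ger0_norm ?invr_ge0 ?mulr_ge0.
have hV0 : 0 <= (2 * h)^-1 by rewrite invr_ge0 mulr_ge0.
have t1 : nrm ((2 * h)%:C^-1 *: (Mo *m (e n.+2 - e n))) <= Q * K * h ^+ 2.
  rewrite nrmZ hV (_ : Q * K * h ^+ 2 = (2 * h)^-1 * (Q * (2 * K * h ^+ 3))).
    exact: (ler_wpM2l hV0 (nrm_le_mul MoQ ee)).
  by field; rewrite lt0r_neq0.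
have t2 : nrm ((2 * h)%:C^-1 *: (Mo *m (y (r + h) - y (r - h) - (2 * h)%:C *: w r)))
    <= Q * c * h ^+ 2.
  rewrite nrmZ hV (_ : Q * c * h ^+ 2 = (2 * h)^-1 * (Q * (2 * c * h ^+ 3))).
    exact: (ler_wpM2l hV0 (nrm_le_mul MoQ D1)).
  by field; rewrite lt0r_neq0.
have t3 : nrm ((Mo - 1%:M) *m w r) <= Cm * M * h ^+ 2.
  by rewrite mulrAC; exact: nrm_le_mul Mo1 wr.
rewrite /difference_momentum_const (mulrDl (Q * K + Q * c)) (mulrDl (Q * K)).
exact: le_trans (nrmD _ _) (lerD (le_trans (nrmD _ _) (lerD t1 t2)) t3).
Qed.

Let a : R := (exp_const 3 + 1) * (16 * M).

Let exp_growth (F : 'M[R[i]]_(3 + 1)) (v : 'cV[R[i]]_(3 + 1)) : nrm F <= 32 * M ->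
  nrm (expm ((h / 2)%:C *: F) *m v) <= (1 + a * h) * nrm v.
Proof.
move=> FM; have Fs := small FM.
have -> : expm ((h / 2)%:C *: F) *m v = v + (expm ((h / 2)%:C *: F) - 1%:M) *m v.
  by rewrite mulmxBl mul1mx addrC subrK.
rewrite (le_trans (nrmD _ _)) // mulrDl mul1r lerD2l (le_trans (nrmM _ _)) //.
rewrite ler_wpM2r ?nrm_ge0 // (le_trans (expm_sub1 (le_trans Fs hM))) //.
by rewrite /a -mulrA ler_wpM2l // addr_ge0 // exp_const_ge0.
Qed.

(** Each factor [expm] grows vectors by at most [1 + a h], hence the local error of third
    order accumulates to second order. *)
Lemma exponential_momentum_error C : m = M1 -> 0 <= C ->
  (forall n, n.+1%:R * h <= T ->
    nrm (w (n.+1%:R * h) - expm ((h / 2)%:C *: field (trj_x z n.+1)) *m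
          (expm ((h / 2)%:C *: field (trj_x z n)) *m w (n%:R * h))) <= C * h ^+ 3) ->
  forall n, n%:R * h <= T ->
    nrm (uvec z n - w (n%:R * h)) <= expR ((2 * a + a ^+ 2 + C) * T) * h ^+ 2.
Proof.
move=> mM1 C0 local.
have a0 : 0 <= a.
  by apply: mulr_ge0; [rewrite addr_ge0 // exp_const_ge0|exact: mulr_ge0].
have aa0 : 0 <= 2 * a + a ^+ 2 by rewrite addr_ge0 ?sqr_ge0 // mulr_ge0.
apply: one_step_stability => // [|| n nT]; first exact: addr_ge0.
  by rewrite mul0r w0 subrr.
have nT' : n%:R * h <= T by rewrite (le_trans _ nT) // ler_wpM2r // ler_nat.
have [_ _ /(_ n nT)] := numerical; rewrite mM1 /= => ->.
have [F0 _] := numerical_field nT'; have [F1 _] := numerical_field nT.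
rewrite -mulmxA (product_identity _ _ _ (w (n%:R * h))).
have g0 : 0 <= nrm (uvec z n - w (n%:R * h)) := nrm_ge0 _.
have a1 : 0 <= 1 + a * h by rewrite addr_ge0 // mulr_ge0.
have gr := le_trans (exp_growth _ F1) (ler_wpM2l a1 (exp_growth (uvec z n - w (n%:R * h)) F0)).
apply: (le_trans (nrmB _ _)); apply: (le_trans (lerD gr (local n nT))).
by apply: growth_arithmetic => //; rewrite ltW.
Qed.

End NumericalSolution.

Local Notation K := orbit_const.

Definition admissible m h z : Prop :=
  [/\ 0 < h, h <= eta, h ^+ 2 * (12 * M ^+ 2) <= 1, 16 * M * h <= 1 &
    [/\ yvec z 0%N = y 0, uvec z 0%N = w 0, is_numerical_solution B E m h T z &
      [/\ (step_const + start_const) * h <= 1, K * h ^+ 2 < rho & c * h < rho]]].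

(** The step size, the numerical solution and the index form one parameter space,
    on which the expansion of the exponentials is uniform. *)
Lemma exponential_local_error : exists2 C, 0 <= C & forall h z n,
  admissible M1 h z -> n.+1%:R * h <= T ->
  nrm (w (n.+1%:R * h) - expm ((h / 2)%:C *: field (trj_x z n.+1)) *m
        (expm ((h / 2)%:C *: field (trj_x z n)) *m w (n%:R * h))) <= C * h ^+ 3.
Proof.
pose I := {q : R * trajectory R nat * nat |
  admissible M1 q.1.1 q.1.2 /\ q.2.+1%:R * q.1.1 <= T}.
pose h (q : I) := (sval q).1.1.
pose z (q : I) := (sval q).1.2.
pose n (q : I) := (sval q).2.
have adm q : admissible M1 (h q) (z q) := (svalP q).1.
have nT q : (n q).+1%:R * h q <= T := (svalP q).2.
have h01 q : 0 < h q <= 1.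
  by have [h0 he _ _ _] := adm q; rewrite h0 (le_trans he).
have h0' q : 0 <= h q by have /andP[/ltW] := h01 q.
have heta q : h q <= eta by have [] := adm q.
have tS q : (n q).+1%:R * h q = (n q)%:R * h q + h q.
  by rewrite -natr1 mulrDl mul1r.
have nT' q : (n q)%:R * h q <= T.
  by rewrite (le_trans _ (nT q)) // ler_wpM2r // ler_nat.
have rT q : 0 <= (n q)%:R * h q <= T by rewrite nT' mulr_ge0.
have rT' q : 0 <= (n q).+1%:R * h q <= T by rewrite nT mulr_ge0.
have num q k : k%:R * h q <= T -> nrm (field (trj_x (z q) k)) <= 32 * M /\
    nrm (field (trj_x (z q) k) - field (x (k%:R * h q))) <= 32 * M * K * h q ^+ 2.
  have [a1 a2 a3 a4 [a5 a6 a7 [a8 a9 _]]] := adm q.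
  exact: (numerical_field a1 a2 a3 a4 a5 a6 a7 a8 a9).
have K0 := orbit_const_ge0.
have M32 : 0 <= 32 * M by exact: mulr_ge0.
have Fs q k : k%:R * h q <= T -> nrm ((h q / 2)%:C *: field (trj_x (z q) k)) <= 1.
  move=> kT; have [Fk _] := num q k kT; have [_ _ _ hM _] := adm q.
  rewrite nrmZ normc_real ger0_norm ?divr_ge0 // (le_trans _ hM) //.
  rewrite (_ : 16 * M * h q = h q / 2 * (32 * M)); last by field.
  by rewrite ler_wpM2l ?divr_ge0.
have h2 (A : I -> 'M[R[i]]_(3 + 1)) a : 0 <= a ->
    (forall q, nrm (A q) <= a) -> unifO h 0 A.
  by move=> a0 Aa; exists a => // q; rewrite expr0 mulr1.
have P0b : unifO h 0 (fun q => field (x ((n q)%:R * h q))).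
  by apply: h2 M32 _ => q; exact: orbit_field (rT q).
have P1b : unifO h 0 (fun q => field (x ((n q).+1%:R * h q))).
  by apply: h2 M32 _ => q; exact: orbit_field (rT' q).
have w0b : unifO h 0 (fun q => w ((n q)%:R * h q)).
  by exists M => // q; rewrite expr0 mulr1; exact: orbit_velocity (h0' q) (heta q) (rT q).
have FP0 : unifO h 2 (fun q => field (trj_x (z q) (n q)) - field (x ((n q)%:R * h q))).
  by exists (32 * M * K) => [|q]; [exact: mulr_ge0|have [] := num q _ (nT' q)].
have FP1 : unifO h 2 (fun q =>
    field (trj_x (z q) (n q).+1) - field (x ((n q).+1%:R * h q))).
  by exists (32 * M * K) => [|q]; [exact: mulr_ge0|have [] := num q _ (nT q)].
have P10 : unifO h 1 (fun q =>
    field (x ((n q).+1%:R * h q)) - field (x ((n q)%:R * h q))).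
  exists (32 * M * c) => [|q]; first exact: mulr_ge0.
  have [_ _ _ _ [_ _ _ [_ _ ch]]] := adm q; have := rT' q.
  by rewrite expr1 tS; exact: field_increment (h0' q) (heta q) (rT q) ch.
have eu : unifO h 2 (fun q => w ((n q).+1%:R * h q) - w ((n q)%:R * h q)
    - real_complex R (h q) *: (field (x ((n q)%:R * h q)) *m w ((n q)%:R * h q))).
  by exists c => // q; rewrite tS; exact: orbit_euler (h0' q) (heta q) (rT q).
have tr : unifO h 3 (fun q => w ((n q).+1%:R * h q) - w ((n q)%:R * h q)
    - real_complex R (h q / 2) *: (field (x ((n q).+1%:R * h q)) *m w ((n q).+1%:R * h q)
    + field (x ((n q)%:R * h q)) *m w ((n q)%:R * h q))).
  exists (2 * c) => [|q]; first exact: mulr_ge0.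
  by have := rT' q; rewrite tS; exact: orbit_trapezoid (h0' q) (heta q) (rT q).
have [C C0 H] := exp_product_local_error h01 P0b P1b w0b FP0 FP1 P10 eu tr
  (fun q => Fs q (n q) (nT' q)) (fun q => Fs q (n q).+1 (nT q)).
by exists C => // h' z' n' ad kT; exact: (H (exist _ (h', z', n') (conj ad kT))).
Qed.

Lemma convergence m : exists C h0, [/\ 0 < C, 0 < h0 & forall h z,
  0 < h -> h <= h0 -> yvec z 0%N = y 0 -> uvec z 0%N = w 0 ->
  is_numerical_solution B E m h T z ->
  forall n, n.+1%:R * h <= T ->
    nrm (yvec z n.+1 - y (n.+1%:R * h)) <= C * h ^+ 2 /\
    nrm (uvec z n.+1 - w (n.+1%:R * h)) <= C * h ^+ 2].
Proof.
have [CL CL0 local] := exponential_local_error.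
have K0 := orbit_const_ge0.
pose a : R := (exp_const 3 + 1) * (16 * M).
pose C1 := expR ((2 * a + a ^+ 2 + CL) * T).
pose C2 := `|difference_momentum_const|.
pose cs := step_const + start_const.
have cs0 : 0 <= cs by exact: addr_ge0 step_const_ge0 start_const_ge0.
have C10 : 0 <= C1 by exact: expR_ge0.
have C20 : 0 <= C2 by exact: normr_ge0.
pose C := K + (C1 + (C2 + 1)).
have C21 : 0 <= C2 + 1 by exact: addr_ge0.
have KC : K <= C by rewrite lerDl; exact: addr_ge0.
have C1C : C1 <= C by rewrite /C addrCA lerDl; exact: addr_ge0.
have C2C : C2 <= C by rewrite /C [C2 + 1]addrC !addrA lerDr; apply: addr_ge0 => //; exact: addr_ge0.
have Cgt0 : 0 < C by rewrite /C !addrA ltr_wpDl //; apply: addr_ge0 => //; exact: addr_ge0.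
have [h00 /andP[h00_gt0 h00eta] small] := small_enough
  [:: 12 * M ^+ 2; 16 * M; cs; (K + 1) / rho; (c + 1) / rho] eta0.
exists C, h00; split=> // h z h0 hh0 z0 w0 num n nT.
have h0' := ltW h0; have heta := le_trans hh0 h00eta; have h1 := le_trans heta eta1.
have part := small h h0' hh0.
have hsq k : 0 <= k -> k * h ^+ 2 <= k * h.
  by move=> k0; rewrite ler_wpM2l // expr2 ler_piMl.
have under k : (k + 1) / rho * h <= 1 -> k * h < rho.
  rewrite mulrAC ler_pdivrMr // mul1r; apply: lt_le_trans.
  by rewrite mulrDl mul1r ltrDl.
have a3 : h ^+ 2 * (12 * M ^+ 2) <= 1.
  rewrite mulrC (le_trans (hsq _ _)) //; first by apply: mulr_ge0 => //; exact: sqr_ge0.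
  by apply: part; rewrite !inE eqxx.
have a4 : 16 * M * h <= 1 by apply: part; rewrite !inE eqxx ?orbT.
have a8 : cs * h <= 1 by apply: part; rewrite !inE eqxx ?orbT.
have a9 : K * h ^+ 2 < rho.
  apply: le_lt_trans (hsq _ K0) _; apply: under.
  by apply: part; rewrite !inE eqxx ?orbT.
have a10 : c * h < rho by apply: under; apply: part; rewrite !inE eqxx ?orbT.
have hh : 0 <= h ^+ 2 by exact: sqr_ge0.
have widen k r : k <= C -> r <= k * h ^+ 2 -> r <= C * h ^+ 2.
  by move=> kC /le_trans; apply; rewrite ler_wpM2r.
have pe := position_error h0 heta a3 a4 z0 w0 num a8 a9 nT.
split; first exact: widen KC pe.
have adm : admissible m h z by [].
have [mM1|mM1] : m = M1 \/ m <> M1 by case: (m); [left|right|right|right].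
  apply: widen C1C _.
  apply: (exponential_momentum_error h0 heta a3 a4 z0 w0 num a8 a9 mM1 CL0 _ nT).
  by move=> k kT; rewrite mM1 in adm; exact: local adm kT.
have du := difference_momentum_error h0 heta a3 a4 z0 w0 num a8 a9 mM1 nT.
by apply: widen C2C (le_trans du _); rewrite ler_wpM2r // ler_norm.
Qed.

End Convergence.

(** * Convergence of the four methods *)

(** Compactness turns the smoothness of the orbit and the local Lipschitz bounds
    into the uniform constants used above. *)
Lemma orbit_constants (R : realType) (B E : 'cV[R]_3 -> 'cV[R]_3) (L T a b : R)
    (s : trajectory R R) :
  0 < T -> a < 0 -> T < b -> is_solution B E `]a, b[ s ->
  smooth_trajectory `]a, b[ 3 s ->
  (forall r : R, 0 <= r <= T ->
     lipschitz_near L B (trj_x s r) /\ lipschitz_near L E (trj_x s r)) ->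
  exists M rho eta : R, [/\ 0 <= M, 0 < rho, 0 < eta, eta <= 1 &
    [/\ forall r u, 0 <= r <= T -> `|u - r| <= eta -> u \in `]a, b[,
        forall j r u, 0 <= r <= T -> `|u - r| <= eta -> (j <= 4)%N ->
          nrm (trajectory_jet s j u) <= M,
        forall r, 0 <= r <= T ->
          l2norm (B (trj_x s r)) <= M /\ l2norm (E (trj_x s r)) <= M &
        forall r p, 0 <= r <= T -> l2norm (p - trj_x s r) < rho ->
          [/\ l2norm (B p) <= M, l2norm (E p) <= M,
              l2norm (B p - B (trj_x s r)) <= M * l2norm (p - trj_x s r) &
              l2norm (E p - E (trj_x s r)) <= M * l2norm (p - trj_x s r)]]].
Proof.
move=> T0 a0 Tb sol smooth lip.
pose al := a / 2; pose be := (T + b) / 2.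
pose eta := Num.min 1 (Num.min (- al) (be - T)).
have eta0 : 0 < eta by rewrite !lt_min ltr01 /al /be; apply/andP; split; lra.
have [e1 e2 e3] : [/\ eta <= 1, eta <= - al & eta <= be - T].
  by rewrite /eta; split; rewrite !ge_min lexx ?orbT.
have near_orbit r u : 0 <= r <= T -> `|u - r| <= eta -> al <= u <= be.
  by move=> /andP[r0 rT]; rewrite ler_norml => /andP[u1 u2]; apply/andP; split; lra.
have inJ u : al <= u <= be -> u \in `]a, b[.
  by rewrite /al /be in_itv /= => /andP[u1 u2]; apply/andP; split; lra.
have inJ' u : al <= u <= be -> (`]a, b[%classic : set R) u.
  by move/inJ; rewrite inE.
have albe : al <= be by rewrite /al /be; lra.
have /fin_all_exists[Mj HMj] : forall j : 'I_5, exists N, forall u, al <= u <= be ->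
    nrm (trajectory_jet s j u) <= N.
  move=> j; apply: vcontinuous_bounded => // u /inJ' Ju.
  by apply: (trajectory_jet_continuous sol smooth) => //; rewrite -ltnS.
pose M1 := \sum_j `|Mj j|.
have M10 : 0 <= M1 by rewrite sumr_ge0.
have jetM j u : al <= u <= be -> (j <= 4)%N -> nrm (trajectory_jet s j u) <= M1.
  move=> uab j4; have j5 : (j < 5)%N by [].
  rewrite (le_trans (HMj (Ordinal j5) u uab)) // (le_trans (ler_norm _)) //.
  by rewrite /M1 (bigD1 (Ordinal j5)) //= lerDl sumr_ge0.
have xcont r : 0 <= r <= T -> forall e, 0 < e ->
    \forall u \near r, l2norm (trj_x s u - trj_x s r) < e.
  move=> rT e ep; pose C : R := (3 + 1)%:R * (2 * M1) + 1.
  have C0 : 0 < C by rewrite ltr_wpDl // !mulr_ge0.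
  have eC : 0 < e / C by rewrite divr_gt0.
  have close d : 0 < d -> \forall u \near r, `|u - r| < d.
    by move=> d0; apply/nbhs_ballP; exists d => //= v; rewrite /ball /= distrC.
  near=> u.
  have ue : `|u - r| <= eta by rewrite ltW //; near: u; exact: close.
  have uC : `|u - r| < e / C by near: u; exact: close.
  rewrite (le_lt_trans (position_le_state s s u r)) //.
  have := @taylor_vector R _ (trajectory_jet s) r u M1 1 M10.
  rewrite big_ord1 expr0 fact0 divr1 scale1r expr1 => H.
  apply: le_lt_trans (H _ _) _.
  - move=> j v; rewrite ltnS leqn0 => /eqP -> vr.
    apply: (trajectory_jet_derive sol smooth) => //; apply: inJ'.
    by apply: near_orbit rT (le_trans vr ue).
  - by move=> v vr; apply: jetM => //; apply: near_orbit rT (le_trans vr ue).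
  - rewrite ltr_pdivlMr // in uC; apply: le_lt_trans uC.
    by rewrite mulrC ler_wpM2l // lerDl.
have [rB [mB [rB0 mB0 HB]]] := lipschitz_tube xcont (fun r rT => (lip r rT).1).
have [rE [mE [rE0 mE0 HE]]] := lipschitz_tube xcont (fun r rT => (lip r rT).2).
pose rho := Num.min rB rE.
have rho0 : 0 < rho by rewrite lt_min rB0.
pose M := M1 + `|L| + 3 * (`|L| * rho + mB + mE).
have Lr : 0 <= `|L| * rho by rewrite mulr_ge0 // ltW.
have L0 : 0 <= `|L| by [].
have [M0 M1M LM BM EM] : [/\ 0 <= M, M1 <= M, `|L| <= M,
    3 * (`|L| * rho + mB) <= M & 3 * (`|L| * rho + mE) <= M].
  by rewrite /M; split; lra.
have mM m : 0 <= m -> 3 * (`|L| * rho + m) <= M -> m <= M by lra.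
have values (G : 'cV[R]_3 -> 'cV[R]_3) m p q : l2norm (p - q) < rho ->
    3 * (`|L| * rho + m) <= M -> l2norm (G q) <= m ->
    l2norm (G p - G q) <= `|L| * l2norm (p - q) -> l2norm (G p) <= M.
  move=> pq mM' Gq GL; have := l2norm_triangle (G p) (G q) 0.
  rewrite !subr0 => /le_trans; apply; apply: le_trans mM'.
  by rewrite ler_wpM2l // lerD // (le_trans GL) // ler_wpM2l // ltW.
have slope (G : 'cV[R]_3 -> 'cV[R]_3) p q :
    l2norm (G p - G q) <= `|L| * l2norm (p - q) ->
    l2norm (G p - G q) <= M * l2norm (p - q).
  by move/le_trans; apply; rewrite ler_wpM2r // l2norm_ge0.
exists M, rho, eta; split=> //; split.
- by move=> r u rT ur; apply: inJ; exact: near_orbit ur.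
- move=> j r u rT ur j4; apply: le_trans M1M; apply: jetM => //.
  exact: near_orbit ur.
- by move=> r rT; split; [apply: le_trans (mM _ mB0 BM); have [] := HB r rT
    |apply: le_trans (mM _ mE0 EM); have [] := HE r rT].
move=> r p rT; rewrite lt_min => /andP[pB pE].
have pr : l2norm (p - trj_x s r) < rho by rewrite lt_min pB.
have [B1 /(_ p pB) B2] := HB r rT; have [E1 /(_ p pE) E2] := HE r rT.
split; [exact: values pr BM B1 B2|exact: values pr EM E1 E2|exact: slope|].
exact: slope.
Unshelve. all: by end_near. Qed.

Theorem theorem1 (R : realType) :
  exists k : nat,
  forall (A : 'cV[R]_3 -> 'cV[R]_3) (U : 'cV[R]_3 -> R)
    (B E : 'cV[R]_3 -> 'cV[R]_3) (L T a b : R) (s : trajectory R R),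
  Ck_on setT k.+1 A ->
  Ck_on setT k.+1 (U : _ -> R^o) ->
  B = curl A ->
  E = (fun p => - grad U p) ->
  0 < T -> a < 0 -> T < b ->
  is_solution B E `]a, b[ s ->
  smooth_trajectory `]a, b[ k s ->
  (forall r : R, 0 <= r <= T ->
     lipschitz_near L B (trj_x s r) /\ lipschitz_near L E (trj_x s r)) ->
  forall m : method,
  exists C h0 : R, [/\ 0 < C, 0 < h0 &
    forall (h : R) (z : trajectory R nat),
    0 < h -> h <= h0 ->
    yvec z 0%N = yvec s 0 -> uvec z 0%N = uvec s 0 ->
    is_numerical_solution B E m h T z ->
    forall n : nat, n.+1%:R * h <= T ->
      l2normC (yvec z n.+1 - yvec s (n.+1%:R * h)) <= C * h ^+ 2 /\
      l2normC (uvec z n.+1 - uvec s (n.+1%:R * h)) <= C * h ^+ 2].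
Proof.
(* three derivatives of the momentum bound the remainder of the second difference *)
exists 3%N => A U B E L T a b s _ _ _ _ T0 a0 Tb sol smooth lip m.
have [M [rho [eta [M0 rho0 eta0 eta1 [inJ jetM BEM tube]]]]] :=
  orbit_constants T0 a0 Tb sol smooth lip.
have J r u : 0 <= r <= T -> `|u - r| <= eta -> (`]a, b[%classic : set R) u.
  by move=> rT ur; have := inJ r u rT ur; rewrite inE.
have J0 r : 0 <= r <= T -> (`]a, b[%classic : set R) r.
  by move=> rT; apply: (J r) => //; rewrite subrr normr0 ltW.
have [C [h0 [C0 h00 conv]]] := convergence T0 M0 rho0 eta0 eta1
  (erefl : trajectory_jet s 0 = yvec s) (trajectory_jet1 s)
  (fun r rT => trajectory_jet2 sol smooth (J0 r rT))
  (fun j r u rT ur j4 => trajectory_jet_derive sol smooth j4 (J r u rT ur))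
  jetM BEM tube m.
exists C, h0; split=> // h z hp hh0 y0 w0 num n nT.
have [H1 H2] := conv h z hp hh0 y0 w0 num n nT.
by split; [exact: le_trans (l2normC_le_nrm _) H1|exact: le_trans (l2normC_le_nrm _) H2].
Qed.
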